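(* Let $P$ be a countable right LCM semigroup which is decomposed as an internal Zappa-Szép product $P=U\bowtie A$, and suppose that: (C1) $U$ and $A$ are right LCM; (C2) $\mathcal{J}(A)$ is totally ordered by inclusion; (C3) the map $u\mapsto a\cdot u$ is a bijection $U\to U$ for each $a\in A$. Then $C^*_A(U\bowtie A)$ and $C^*_U(U\bowtie A)$ are groupoid $C^*$-algebras; more precisely, each of them is isomorphic to the groupoid $C^*$-algebra $C^*(\mathcal{G}_X(\mathcal{S}_P))$ for a suitable subset $X\subseteq E(\mathcal{S}_P)\times\mathcal{P}_{fin}(E(\mathcal{S}_P))$ (depending on which of the two algebras is considered).
   Context: Right LCM semigroups. A semigroup $P$ with identity $1_P$ is right LCM if it is left cancellative and the intersection of any two principal right ideals is either empty or a principal right ideal. $\mathcal{J}(P)$ is the set of all principal right ideals $pP$ together with $\varnothing$. A finite subset $F\subset P$ is a foundation set if for all $p\in P$ there is $f\in F$ with $fP\cap pP\ne\varnothing$. Left inverse hull. Let $U(P)$ be the group of invertible elements of $P$. On $P\times P$ put $(p,q)\sim(a,b)$ iff there is $u\in U(P)$ with $p=au$, $q=bu$; $[p,q]$ is the class of $(p,q)$. $\mathcal{S}_P=\{[p,q]:p,q\in P\}\cup\{0\}$ is an inverse semigroup with zero $0$ and identity $[1_P,1_P]$, with $[a,b][c,d]=[ab',dc']$ if $bP\cap cP=rP$ and $bb'=cc'=r$, $[a,b][c,d]=0$ if $bP\cap cP=\varnothing$, and $[p,q]^{-1}=[q,p]$. Internal Zappa-Szép product. $P=U\bowtie A$ means that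 $U,A\subseteq P$ are subsemigroups with $U\cap A=\{1_P\}$ such that every $p\in P$ is uniquely $p=ua$ with $u\in U$, $a\in A$. For $u\in U,a\in A$ write $au=(a\cdot u)\,a|_u$ with $a\cdot u\in U$, $a|_u\in A$. The $C^*$-algebras of $P$. $C^*(P)$ is the universal $C^*$-algebra generated by isometries $\{v_p:p\in P\}$ and projections $\{e_X:X\in\mathcal{J}(P)\}$ subject to: $v_pv_q=v_{pq}$; $v_pe_Xv_p^*=e_{pX}$; $e_P=1$, $e_\varnothing=0$; $e_Xe_Y=e_{X\cap Y}$ (for all $p,q\in P$, $X,Y\in\mathcal{J}(P)$). $C^*_A(U\bowtie A)$ is the quotient of $C^*(P)$ by the relations $e_{aP}=1$ for all $a\in A$. $C^*_U(U\bowtie A)$ is the quotient of $C^*(P)$ by the relations $\prod_{f\in F}(1-e_{fP})=0$ for all foundation sets $F\subseteq U$ of the semigroup $U$. The groupoids $\mathcal{G}_X(S)$. Let $S$ be an inverse semigroup with zero, $E(S)$ its semilattice of idempotents, $\mathbf{d}(s)=s^{-1}s$, $\le$ the natural partial order, $\mathcal{P}_{fin}(E(S))$ the set of finite subsets of $E(S)$, and $X\subseteq E(S)\times\mathcal{P}_{fin}(E(S))$. $X'$ is the smallest set containing $X$ such that $(e,\{e_1,\dots,e_n\})\in X'$ implies $(s^{-1}es,\{s^{-1}e_1s,\dots,s^{-1}e_ns\})\in X'$ for all $s\in S$. A character of $E(S)$ is a non-zero map $\varphi\colon E(S)\to\{0,1\}$ with $\varphi(0)=0$, $\varphi(ef)=\varphi(e)\wedge\varphi(f)$;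 $\widehat{E(S)}$ is the space of characters with the topology of pointwise convergence, and $\widehat{E(S)}_{X'}$ the closed subset of those with $\varphi(e)=\bigvee_i\varphi(e_i)$ for all $(e,\{e_1,\dots,e_n\})\in X'$. $S$ acts on $\widehat{E(S)}_{X'}$ by $(s\cdot\varphi)(e)=\varphi(s^{-1}es)$ when $\varphi(\mathbf{d}(s))=1$. $\mathcal{G}_X(S)$ is the groupoid of germs of this action: elements $[s,\varphi]$ with $\varphi\in\widehat{E(S)}_{X'}$, $\varphi(\mathbf{d}(s))=1$, where $[s,\varphi]=[t,\varphi]$ iff $se=te$ for some $e\in E(S)$ with $\varphi(e)=1$; $[s,\varphi]$ goes from $\varphi$ to $s\cdot\varphi$ and $[s,t\cdot\varphi][t,\varphi]=[st,\varphi]$. Its topology has as basis the sets $\{[s,\varphi]:\varphi(\mathbf{d}(s))=1,\ \varphi(\mathbf{d}(s_1))=\dots=\varphi(\mathbf{d}(s_n))=0\}$ with $n\ge0$, $s\in S$, $s_1,\dots,s_n\le s$. It is an étale groupoid whose unit space is Hausdorff with a basis of compact-open sets; the groupoid itself need not be Hausdorff. It is the groupoid dual, under non-commutative Stone duality, to the $X$-to-join Booleanization $\mathrm{B}_X(S)$, i.e. the Boolean inverse semigroup of compact-open bisections of $\mathcal{G}_X(S)$. $C^*(\mathcal{G})$ denotes the full groupoid $C^*$-algebra of an étale groupoid $\mathcal{G}$. *)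

(* Defs.v *)
From HB Require Import structures.
From mathcomp Require Import all_boot all_order all_algebra.
From mathcomp Require Import complex finmap generic_quotient.
From mathcomp Require Import boolp classical_sets functions cardinality fsbigop.
From mathcomp Require Import reals topology normedtype.

Set Implicit Arguments.
Unset Strict Implicit.
Unset Printing Implicit Defensive.

Import numFieldNormedType.Exports.
Import GRing.Theory Num.Theory.

Local Open Scope quotient_scope.
Local Open Scope classical_set_scope.
Local Open Scope group_scope.

(* P, U and A are all handled as subsets [M] of the ambient
   monoid [P]; principal ideals, foundation sets, ... are relative to [M]. *)
Section RightLCM.
Variable P : monoidType.
Implicit Types (M U A : set P) (p q : P).

Definition rideal M p : set P := [set p * m | m in M].

Definition right_lcm M : Prop :=
  [/\ M 1 /\ (forall x y, M x -> M y -> M (x * y)),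
      forall p x y, M p -> M x -> M y -> p * x = p * y -> x = y &
      forall p q, M p -> M q ->
        rideal M p `&` rideal M q = set0 \/
        exists2 r, M r & rideal M p `&` rideal M q = rideal M r].

Definition Jset M : set (set P) :=
  [set I | I = set0 \/ exists2 p, M p & I = rideal M p].

Definition foundation_set M (F : {fset P}) : Prop :=
  (forall f, f \in F -> M f) /\
  (forall p, M p -> exists2 f, f \in F & rideal M f `&` rideal M p !=set0).

Definition invertible p : Prop := exists q, p * q = 1 /\ q * p = 1.

Definition zappa_szep U A : Prop :=
  [/\ forall x y, U x -> U y -> U (x * y),
      forall x y, A x -> A y -> A (x * y),
      U `&` A = [set 1] &
      forall p, exists! ua : P * P, [/\ U ua.1, A ua.2 & p = ua.1 * ua.2]].

(* the U-component of p = u a *)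
Definition zs_left U A p : P :=
  (xget (1, 1) [set ua : P * P | [/\ U ua.1, A ua.2 & p = ua.1 * ua.2]]).1.

Definition zs_act U A (a u : P) : P := zs_left U A (a * u).

End RightLCM.

HB.mixin Record Semigroup_isInverse0 S of Semigroup S := {
  szero : S;
  sinv : S -> S;
  mul0s : forall s, szero * s = szero :> S;
  muls0 : forall s, s * szero = szero :> S;
  mulsVs : forall s, s * sinv s * s = s :> S;
  mulVsV : forall s, sinv s * s * sinv s = sinv s :> S;
  sinv_unique : forall s t, s * t * s = s :> S -> t * s * t = t :> S -> t = sinv s
}.

#[short(type="invSemigroupType")]
HB.structure Definition InvSemigroup := {S of Semigroup_isInverse0 S & Semigroup S}.

Section InvSemigroupTheory.
Variable S : invSemigroupType.
Implicit Types s t u e f : S.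

Lemma sinvK s : sinv (sinv s) = s.
Proof. by symmetry; apply: sinv_unique; rewrite ?mulVsV ?mulsVs. Qed.

Lemma sinv_idem e : e * e = e -> sinv e = e.
Proof. by move=> ee; symmetry; apply: sinv_unique; rewrite !ee. Qed.

Lemma idemM e f : e * e = e -> f * f = f -> (e * f) * (e * f) = e * f.
Proof.
move=> ee ff; set x := sinv (e * f).
have x1 : e * f * x * e * f = e * f by rewrite -(mulgA _ e f); exact: mulsVs.
have x2 : x * e * f * x = x by rewrite -(mulgA x e f); exact: mulVsV.
have xE : f * x * e = x.
  apply: sinv_unique.
  - by rewrite !mulgA -(mulgA e f f) ff -(mulgA _ e e) ee.
  - rewrite !mulgA -(mulgA _ e e) ee -(mulgA _ f f) ff.
    by rewrite -[in RHS]x2 !mulgA.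
have xx : x * x = x.
  transitivity (f * (x * e * f * x) * e); last by rewrite x2 xE.
  by rewrite -{1 2}xE !mulgA.
have -> : e * f = sinv x by rewrite /x sinvK.
by rewrite (sinv_idem xx).
Qed.

Lemma idemC e f : e * e = e -> f * f = f -> e * f = f * e.
Proof.
move=> ee ff; have := idemM ee ff; have := idemM ff ee.
rewrite !mulgA => fe ef.
rewrite -[LHS]sinv_idem ?mulgA//; symmetry; apply: sinv_unique.
- by rewrite !mulgA -(mulgA e f f) ff -(mulgA _ e e) ee.
- by rewrite !mulgA -(mulgA f e e) ee -(mulgA _ f f) ff.
Qed.

Lemma idem_dom s : (sinv s * s) * (sinv s * s) = sinv s * s.
Proof. by rewrite mulgA mulVsV. Qed.

Lemma idem_rng s : (s * sinv s) * (s * sinv s) = s * sinv s.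
Proof. by rewrite mulgA mulsVs. Qed.

Lemma conjM s e f : e * e = e -> f * f = f ->
  (sinv s * e * s) * (sinv s * f * s) = sinv s * (e * f) * s.
Proof.
move=> ee ff; have c := idemC (idem_rng s) ff.
rewrite !mulgA -(mulgA _ s (sinv s)) -(mulgA _ (s * sinv s) f) c !mulgA.
by rewrite -(mulgA _ s (sinv s)) -(mulgA _ (s * sinv s) s) mulsVs.
Qed.

Lemma sinvM s t : sinv (s * t) = sinv t * sinv s.
Proof.
symmetry; apply: sinv_unique.
- transitivity (s * ((t * sinv t) * (sinv s * s)) * t); first by rewrite !mulgA.
  rewrite (idemC (idem_rng t) (idem_dom s)) !mulgA mulsVs.
  by rewrite -!mulgA (mulgA t) mulsVs.
- transitivity (sinv t * ((sinv s * s) * (t * sinv t)) * sinv s).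
    by rewrite !mulgA.
  rewrite (idemC (idem_dom s) (idem_rng t)) !mulgA mulVsV.
  by rewrite -!mulgA (mulgA (sinv s)) mulVsV.
Qed.

End InvSemigroupTheory.

Section LeftHull.
Variables (P : monoidType) (hP : right_lcm [set: P]).
Implicit Types (p q a b c d : P).
Local Notation rideal := (rideal [set: P]).

Let lcan p x y : p * x = p * y -> x = y.
Proof. by case: hP => _ h _; exact: h. Qed.

Definition hull_rel : rel (P * P) := fun x y =>
  `[< exists u, [/\ invertible u, x.1 = y.1 * u & x.2 = y.2 * u] >].

Lemma hull_rel_equiv : equiv_class_of hull_rel.
Proof.
split=> [x|x y|y x z].
- by apply/asboolP; exists 1; split; rewrite ?mulg1//; exists 1; rewrite mulg1.
- suff sym x' y' : hull_rel x' y' -> hull_rel y' x' by apply/idP/idP; exact: sym.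
  move=> /asboolP[u [[w [uw wu]] h1 h2]]; apply/asboolP; exists w; split.
  + by exists u.
  + by rewrite h1 -mulgA uw mulg1.
  + by rewrite h2 -mulgA uw mulg1.
- move=> /asboolP[u [[w [uw wu]] h1 h2]] /asboolP[u' [[w' [uw' wu']] h1' h2']].
  apply/asboolP; exists (u' * u); split; last 2 first.
  + by rewrite h1 h1' mulgA.
  + by rewrite h2 h2' mulgA.
  + exists (w * w'); split.
      by rewrite -mulgA (mulgA u) uw mul1g.
    by rewrite -mulgA (mulgA w') wu' mul1g.
Qed.

Canonical hull_equiv := EquivRelPack hull_rel_equiv.
Canonical hull_encModRel := defaultEncModRel hull_rel.

(* [None] is the zero of the hull. *)
Definition left_hull of right_lcm [set: P] := option {eq_quot hull_equiv}.

HB.instance Definition _ := Choice.on (left_hull hP).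

Definition bracket p q : left_hull hP := Some (\pi_({eq_quot hull_equiv}) (p, q)).

(* [k = (b', c')] : b P `&` c P = r P and b b' = c c' = r *)
Definition hull_lcm b c (k : P * P) : Prop :=
  rideal b `&` rideal c = rideal (b * k.1) /\ b * k.1 = c * k.2.

Definition hull_mul (x y : left_hull hP) : left_hull hP :=
  match x, y with
  | Some x, Some y =>
    if pselect (exists k, hull_lcm (repr x).2 (repr y).1 k) is left h
    then bracket ((repr x).1 * (sval (cid h)).1) ((repr y).2 * (sval (cid h)).2)
    else None
  | _, _ => None
  end.

Definition hull_inv (x : left_hull hP) : left_hull hP :=
  if x is Some x then bracket (repr x).2 (repr x).1 else None.

(* A class [p, q] is determined by the partial bijection q x |-> p x. *)
Let graph (x : left_hull hP) : set (P * P) :=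
  if x is Some x then [set ((repr x).1 * z, (repr x).2 * z) | z in setT] else set0.

Let graph_bracket p q : graph (bracket p q) = [set (p * z, q * z) | z in setT].
Proof.
rewrite /graph /bracket; case: piP => -[a b] /= /eqmodP /asboolP[u [[w [uw wu]]]].
move=> /= -> ->; apply/seteqP; split=> _ [z _ <-].
- by exists (w * z) => //; rewrite -!mulgA !(mulgA u) uw !mul1g.
- by exists (u * z) => //; rewrite !mulgA.
Qed.

Lemma bracketP (x : left_hull hP) : x = None \/ exists p q, x = bracket p q.
Proof.
case: x => [x|]; [right|by left].
by exists (repr x).1, (repr x).2; rewrite /bracket -surjective_pairing reprK.
Qed.

Lemma bracket_eq p q u : invertible u -> bracket (p * u) (q * u) = bracket p q.
Proof. by move=> iu; congr Some; apply/eqmodP/asboolP; exists u. Qed.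

Let graph_inj : injective graph.
Proof.
move=> x y; case: (bracketP x) => [->|[p [q ->]]];
  case: (bracketP y) => [->|[a [b ->]]] //; rewrite ?graph_bracket /=.
- by move/seteqP => -[_ /(_ (a * 1, b * 1))]; case; exists 1.
- by move/seteqP => -[/(_ (p * 1, q * 1)) + _]; case; exists 1.
- move=> /seteqP[/(_ (p, q)) h1 /(_ (a, b)) h2].
  have [|v _ [av bv]] := h1; first by exists 1; rewrite ?mulg1.
  have [|u _ [pu qu]] := h2; first by exists 1; rewrite ?mulg1.
  rewrite -av -bv bracket_eq//; exists u; split.
    by apply: (@lcan a); rewrite mulgA av pu mulg1.
  by apply: (@lcan p); rewrite mulgA pu av mulg1.
Qed.

Let comp (f g : set (P * P)) : set (P * P) :=
  [set xz | exists2 y, f (xz.1, y) & g (y, xz.2)].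

Let hull_lcmP b c : rideal b `&` rideal c = set0 \/ exists k, hull_lcm b c k.
Proof.
case: hP => _ _ /(_ b c I I)[->|[r _ e]]; [by left|right].
have : rideal r r by exists 1; rewrite ?mulg1.
rewrite -e => -[[b' _ hb] [c' _ hc]]; exists (b', c'); split=> /=.
  by rewrite hb.
by rewrite hb hc.
Qed.

Let comp_bracket a b c d k : hull_lcm b c k ->
  comp (graph (bracket a b)) (graph (bracket c d)) =
  graph (bracket (a * k.1) (d * k.2)).
Proof.
move=> [e e']; rewrite !graph_bracket; apply/seteqP; split=> -[x z] /=.
- move=> [y [s _ [<- sy]] [t _ [ty <-]]].
  have : (rideal b `&` rideal c) y by split; [exists s|exists t].
  rewrite e => -[w _ wy]; exists w => //; congr (_, _); rewrite -mulgA.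
    by congr (_ * _); apply: (@lcan b); rewrite sy mulgA.
  by congr (_ * _); apply: (@lcan c); rewrite ty mulgA -e'.
- move=> [w _ [<- <-]]; exists (b * k.1 * w).
    by exists (k.1 * w); rewrite ?mulgA.
  by exists (k.2 * w); rewrite // !mulgA e'.
Qed.

Let comp_bracket0 a b c d : rideal b `&` rideal c = set0 ->
  comp (graph (bracket a b)) (graph (bracket c d)) = set0.
Proof.
move=> e; rewrite !graph_bracket -subset0 => -[x z] /=.
move=> [y [s _ [_ sy]] [t _ [ty _]]].
have : (rideal b `&` rideal c) y by split; [exists s|exists t].
by rewrite e.
Qed.

Let graph_mul x y : graph (hull_mul x y) = comp (graph x) (graph y).
Proof.
case: x => [x|]; last by apply/seteqP; split=> // -[? ?] [].
case: y => [y|]; last by apply/seteqP; split=> // -[? ?] [].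
have xE : Some x = bracket (repr x).1 (repr x).2.
  by rewrite /bracket -surjective_pairing reprK.
have yE : Some y = bracket (repr y).1 (repr y).2.
  by rewrite /bracket -surjective_pairing reprK.
rewrite [in RHS]xE [in RHS]yE /hull_mul.
case: pselect => [h|h]; first by rewrite -(comp_bracket _ _ (svalP (cid h))).
by rewrite comp_bracket0//; have [|//] := hull_lcmP (repr x).2 (repr y).1.
Qed.

Let graph_inv x : graph (hull_inv x) = [set z | graph x (z.2, z.1)].
Proof.
case: x => [x|]; last by apply/seteqP; split.
rewrite -[hull_inv _]/(bracket (repr x).2 (repr x).1) graph_bracket; apply/seteqP.
by split=> -[y z] /= [w _ [<- <-]]; exists w.
Qed.

Lemma hull_mulE a b c d b' c' r :
  rideal b `&` rideal c = rideal r -> b * b' = r -> c * c' = r ->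
  hull_mul (bracket a b) (bracket c d) = bracket (a * b') (d * c').
Proof.
move=> e hb hc; apply: graph_inj; rewrite graph_mul.
by rewrite (@comp_bracket _ _ _ _ (b', c'))//; split; rewrite /= hb.
Qed.

Lemma hull_mulE0 a b c d : rideal b `&` rideal c = set0 ->
  hull_mul (bracket a b) (bracket c d) = None.
Proof. by move=> e; apply: graph_inj; rewrite graph_mul comp_bracket0. Qed.

Lemma hull_invE p q : hull_inv (bracket p q) = bracket q p.
Proof.
apply: graph_inj; rewrite graph_inv !graph_bracket; apply/seteqP.
by split=> -[y z] /= [w _ [<- <-]]; exists w.
Qed.

Let graph_pbij x a b c d : graph x (a, b) -> graph x (c, d) -> a = c <-> b = d.
Proof.
case: (bracketP x) => [-> //|[p [q ->]]]; rewrite graph_bracket.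
move=> -[z _ [<- <-]] [w _ [<- <-]].
by split=> /lcan ->.
Qed.

Let hull_mulA : associative hull_mul.
Proof.
move=> x y z; apply: graph_inj; rewrite !graph_mul; apply/seteqP.
split=> -[a b] /=.
- by move=> [c xc [d yd zd]]; exists d => //; exists c.
- by move=> [d [c xc yd] zd]; exists c => //; exists d.
Qed.

HB.instance Definition _ := isSemigroup.Build (left_hull hP) hull_mulA.

Let hull_mul0s x : hull_mul None x = None. Proof. by []. Qed.

Let hull_muls0 x : hull_mul x None = None. Proof. by case: x. Qed.

Let hull_mulsVs x : hull_mul (hull_mul x (hull_inv x)) x = x.
Proof.
apply: graph_inj; rewrite !graph_mul graph_inv; apply/seteqP.
split=> -[a b] /=.
- by move=> [c [d xd /= xc] xb]; have -> : a = c by apply/(graph_pbij xd xc).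
- by move=> xab; exists a => //; exists b.
Qed.

Let hull_invK x : hull_inv (hull_inv x) = x.
Proof. by apply: graph_inj; rewrite !graph_inv; apply/seteqP; split=> -[]. Qed.

Let hull_mulVsV x : hull_mul (hull_mul (hull_inv x) x) (hull_inv x) = hull_inv x.
Proof. by rewrite -{2}[x]hull_invK hull_mulsVs. Qed.

Let hull_inv_unique x y : hull_mul (hull_mul x y) x = x ->
  hull_mul (hull_mul y x) y = y -> y = hull_inv x.
Proof.
move=> e1 e2; apply: graph_inj; rewrite graph_inv; apply/seteqP.
have g1 := congr1 graph e1; have g2 := congr1 graph e2.
rewrite !graph_mul in g1 g2.
split=> -[a b] /= h.
- move: (h); rewrite -{1}g2 => -[c [d yad xdc] ycb].
  have bd : b = d by apply/(graph_pbij h yad).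
  have ac : a = c by apply/(graph_pbij h ycb); rewrite bd.
  by rewrite ac bd.
- move: (h); rewrite -{1}g1 => -[c [d xbd ydc] xca].
  have ad : a = d by apply/(graph_pbij h xbd).
  have bc : b = c by apply/(graph_pbij h xca).
  by rewrite ad bc.
Qed.

HB.instance Definition _ := Semigroup_isInverse0.Build (left_hull hP)
  hull_mul0s hull_muls0 hull_mulsVs hull_mulVsV hull_inv_unique.

End LeftHull.

(* [gmul g h] is "g after h"; it is meaningful only when
   [gsrc g = grng h].  Objects embed in the arrows through [gid], and carry
   the topology induced by this embedding. *)
Record top_groupoid := TopGroupoid {
  gobj : Type;
  garr : topologicalType;
  gsrc : garr -> gobj;
  grng : garr -> gobj;
  gid : gobj -> garr;
  gmul : garr -> garr -> garr;
  ginv : garr -> garr;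
  gsrc_id : forall x, gsrc (gid x) = x;
  grng_id : forall x, grng (gid x) = x;
  gsrc_inv : forall g, gsrc (ginv g) = grng g;
  grng_inv : forall g, grng (ginv g) = gsrc g;
  gsrc_mul : forall g h, gsrc g = grng h -> gsrc (gmul g h) = gsrc h;
  grng_mul : forall g h, gsrc g = grng h -> grng (gmul g h) = grng g;
  gmulA : forall g h k, gsrc g = grng h -> gsrc h = grng k ->
    gmul g (gmul h k) = gmul (gmul g h) k;
  gmul1g : forall g, gmul (gid (grng g)) g = g;
  gmulg1 : forall g, gmul g (gid (gsrc g)) = g;
  gmulVg : forall g, gmul (ginv g) g = gid (gsrc g);
  gmulgV : forall g, gmul g (ginv g) = gid (grng g)
}.

Section Germs.
Variable S : invSemigroupType.
Implicit Types s t u : S.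

Definition idem : Type := {e : S | e * e == e}.
HB.instance Definition _ := Choice.on idem.
Implicit Types e f : idem.

Lemma idemE e : val e * val e = val e. Proof. exact/eqP/(valP e). Qed.

Definition idem0 : idem := exist _ (@szero S) (introT eqP (mul0s szero)).

Definition imul e f : idem :=
  exist _ (val e * val f) (introT eqP (idemM (idemE e) (idemE f))).

Definition dom s : idem := exist _ (sinv s * s) (introT eqP (idem_dom s)).

Lemma iconj_subproof s e :
  (sinv s * val e * s) * (sinv s * val e * s) == sinv s * val e * s.
Proof. by rewrite conjM ?idemE. Qed.

Definition iconj s e : idem := exist _ (sinv s * val e * s) (iconj_subproof s e).

Definition conj_stable (Y : set (idem * {fset idem})) : Prop :=
  forall s e (F : {fset idem}), Y (e, F) ->
    Y (iconj s e, [fset iconj s f | f in F]%fset).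

Definition conj_closure (X : set (idem * {fset idem})) :
  set (idem * {fset idem}) := smallest conj_stable X.

Definition is_character (phi : idem -> bool) : Prop :=
  [/\ exists e, phi e, phi idem0 = false &
      forall e f, phi (imul e f) = phi e && phi f].

Variable X : set (idem * {fset idem}).

Definition X_to_join (phi : idem -> bool) : Prop :=
  forall e (F : {fset idem}), conj_closure X (e, F) ->
    phi e = \big[orb/false]_(f <- F) phi f.

(* The characters in the closed set cut out by X'; pointwise convergence is the
   topology induced on them as units of the groupoid below. *)
Definition spectrum : Type :=
  {phi : idem -> bool | `[< is_character phi /\ X_to_join phi >]}.
HB.instance Definition _ := Choice.on spectrum.
Implicit Types phi psi : spectrum.

Lemma charP phi : is_character (val phi). Proof. by case: (asboolP _ (valP phi)). Qed.

Lemma joinP phi : X_to_join (val phi). Proof. by case: (asboolP _ (valP phi)). Qed.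

Lemma charM phi e f : val phi (imul e f) = val phi e && val phi f.
Proof. by case: (charP phi) => _ _; exact. Qed.

Lemma act_subproof s phi (h : val phi (dom s)) :
  `[< is_character (fun e => val phi (iconj s e)) /\
      X_to_join (fun e => val phi (iconj s e)) >].
Proof.
apply/asboolP; split; first split.
- exists (dom (sinv s)); suff -> : iconj s (dom (sinv s)) = dom s by [].
  by apply: val_inj; rewrite /= sinvK -!mulgA (mulgA s) mulsVs.
- case: (charP phi) => _ <- _; congr (val phi _); apply: val_inj => /=.
  by rewrite muls0 mul0s.
- move=> e f; rewrite -charM; congr (val phi _); apply: val_inj => /=.
  by rewrite conjM ?idemE.
- move=> e F XF.
  have /joinP -> : conj_closure X (iconj s e, [fset iconj s f | f in F]%fset).
    by move=> Y [Yc XY]; apply: (Yc); apply: XF.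
  apply/idP/idP; rewrite !big_has => /hasP[f].
    by case/imfsetP => /= f' f'F -> ?; apply/hasP; exists f'.
  by move=> fF ?; apply/hasP; exists (iconj s f) => //; apply/imfsetP; exists f.
Qed.

Definition act s phi (h : val phi (dom s)) : spectrum :=
  exist _ (fun e => val phi (iconj s e)) (act_subproof h).

Definition pregerm : Type := {p : S * spectrum | val p.2 (dom p.1)}.
HB.instance Definition _ := Choice.on pregerm.

Definition germ_rel : rel pregerm := fun p q =>
  `[< (val p).2 = (val q).2 /\
      exists2 e, val (val p).2 e & (val p).1 * val e = (val q).1 * val e >].

Lemma germ_rel_equiv : equiv_class_of germ_rel.
Proof.
split=> [p|p q|q p r].
- by apply/asboolP; split=> //; exists (dom (val p).1) => //; exact: (valP p).
- suff sym p' q' : germ_rel p' q' -> germ_rel q' p' by apply/idP/idP; exact: sym.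
  by move=> /asboolP[pq [e pe ee]]; apply/asboolP; split=> //; exists e; rewrite -?pq.
- move=> /asboolP[pq [e pe ee]] /asboolP[qr [f qf ff]]; apply/asboolP.
  rewrite pq qr; split=> //; exists (imul e f); rewrite /= ?charM.
    by rewrite -qr qf -pq pe.
  rewrite mulgA ee -mulgA (idemC (idemE e) (idemE f)).
  by rewrite mulgA ff -mulgA.
Qed.

Canonical germ_equiv := EquivRelPack germ_rel_equiv.
Canonical germ_encModRel := defaultEncModRel germ_rel.

Definition germs : Type := {eq_quot germ_equiv}.
HB.instance Definition _ := Choice.on germs.

Definition germ s phi (h : val phi (dom s)) : germs :=
  \pi_({eq_quot germ_equiv}) (exist _ (s, phi) h).

Lemma germ_eqP s t phi (hs : val phi (dom s)) (ht : val phi (dom t)) :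
  germ hs = germ ht <-> exists2 e, val phi e & s * val e = t * val e.
Proof.
split; first by move=> /eqmodP/asboolP[_].
by move=> h; apply/eqmodP/asboolP.
Qed.

Lemma germ_ext s t phi psi (hs : val phi (dom s)) (ht : val psi (dom t)) :
  phi = psi -> (exists2 e, val phi e & s * val e = t * val e) -> germ hs = germ ht.
Proof. by move=> E; subst psi; move/germ_eqP; exact. Qed.

Lemma germ_cast s phi psi (hs : val phi (dom s)) (hs' : val psi (dom s)) :
  phi = psi -> germ hs = germ hs'.
Proof. by move=> E; apply: germ_ext => //; case: (charP phi) => -[e pe] _ _; exists e. Qed.

Lemma germsP (g : germs) : exists s phi (h : val phi (dom s)), g = germ h.
Proof.
exists (val (repr g)).1, (val (repr g)).2, (valP (repr g)); rewrite -[LHS]reprK.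
by congr (\pi _); apply: val_inj; rewrite /= -surjective_pairing.
Qed.

Definition germ_src (g : germs) : spectrum := (val (repr g)).2.

Definition germ_rng (g : germs) : spectrum := act (valP (repr g)).

Lemma germ_srcE s phi (h : val phi (dom s)) : germ_src (germ h) = phi.
Proof. by rewrite /germ_src /germ; case: piP => p /eqmodP/asboolP[/= <-]. Qed.

Lemma act_eq s t phi (hs : val phi (dom s)) (ht : val phi (dom t)) e :
  val phi e -> s * val e = t * val e -> act hs = act ht.
Proof.
move=> pe se; apply: val_inj; apply/funext => f /=.
have E u : val phi (iconj u f) = val phi (iconj (u * val e) f).
  transitivity (val phi (imul e (imul (iconj u f) e))).
    by rewrite !charM pe andbT.
  congr (val phi _); apply: val_inj => /=.
  by rewrite sinvM (sinv_idem (idemE e)) !mulgA.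
by rewrite E se -E.
Qed.

Lemma germ_rngE s phi (h : val phi (dom s)) : germ_rng (germ h) = act h.
Proof.
rewrite /germ_rng /germ; case: piP => -[[t psi] ht] /eqmodP/asboolP[/= E].
move: ht; rewrite -{}E => ht [e pe se].
by apply: act_eq pe _; rewrite -se.
Qed.

Lemma mul_subproof s t phi psi (hs : val psi (dom s)) (ht : val phi (dom t)) :
  psi = act ht -> val phi (dom (s * t)).
Proof.
move=> E; move: hs; rewrite E /=.
suff -> : iconj t (dom s) = dom (s * t) by [].
by apply: val_inj; rewrite /= sinvM !mulgA.
Qed.

Definition germ_mul (g h : germs) : germs :=
  if pselect (germ_src g = germ_rng h) is left E
  then germ (mul_subproof (valP (repr g)) E) else g.

Let mul_germ_eq s s' t t' e f : s' * val e = s * val e -> t' * val f = t * val f ->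
  s' * t' * (val f * (sinv t * val e * t)) = s * t * (val f * (sinv t * val e * t)).
Proof.
move=> es et.
have K : t * (val f * (sinv t * val e * t)) = val e * t * val f.
  rewrite (idemC (idemE f) (idemE (iconj t e))) /= !mulgA; congr (_ * _).
  by rewrite (idemC (idem_rng t) (idemE e)) -!mulgA (mulgA t) mulsVs.
rewrite -[RHS]mulgA K -mulgA (mulgA t') et -(mulgA t) K.
by rewrite !mulgA es.
Qed.

Lemma germ_mulE s t phi (ht : val phi (dom t)) (hs : val (act ht) (dom s))
    (hst : val phi (dom (s * t))) : germ_mul (germ hs) (germ ht) = germ hst.
Proof.
rewrite /germ_mul; case: pselect => [E|]; last by rewrite germ_srcE germ_rngE.
move: E; rewrite /germ_src /germ_rng {1 2 3}/germ.
case: piP => -[[s' psi] hs'] /= /eqmodP/asboolP[/= Es].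
case: piP => -[[t' phi'] ht'] /= /eqmodP/asboolP[/= Et].
move: hs' ht'; rewrite -{}Es -{}Et => hs' ht' [f pf tf] [e pe se] E.
apply/germ_eqP; exists (imul f (iconj t e)).
  by rewrite charM; apply/andP; split; [exact: pf|exact: pe].
by apply: mul_germ_eq.
Qed.

Lemma inv_subproof s phi (h : val phi (dom s)) : val (act h) (dom (sinv s)).
Proof.
move=> /=; suff -> : iconj s (dom (sinv s)) = dom s by [].
by apply: val_inj; rewrite /= sinvK -!mulgA (mulgA s) mulsVs.
Qed.

Definition germ_inv (g : germs) : germs := germ (inv_subproof (valP (repr g))).

Lemma germ_invE s phi (h : val phi (dom s)) :
  germ_inv (germ h) = germ (inv_subproof h).
Proof.
rewrite /germ_inv {2}/germ; case: piP => -[[t psi] ht] /= /eqmodP/asboolP[/= E].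
move: ht; rewrite -{}E => ht [e pe se].
have A : act ht = act h := act_eq ht h pe (esym se).
apply: germ_ext; first exact: (act_eq _ _ pe (esym se)).
exists (iconj (sinv s) e).
  change (val phi (iconj t (iconj (sinv s) e))).
  have := congr1 (fun p : spectrum => val p (iconj (sinv s) e)) A => /= ->.
  suff -> : iconj s (iconj (sinv s) e) = imul (imul (dom s) e) (dom s).
    by rewrite !charM h /= andbT.
  by apply: val_inj; rewrite /= sinvK !mulgA.
rewrite /= sinvK.
have K : val e * sinv s = val e * sinv t.
  by rewrite -(sinv_idem (idemE e)) -!sinvM se.
have L u : sinv u * (u * val e * sinv u) = val e * sinv u.
  by rewrite !mulgA (idemC (idem_dom u) (idemE e)) -(mulgA (val e)) mulVsV.
have Q : s * val e * sinv s = t * val e * sinv t by rewrite -se -!mulgA K.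
by rewrite {1}Q !L K.
Qed.

(* Any idempotent of the filter [phi] gives the same germ, the unit at [phi]. *)
Lemma id_subproof phi : exists2 e, val phi e & val phi (dom (val e)).
Proof.
case: (charP phi) => -[e pe] _ _; exists e => //.
suff -> : dom (val e) = e by [].
by apply: val_inj; rewrite /= (sinv_idem (idemE e)) idemE.
Qed.

Definition germ_id phi : germs := germ (s2valP' (cid2 (id_subproof phi))).

Lemma germ_idE e phi (h : val phi (dom (val e))) : germ_id phi = germ h.
Proof.
rewrite /germ_id; case: cid2 => f pf hf /=; apply/germ_eqP.
exists (imul e f); rewrite /= ?charM ?pf ?andbT.
  suff <- : dom (val e) = e by [].
  by apply: val_inj; rewrite /= (sinv_idem (idemE e)) idemE.
by rewrite mulgA (idemC (idemE f) (idemE e)) -mulgA idemE mulgA idemE.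
Qed.

Definition natural_le s t : Prop := exists e, s = t * val e.

Definition basic (s : S) (l : seq S) : set germs :=
  [set g | exists phi (h : val phi (dom s)),
     g = germ h /\ all (fun t => ~~ val phi (dom t)) l].

Definition germ_basis : set (set germs) :=
  [set O | exists s l, (forall t, t \in l -> natural_le t s) /\ O = basic s l].

Let basis_cover : \bigcup_(O in germ_basis) O = [set: germs].
Proof.
apply/seteqP; split=> // g _; have [s [phi [h ->]]] := germsP g.
by exists (basic s [::]); [exists s, [::]|exists phi, h].
Qed.

Lemma domMi t phi e : val phi (dom (t * val e)) = val phi e && val phi (dom t).
Proof.
rewrite -charM; congr (val phi _); apply: val_inj => /=.
rewrite sinvM (sinv_idem (idemE e)) mulgA -(mulgA (val e)) -mulgA.
by rewrite (idemC (idem_dom t) (idemE e)) mulgA idemE.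
Qed.

Let basis_join (O O' : set germs) g : germ_basis O -> germ_basis O' -> O g -> O' g ->
  exists O'', [/\ germ_basis O'', O'' g & O'' `<=` O `&` O'].
Proof.
move=> [s [l [ls ->]]] [t [m [mt ->]]] [phi [hs [-> hl]]] [psi [ht [E hm]]].
have pp : phi = psi by rewrite -(germ_srcE hs) E germ_srcE.
subst psi; have /germ_eqP[e pe se] := E.
exists (basic (s * val e) [seq x * val e | x <- l ++ m]); split.
- exists (s * val e), [seq x * val e | x <- l ++ m]; split=> //.
  have C f : val f * val e = val e * val f by exact: (idemC (idemE f) (idemE e)).
  move=> _ /mapP[x + ->]; rewrite mem_cat => /orP[/ls|/mt] [f ->]; exists f.
    by rewrite -!mulgA C.
  by rewrite se -!mulgA C.
- exists phi; have h : val phi (dom (s * val e)) by rewrite domMi hs andbT; exact: pe.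
  exists h; split; first by apply/germ_eqP; exists e => //; rewrite -mulgA idemE.
  rewrite all_map all_cat; apply/andP; split.
    by apply: sub_all hl => x /negbTE xF; rewrite /= domMi xF andbF.
  by apply: sub_all hm => x /negbTE xF; rewrite /= domMi xF andbF.
- move=> _ [psi [h [-> ]]]; rewrite all_map all_cat => /andP[al am].
  have /andP[qe qs] : val psi e && val psi (dom s) by rewrite -domMi.
  have /andP[_ qt] : val psi e && val psi (dom t) by rewrite -domMi -se.
  have N x : ~~ val psi (dom (x * val e)) -> ~~ val psi (dom x).
    by rewrite domMi qe.
  split; [exists psi, qs|exists psi, qt]; split.
  + by apply/germ_eqP; exists e => //; rewrite -mulgA idemE.
  + by apply: sub_all al => x; exact: N.
  + by apply/germ_eqP; exists e => //; rewrite -mulgA idemE se.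
  + by apply: sub_all am => x; exact: N.
Qed.

HB.instance Definition _ := @isBaseTopological.Build germs
  (set germs) germ_basis id basis_cover basis_join.

Lemma germ_mul_act s t phi (ht : val phi (dom t)) (hs : val (act ht) (dom s))
  (hst : val phi (dom (s * t))) : act hst = act hs.
Proof.
apply: val_inj; apply/funext => e /=; congr (val phi _).
by apply: val_inj; rewrite /= sinvM !mulgA.
Qed.

Lemma germ_mulP g h : germ_src g = germ_rng h ->
  exists s t phi (ht : val phi (dom t)) (hs : val (act ht) (dom s))
    (hst : val phi (dom (s * t))),
  [/\ g = germ hs, h = germ ht & germ_mul g h = germ hst].
Proof.
have [s [psi [hs ->]]] := germsP g; have [t [phi [ht ->]]] := germsP h.
rewrite germ_srcE germ_rngE => E; subst psi.
exists s, t, phi, ht, hs, (mul_subproof hs (erefl (act ht))).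
by split=> //; exact: germ_mulE.
Qed.

Let src_id phi : germ_src (germ_id phi) = phi.
Proof. by rewrite /germ_id germ_srcE. Qed.

Lemma idem_act e phi (h : val phi (dom (val e))) : act h = phi.
Proof.
have pe : val phi e.
  suff <- : dom (val e) = e by [].
  by apply: val_inj; rewrite /= (sinv_idem (idemE e)) idemE.
apply: val_inj; apply/funext => f /=.
transitivity (val phi (imul (imul e f) e)); last by rewrite !charM pe andbT.
by congr (val phi _); apply: val_inj; rewrite /= (sinv_idem (idemE e)).
Qed.

Let rng_id phi : germ_rng (germ_id phi) = phi.
Proof. by case: (id_subproof phi) => e _ h; rewrite (germ_idE h) germ_rngE idem_act. Qed.

Lemma act_inv s phi (h : val phi (dom s)) (h' : val (act h) (dom (sinv s))) :
  act h' = phi.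
Proof.
apply: val_inj; apply/funext => f /=.
transitivity (val phi (imul (imul (dom s) f) (dom s))).
  by congr (val phi _); apply: val_inj; rewrite /= sinvK !mulgA.
by rewrite !charM h andbT.
Qed.

Let src_inv g : germ_src (germ_inv g) = germ_rng g.
Proof. by have [s [phi [h ->]]] := germsP g; rewrite germ_invE germ_srcE germ_rngE. Qed.

Let rng_inv g : germ_rng (germ_inv g) = germ_src g.
Proof.
by have [s [phi [h ->]]] := germsP g; rewrite germ_invE germ_srcE germ_rngE act_inv.
Qed.

Let src_mul g h : germ_src g = germ_rng h -> germ_src (germ_mul g h) = germ_src h.
Proof. by move=> /germ_mulP[s [t [phi [ht [hs [hst [-> -> ->]]]]]]]; rewrite !germ_srcE. Qed.

Let rng_mul g h : germ_src g = germ_rng h -> germ_rng (germ_mul g h) = germ_rng g.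
Proof.
move=> /germ_mulP[s [t [phi [ht [hs [hst [-> -> ->]]]]]]].
by rewrite !germ_rngE (germ_mul_act hs).
Qed.

Let mulA g h k : germ_src g = germ_rng h -> germ_src h = germ_rng k ->
  germ_mul g (germ_mul h k) = germ_mul (germ_mul g h) k.
Proof.
have [s [psi [hs ->]]] := germsP g.
move=> E /germ_mulP[t [u [phi [hu [ht [htu [hE -> ->]]]]]]].
move: E; rewrite {}hE germ_srcE germ_rngE => E; subst psi.
have hst := mul_subproof hs (erefl (act ht)); rewrite (germ_mulE _ hst).
have hs' : val (act htu) (dom s) by rewrite (germ_mul_act ht).
have hstu := mul_subproof hst (erefl (act hu)).
have hstu' := mul_subproof hs' (erefl (act htu)).
rewrite (germ_mulE _ hstu).
have -> : germ hs = germ hs'.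
  by apply: germ_cast; rewrite (germ_mul_act ht).
rewrite (germ_mulE _ hstu'); apply/germ_eqP.
by case: (charP phi) => -[e pe] _ _; exists e => //; rewrite !mulgA.
Qed.

Let mul_idem_l s phi (h : val phi (dom s)) e (he : val (act h) (dom (val e))) :
  germ_mul (germ he) (germ h) = germ h.
Proof.
have hes := mul_subproof he (erefl (act h)); rewrite (germ_mulE _ hes).
have pe : val phi (iconj s e).
  suff <- : dom (val e) = e by [].
  by apply: val_inj; rewrite /= (sinv_idem (idemE e)) idemE.
apply/germ_eqP; exists (iconj s e) => //=.
have c := idemC (idem_rng s) (idemE e).
rewrite !mulgA -(mulgA (val e) s (sinv s)) -(mulgA (val e) (s * sinv s) (val e)).
by rewrite !c (mulgA (val e) (val e)) idemE.
Qed.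

Let mul1 g : germ_mul (germ_id (germ_rng g)) g = g.
Proof.
have [s [phi [h ->]]] := germsP g; rewrite germ_rngE.
have [e _ he] := id_subproof (act h).
by rewrite (germ_idE he); exact: mul_idem_l.
Qed.

Let mulr1 g : germ_mul g (germ_id (germ_src g)) = g.
Proof.
have [s [phi [h ->]]] := germsP g; rewrite germ_srcE.
have [e pe he] := id_subproof phi; rewrite (germ_idE he).
have h' : val (act he) (dom s) by rewrite idem_act.
have -> : germ h = germ h'.
  by apply: germ_cast; rewrite idem_act.
have hse := mul_subproof h' (erefl (act he)); rewrite (germ_mulE _ hse).
have -> : germ h' = germ h.
  by apply: germ_cast; rewrite idem_act.
by apply/germ_eqP; exists e => //; rewrite -mulgA idemE.
Qed.

Let mulV g : germ_mul (germ_inv g) g = germ_id (germ_src g).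
Proof.
have [s [phi [h ->]]] := germsP g; rewrite germ_srcE germ_invE.
have hs := mul_subproof (inv_subproof h) (erefl (act h)).
by rewrite (germ_mulE _ hs) (@germ_idE (dom s) _ hs).
Qed.

Let mulrV g : germ_mul g (germ_inv g) = germ_id (germ_rng g).
Proof.
have [s [phi [h ->]]] := germsP g; rewrite germ_rngE germ_invE.
have h' : val (act (inv_subproof h)) (dom s) by rewrite act_inv.
have -> : germ h = germ h'.
  by apply: germ_cast; rewrite act_inv.
have hs := mul_subproof h' (erefl (act (inv_subproof h))).
rewrite (germ_mulE _ hs).
have e : s * sinv s = val (dom (sinv s)) by rewrite /= sinvK.
by move: hs; rewrite e => hs; rewrite -(@germ_idE (dom (sinv s)) _ hs).
Qed.

Definition germ_groupoid : top_groupoid :=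
  TopGroupoid src_id rng_id src_inv rng_inv src_mul rng_mul mulA mul1 mulr1 mulV mulrV.

Lemma germ_openE (O : set (garr germ_groupoid)) :
  open O <-> exists2 D' : set (set germs),
    D' `<=` germ_basis & \bigcup_(i in D') i = O.
Proof. by []. Qed.

End Germs.

Local Close Scope group_scope.
Local Open Scope ring_scope.

(* C*-algebras need not have a unit, and the zero algebra is allowed. *)
HB.mixin Record isCstar (R : realType) A of CompleteNormedModule R[i] A := {
  cmul : A -> A -> A;
  adj : A -> A;
  cmulA : associative cmul;
  cmulDl : left_distributive cmul +%R;
  cmulDr : right_distributive cmul +%R;
  cmulZl : forall (c : R[i]) (x y : A), cmul (c *: x) y = c *: cmul x y;
  cmulZr : forall (c : R[i]) (x y : A), cmul x (c *: y) = c *: cmul x y;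
  adjK : involutive adj;
  adjD : {morph adj : x y / x + y};
  adjZ : forall (c : R[i]) (x : A), adj (c *: x) = c^* *: adj x;
  adjM : forall x y, adj (cmul x y) = cmul (adj y) (adj x);
  cnormM : forall x y, `|cmul x y| <= `|x| * `|y|;
  cnorm_adj : forall x, `|cmul (adj x) x| = `|x| ^+ 2
}.

#[short(type="cstarType")]
HB.structure Definition Cstar (R : realType) :=
  {A of isCstar R A & CompleteNormedModule R[i] A}.

Notation "x ** y" := (cmul x y) (at level 40, left associativity) : ring_scope.

Section CstarAlgebras.
Variable R : realType.
Implicit Types B C D : cstarType R.

Definition is_unit B (one : B) : Prop :=
  forall x, one ** x = x /\ x ** one = x.

Definition is_projection B (p : B) : Prop := adj p = p /\ p ** p = p.

Definition star_hom B D (h : B -> D) : Prop :=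
  [/\ forall x y, h (x + y) = h x + h y,
      forall (c : R[i]) x, h (c *: x) = c *: h x,
      forall x y, h (x ** y) = h x ** h y &
      forall x, h (adj x) = adj (h x)].

Definition isomorphic B D : Prop :=
  exists2 h : B -> D, star_hom h & bijective h.

Definition closed_ideal B (I : set B) : Prop :=
  [/\ I 0, forall x y, I x -> I y -> I (x + y),
      forall (c : R[i]) x, I x -> I (c *: x),
      forall x y, I x -> I (x ** y) /\ I (y ** x) &
      closed I].

(* [q] exhibits [B] as the quotient of [C] by the closed ideal generated by
   the set of relators [W]. *)
Definition is_quotient C (W : set C) B (q : C -> B) : Prop :=
  [/\ star_hom q, (forall y, exists x, q x = y) &
      q @^-1` [set 0] = smallest (@closed_ideal C) W].

End CstarAlgebras.

Section GroupoidCstar.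
Variables (R : realType) (G : top_groupoid).
Local Notation arr := (garr G).
Implicit Types (f g : arr -> R[i]).

Definition open_bisection (V : set arr) : Prop :=
  [/\ open V, {in V &, injective (@gsrc G)} & {in V &, injective (@grng G)}].

(* A function in C_c(V), extended by zero, for some open bisection V; such
   functions need not be continuous on a non-Hausdorff G. *)
Definition bisection_function f : Prop :=
  exists V K : set arr,
    [/\ open_bisection V, compact K, K `<=` V,
        forall x, ~ K x -> f x = 0 &
        forall x, V x -> {for x, continuous (f : arr -> R[i]^o)}].

(* Connes' algebra C_c(G): the linear span of the previous functions. *)
Definition Cc : set (arr -> R[i]) :=
  [set f | exists n (b : 'I_n -> arr -> R[i]),
     (forall i, bisection_function (b i)) /\ f = fun x => \sum_(i < n) b i x].

(* The sum has finitely many nonzero terms for f and g in C_c(G), G étale. *)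
Definition convolution f g : arr -> R[i] := fun x =>
  \sum_(yz \in [set yz : arr * arr |
                 gsrc yz.1 = grng yz.2 /\ gmul yz.1 yz.2 = x]) f yz.1 * g yz.2.

Definition involution f : arr -> R[i] := fun x => (f (ginv x))^*.

(* Only the values on [Cc] matter. *)
Definition Cc_star_hom (D : cstarType R) (pi : (arr -> R[i]) -> D) : Prop :=
  [/\ forall f g, Cc f -> Cc g -> pi (fun x => f x + g x) = pi f + pi g,
      forall (c : R[i]) f, Cc f -> pi (fun x => c * f x) = c *: pi f,
      forall f g, Cc f -> Cc g -> pi (convolution f g) = pi f ** pi g &
      forall f, Cc f -> pi (involution f) = adj (pi f)].

(* [D] is the completion of C_c(G), through [iota], for the greatest
   C*-seminorm on C_c(G); this determines (D, iota) up to isomorphism. *)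
Definition is_groupoid_cstar (D : cstarType R) (iota : (arr -> R[i]) -> D) : Prop :=
  [/\ Cc_star_hom iota, dense (iota @` Cc) &
      forall (D' : cstarType R) (pi : (arr -> R[i]) -> D'), Cc_star_hom pi ->
        forall f, Cc f -> `|pi f| <= `|iota f|].

End GroupoidCstar.

Section SemigroupCstar.
Variables (R : realType) (P : monoidType).
Local Notation J := (Jset [set: P]).
Local Notation rideal := (rideal [set: P]).
Implicit Types (B C D : cstarType R) (U A : set P).

(* [v] and [e] are families of isometries and projections satisfying the
   defining relations; only the values of [e] on [J] matter. *)
Definition semigroup_rep B (one : B) (v : P -> B) (e : set P -> B) : Prop :=
  [/\ is_unit one,
      (forall p, adj (v p) ** v p = one) /\ (forall X, J X -> is_projection (e X)),
      forall p q, v p ** v q = v (p * q)%g,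
      forall p X, J X -> v p ** e X ** adj (v p) = e [set (p * x)%g | x in X] &
      [/\ e [set: P] = one, e set0 = 0 &
          forall X Y, J X -> J Y -> e X ** e Y = e (X `&` Y)]].

Definition is_semigroup_cstar C (one : C) (v : P -> C) (e : set P -> C) : Prop :=
  semigroup_rep one v e /\
  forall D (one' : D) (v' : P -> D) (e' : set P -> D), semigroup_rep one' v' e' ->
    exists! h : C -> D,
      [/\ star_hom h, forall p, h (v p) = v' p & forall X, J X -> h (e X) = e' X].

Section Relators.
Variables (U A : set P) (C : cstarType R) (one : C) (e : set P -> C).

Definition relators_A : set C := [set one - e (rideal a) | a in A].

(* The factors commute, so their order is immaterial. *)
Definition relators_U : set C :=
  [set \big[@cmul R C/one]_(f <- F) (one - e (rideal f)) | F in foundation_set U].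

End Relators.

(* [q : C -> B] exhibits [B] as C*_A(P), resp. C*_U(P), where C = C*(P). *)
Definition is_cstar_A A B : Prop :=
  exists C (one : C) v e (q : C -> B),
    is_semigroup_cstar one v e /\ is_quotient (relators_A A one e) q.

Definition is_cstar_U U B : Prop :=
  exists C (one : C) v e (q : C -> B),
    is_semigroup_cstar one v e /\ is_quotient (relators_U U one e) q.

End SemigroupCstar.

(* Main.v *)
Require Import Defs.
From HB Require Import structures.
From mathcomp Require Import all_boot all_order all_algebra.
From mathcomp Require Import complex finmap generic_quotient.
From mathcomp Require Import boolp classical_sets functions cardinality fsbigop.
From mathcomp Require Import reals topology normedtype.
From mathcomp Require Import ring lra.
Import Defs.

Set Implicit Arguments.
Unset Strict Implicit.
Unset Printing Implicit Defensive.

Import Order.TTheory GRing.Theory Num.Theory.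
Import numFieldNormedType.Exports.

Local Open Scope classical_set_scope.
Local Open Scope ring_scope.

(** The quotient [B] of C*(P) is itself a full groupoid C*-algebra.  Each of the
    two quotients is cut out by relators prod_(f in F) (1 - e_(fP)), where [F]
    runs over a family of finite subsets of [P]: the singletons of [A] for the
    first algebra, the foundation sets of [U] for the second.  The set [X] is the
    translation of these relators: the unit [1, 1] of the left inverse hull [S] is
    the join of the idempotents [f, f], for [f] in [F] ([hull_relations]).

    The elements v_p v_q^* of [B] form a representation [T] of [S]
    ([hull_rep_srep]), and [T] satisfies the relations in [X] and hence all their
    conjugates ([obeys_conj]).  A finite linear combination of elements of [S]
    has two readings: a function on the groupoid of germs, [steinberg L], where
    [s] stands for the indicator of the bisection of all germs of [s], and an
    element of [B], [lincomb T L].  The core of the proof is the inequality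
    [key_estimate]: the norm of [lincomb T L] is at most [n] times the supremum of
    |steinberg L|, where [n] is the number of bisections that carry [L].  It shows
    at once that the second reading depends on the first only, and that it extends
    to uniform limits.  It is proved by localization.  Multiply by the projections
    T_e and 1 - T_e along an enumeration of the idempotents; if the estimate
    failed, it would fail on a decreasing sequence of nonzero products, and such a
    sequence is a character satisfying [X] ([compact_induction]).  Close to a
    character, however, distinct germs stay distinct and equal germs stay equal,
    so the combination becomes a sum of at most [n] terms T_s z with [z] a scalar
    value of the function.

    Functions in C_c are sums of functions [carry s f] with [f] continuous on the
    spectrum ([bisection_carry]), and these are uniform limits of [steinberg L]
    ([cts_approx]), so the estimate yields a star-homomorphism [groupoid_iota] of
    C_c into [B].  Its range is dense because the closed span of the v_p v_q^*
    already has the universal property of C*(P) ([span_dense]).  If [pi] is another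
    star-homomorphism of C_c, the elements pi(1_s) generate a representation of
    [P], in the corner of the target whose unit is the image of [1, 1], and this
    representation kills the relators; so it factors through [B], and [pi] is
    [groupoid_iota] followed by a star-homomorphism ([iota_universal]).

    Star-homomorphisms are purely algebraic in all of this.  That those between
    C*-algebras are contractive ([hom_contract]), and that [pi] is bounded on each
    bisection ([pi_carry_bound]), rests on writing self-adjoint elements as real or
    imaginary parts of unitaries. *)

(** * Norms and completeness *)

Lemma small_scale (R : realType) (K d : R) : 0 <= K -> 0 < d ->
  exists c : R, [/\ 0 < c, c <= 1 & c * K <= d].
Proof.
move=> K0 d0; have K1 : 0 < K + 1 by lra.
exists (Num.min 1 (d / (K + 1))); split.
- by rewrite lt_min ltr01 divr_gt0.
- by rewrite ge_min lexx.
have : Num.min 1 (d / (K + 1)) * (K + 1) <= d.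
  by rewrite -ler_pdivlMr// ge_min lexx orbT.
have : 0 <= Num.min 1 (d / (K + 1)) by rewrite le_min ler01 divr_ge0 ?ltW.
nra.
Qed.

Section RealNorm.
Variables (R : realType) (V : normedZmodType R[i]).
Implicit Types x y : V.

(** The norm is a complex number with zero imaginary part; its real part lives in
    an ordered field. *)
Definition nrm x : R := complex.Re `|x|.

Lemma nrmE x : `|x| = (nrm x)%:C%C.
Proof. by rewrite /nrm RRe_real// ger0_real. Qed.

Lemma nrm_ge0 x : 0 <= nrm x.
Proof. by rewrite -ler0c -nrmE. Qed.

Lemma nrm0 : nrm 0 = 0. Proof. by rewrite /nrm normr0. Qed.

Lemma nrm_eq0 x : nrm x = 0 -> x = 0.
Proof. by move=> h; apply/eqP; rewrite -normr_eq0 nrmE h. Qed.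

Lemma nrmD x y : nrm (x + y) <= nrm x + nrm y.
Proof. by rewrite -lecR rmorphD /= -!nrmE ler_normD. Qed.

Lemma nrmN x : nrm (- x) = nrm x.
Proof. by rewrite /nrm normrN. Qed.

Lemma nrmBC x y : nrm (x - y) = nrm (y - x).
Proof. by rewrite -nrmN opprB. Qed.

Lemma nrmB x y : nrm (x - y) <= nrm x + nrm y.
Proof. by rewrite -(nrmN y) nrmD. Qed.

Lemma nrmB3 y x z : nrm (x - z) <= nrm (x - y) + nrm (y - z).
Proof. by rewrite (le_trans _ (nrmD _ _))// addrA subrK. Qed.

Lemma nrm_sum I (r : seq I) (P : pred I) (F : I -> V) :
  nrm (\sum_(i <- r | P i) F i) <= \sum_(i <- r | P i) nrm (F i).
Proof.
elim/big_rec2: _ => [|i y x _ h]; first by rewrite nrm0.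
by rewrite (le_trans (nrmD _ _))// lerD2l.
Qed.

Lemma nrm_le0 x : (forall e, 0 < e -> nrm x <= e) -> x = 0.
Proof.
move=> h; apply: nrm_eq0; apply/eqP; rewrite eq_le nrm_ge0 andbT.
by apply/ler_addgt0Pl => e /h; rewrite addr0.
Qed.

Lemma nrm_sub0 x y : (forall e, 0 < e -> nrm (x - y) <= e) -> x = y.
Proof. by move=> h; apply/eqP; rewrite -subr_eq0; apply/eqP/nrm_le0. Qed.

End RealNorm.

Section RealNormModule.
Variable R : realType.

Lemma nrmZ (V : normedModType R[i]) (c : R[i]) (x : V) :
  nrm (c *: x) = nrm c * nrm x.
Proof. by apply: complexI; rewrite rmorphM /= -!nrmE normrZ. Qed.

Lemma nrmM (c d : R[i]) : nrm (c * d) = nrm c * nrm d.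
Proof. by apply: complexI; rewrite rmorphM /= -!nrmE normrM. Qed.

Lemma nrm_real (x : R) : nrm (x%:C)%C = `|x|.
Proof. by apply: complexI; rewrite -nrmE normc_def /= expr0n addr0 sqrtr_sqr. Qed.

Lemma nrm1 : nrm (1 : R[i]) = 1.
Proof. by rewrite /nrm normr1. Qed.

Lemma nrm_conj (c : R[i]) : nrm c^* = nrm c.
Proof. by rewrite /nrm norm_conjC. Qed.

Lemma nrm_i : nrm ('i : R[i]) = 1.
Proof. by rewrite /nrm normCi. Qed.

Lemma nearby_ball (V : normedModType R[i]) (x : V) (e : R) : 0 < e ->
  nbhs x [set y | nrm (x - y) < e].
Proof.
move=> e0; apply/nbhs_ballP; exists (e%:C)%C; first by rewrite /= ltcR.
by move=> y; rewrite -ball_normE /= nrmE ltcR.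
Qed.

Lemma nbhs_nrmP (V : normedModType R[i]) (x : V) (O : set V) :
  nbhs x O <-> exists2 e : R, 0 < e & forall y, nrm (x - y) < e -> O y.
Proof.
split=> [/nbhs_ballP[e /= e0 h]|[e e0 h]]; last exact: filterS (nearby_ball x e0).
exists (complex.Re e).
  by move: e0; rewrite ltcE /= => /andP[].
move=> y hy; apply: h; rewrite -ball_normE /= nrmE.
by rewrite -(RRe_real (gtr0_real e0)) ltcR.
Qed.

(** The sets [G e] form a basis of a Cauchy filter; indexing by the error
    instead of by a sequence spares any choice of approximants. *)
Lemma cauchy_family (V : completeNormedModType R[i]) (G : R -> set V) :
  (forall e, 0 < e -> exists x, G e x) ->
  (forall e d, 0 < e -> e <= d -> G e `<=` G d) ->
  (forall e x y, 0 < e -> G e x -> G e y -> nrm (x - y) <= e) ->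
  exists l, forall e x, 0 < e -> G e x -> nrm (x - l) <= e.
Proof.
move=> Gne Gmono Gd.
pose F : set_system V := filter_from [set e | 0 < e] G.
have FF : Filter F.
  apply: filter_from_filter; first by exists 1 => /=.
  move=> e d /= e0 d0; exists (Num.min e d); first by rewrite /= lt_min e0.
  have m0 : 0 < Num.min e d by rewrite lt_min e0.
  by move=> x Gx; split; apply: Gmono Gx; rewrite ?ge_min ?lexx ?orbT.
have PF : ProperFilter F.
  by apply: filter_from_proper => e /Gne[x ?]; exists x.
have /cauchy_cvg/cvg_ex[l Fl] : cauchy F.
  apply/cauchy_ballP => e e0; have : 0 < complex.Re e.
    by move: e0; rewrite ltcE /= => /andP[].
  move=> re0; have r2 : 0 < complex.Re e / 2 by rewrite divr_gt0.
  exists (G (complex.Re e / 2), G (complex.Re e / 2)) => /=.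
    by split; exists (complex.Re e / 2).
  move=> [x y] /= [Gx Gy]; rewrite -ball_normE /= nrmE -(RRe_real (gtr0_real e0)).
  by rewrite ltcR (le_lt_trans (Gd _ _ _ r2 Gx Gy))// ltr_pdivrMr// ltr_pMr// ltr1n.
exists l => e x e0 Gx; apply/ler_addgt0Pr => d d0.
have [c /= c0 Gc] := Fl _ (nearby_ball l d0).
have m0 : 0 < Num.min c e by rewrite lt_min c0.
have [y Gy] := Gne _ m0.
have yc : G c y by apply: Gmono Gy; rewrite ?ge_min ?lexx.
have ye : G e y by apply: Gmono Gy; rewrite ?ge_min ?lexx ?orbT.
rewrite (le_trans (nrmB3 y _ _))// lerD//; first exact: Gd ye.
by have := Gc _ yc; rewrite /= nrmBC; exact: ltW.
Qed.

End RealNormModule.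

(** * Star-homomorphisms are contractive *)

Section CstarBasics.
Variables (R : realType) (A : cstarType R).
Implicit Types (x y z : A) (c : R[i]).

Lemma cmul0x x : 0 ** x = 0.
Proof. by have := cmulZl 0 0 x; rewrite !scale0r. Qed.

Lemma cmulx0 x : x ** 0 = 0.
Proof. by have := cmulZr 0 x 0; rewrite !scale0r. Qed.

Lemma cmulNx x y : (- x) ** y = - (x ** y).
Proof. by rewrite -scaleN1r cmulZl scaleN1r. Qed.

Lemma cmulxN x y : x ** (- y) = - (x ** y).
Proof. by rewrite -scaleN1r cmulZr scaleN1r. Qed.

Lemma cmulBl x y z : (x - y) ** z = x ** z - y ** z.
Proof. by rewrite cmulDl cmulNx. Qed.

Lemma cmulBr x y z : z ** (x - y) = z ** x - z ** y.
Proof. by rewrite cmulDr cmulxN. Qed.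

Lemma cmul_suml I (r : seq I) (P : pred I) (F : I -> A) x :
  (\sum_(i <- r | P i) F i) ** x = \sum_(i <- r | P i) F i ** x.
Proof. by elim/big_rec2: _ => [|i y z _ <-]; rewrite ?cmul0x ?cmulDl. Qed.

Lemma cmul_sumr I (r : seq I) (P : pred I) (F : I -> A) x :
  x ** (\sum_(i <- r | P i) F i) = \sum_(i <- r | P i) x ** F i.
Proof. by elim/big_rec2: _ => [|i y z _ <-]; rewrite ?cmulx0 ?cmulDr. Qed.

Lemma adj0 : adj (0 : A) = 0.
Proof. by have := adjZ 0 (0 : A); rewrite conjC0 !scale0r. Qed.

Lemma adjN x : adj (- x) = - adj x.
Proof. by rewrite -scaleN1r adjZ rmorphN rmorph1 scaleN1r. Qed.

Lemma adjB x y : adj (x - y) = adj x - adj y.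
Proof. by rewrite adjD adjN. Qed.

Lemma adj_sum I (r : seq I) (P : pred I) (F : I -> A) :
  adj (\sum_(i <- r | P i) F i) = \sum_(i <- r | P i) adj (F i).
Proof. by elim/big_rec2: _ => [|i y z _ <-]; rewrite ?adj0 ?adjD. Qed.

Lemma nrm_cmul x y : nrm (x ** y) <= nrm x * nrm y.
Proof. by rewrite -lecR rmorphM /= -!nrmE cnormM. Qed.

Lemma nrm_Cstar x : nrm (adj x ** x) = nrm x ^+ 2.
Proof. by apply: complexI; rewrite rmorphXn /= -!nrmE cnorm_adj. Qed.

(** From |y|^2 = |y^* y| <= |y^*| |y|, applied to [x] and to its adjoint. *)
Lemma nrm_adj x : nrm (adj x) = nrm x.
Proof.
suff h y : nrm y <= nrm (adj y) by apply/eqP; rewrite eq_le h -{2}(adjK x) h.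
have [->|y0] := eqVneq (nrm y) 0; first exact: nrm_ge0.
have yp : 0 < nrm y by rewrite lt_neqAle eq_sym y0 nrm_ge0.
by rewrite -(ler_pM2r yp) -expr2 -nrm_Cstar nrm_cmul.
Qed.

Lemma nrm_proj x : is_projection x -> nrm x <= 1.
Proof.
move=> [xa xx]; have := nrm_Cstar x; rewrite xa xx => h.
have := nrm_ge0 x; nra.
Qed.

Lemma nrm_isometry x y : adj x ** x = y -> is_projection y -> nrm x <= 1.
Proof.
move=> h /nrm_proj; rewrite -h nrm_Cstar => hx.
have := nrm_ge0 x; nra.
Qed.

Lemma nrm_mul_dist (c : R) x y x' y' : c <= 1 ->
  nrm (x - x') <= c -> nrm (y - y') <= c ->
  nrm (x ** y - x' ** y') <= c * (nrm x + nrm y + 1).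
Proof.
move=> c1 xx yy.
have -> : x ** y - x' ** y' = (x - x') ** y + x' ** (y - y').
  by rewrite cmulBl cmulBr addrA subrK.
have := nrmB3 x x' 0; rewrite !subr0 nrmBC => x1.
have p1 := nrm_cmul (x - x') y; have p2 := nrm_cmul x' (y - y').
have q1 : nrm (x - x') * nrm y <= c * nrm y by rewrite ler_wpM2r ?nrm_ge0.
have q2 : nrm x' * nrm (y - y') <= (nrm x + 1) * c.
  by rewrite ler_pM ?nrm_ge0//; lra.
by rewrite (le_trans (nrmD _ _))//; lra.
Qed.

Lemma unit_adj (one : A) : is_unit one -> adj one = one.
Proof.
move=> u; have := congr1 (@adj R A) (u (adj one)).1.
by rewrite adjM adjK (u (adj one)).1.
Qed.

End CstarBasics.

(** The multiplicative constant 4 disappears when the exponent grows. *)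
Lemma le_of_pow2 (R : realType) (a b : R) : 0 <= a -> 0 <= b ->
  (forall n, a ^+ (2 ^ n) <= 4 * b ^+ (2 ^ n)) -> a <= b.
Proof.
move=> a0 b0 hn; rewrite leNgt; apply/negP => ba.
have [b0'|bN0] := eqVneq b 0.
  by have := hn 0%N; rewrite b0' expn0 !expr1 mulr0; move: ba; rewrite b0'; lra.
have bp : 0 < b by rewrite lt_neqAle eq_sym bN0.
pose d := a / b - 1.
have ab : a = b * (1 + d) by rewrite /d addrC subrK mulrC divfK.
have d0 : 0 < d by rewrite /d subr_gt0 ltr_pdivlMr// mul1r.
have bern n : 1 + n%:R * d <= (1 + d) ^+ n.
  elim: n => [|n ih]; first by rewrite expr0 mul0r addr0.
  rewrite exprS -natr1; have : 0 <= n%:R :> R by [].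
  nra.
have := archi_boundP (_ : 0 <= 4 / d); rewrite divr_ge0 ?(ltW d0)// => /(_ isT).
set n := Num.bound _ => nd.
have := hn n; rewrite {1}ab exprMn mulrC ler_pM2r ?exprn_gt0// => h4.
have := bern (2 ^ n)%N.
have : n%:R <= (2 ^ n)%:R :> R by rewrite ler_nat ltnW// ltn_expl.
move: nd; rewrite ltr_pdivrMr// => nd.
nra.
Qed.

Section Contractivity.
Variables (R : realType) (A B : cstarType R) (h : A -> B).
Hypothesis hh : star_hom h.

Let hD x y : h (x + y) = h x + h y. Proof. by case: hh. Qed.
Let hZ c x : h (c *: x) = c *: h x. Proof. by case: hh. Qed.
Let hM x y : h (x ** y) = h x ** h y. Proof. by case: hh. Qed.
Let hA x : h (adj x) = adj (h x). Proof. by case: hh. Qed.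

Lemma hom0 : h 0 = 0.
Proof. by have := hZ 0 0; rewrite !scale0r. Qed.

Lemma homN x : h (- x) = - h x.
Proof. by rewrite -scaleN1r hZ scaleN1r. Qed.

Lemma homB x y : h (x - y) = h x - h y.
Proof. by rewrite hD homN. Qed.

Lemma hom_sum I (r : seq I) (P : pred I) (F : I -> A) :
  h (\sum_(i <- r | P i) F i) = \sum_(i <- r | P i) h (F i).
Proof. by elim/big_rec2: _ => [|i y z _ <-]; rewrite ?hom0 ?hD. Qed.

(** With [b] the fixed point of [b |-> (x^2 + b^2) / 2] one has
    [(1 - b)^2 + x^2 = 1], the substitute for a square root of [1 - x^2] in an
    algebra without unit. *)
Lemma sqrt_fixpoint (x : A) : adj x = x -> nrm x <= 1 / 2 ->
  exists b, [/\ adj b = b, b ** x = x ** b & x ** x = 2 *: b - b ** b].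
Proof.
move=> xa x2.
pose f (b : A) : A := (2%:R^-1 : R[i]) *: (x ** x + b ** b).
pose u n := iter n f 0.
have n2 : nrm (2%:R^-1 : R[i]) = 1 / 2.
  have -> : (2%:R^-1 : R[i]) = ((1 / 2 : R)%:C)%C.
    by rewrite div1r fmorphV rmorph_nat.
  by rewrite nrm_real ger0_norm// divr_ge0.
have x4 : nrm (x ** x) <= 1 / 4.
  have := nrm_cmul x x; have := nrm_ge0 x; nra.
have u4 n : nrm (u n) <= 1 / 4.
  elim: n => [|n ih]; first by rewrite /u /= nrm0 divr_ge0.
  rewrite /u /= -/(u n) /f nrmZ n2.
  have := nrmD (x ** x) (u n ** u n); have := nrm_cmul (u n) (u n).
  have := nrm_ge0 (u n); nra.
have fL b c : nrm b <= 1 / 4 -> nrm c <= 1 / 4 ->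
    nrm (f b - f c) <= 1 / 4 * nrm (b - c).
  move=> b4 c4; rewrite /f -scalerBr nrmZ n2.
  have -> : x ** x + b ** b - (x ** x + c ** c) = b ** (b - c) + (b - c) ** c.
    by rewrite cmulBr cmulBl opprD addrACA subrr add0r subrKA.
  have := nrmD (b ** (b - c)) ((b - c) ** c).
  have := nrm_cmul b (b - c); have := nrm_cmul (b - c) c.
  have := nrm_ge0 (b - c); nra.
have ud k n : nrm (u n - u (n + k)%N) <= 1 / 2 * (1 / 2) ^+ n.
  elim: n => [|n ih]; first by rewrite add0n expr0 mulr1 /u /= sub0r nrmN (le_trans (u4 k))//; lra.
  rewrite addSn /u /= -!/(u _) exprS.
  by have := fL _ _ (u4 n) (u4 (n + k)%N); have := nrm_ge0 (u n - u (n + k)%N); nra.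
pose G (e : R) : set A := [set b | exists2 n, (1 / 2) ^+ n <= e & b = u n].
have ex e : 0 < e -> exists n, (1 / 2 : R) ^+ n <= e.
  move=> e0; have := archi_boundP (ltW (_ : 0 < e^-1)); rewrite invr_gt0 => /(_ e0).
  set N := Num.bound _ => eN; exists N.
  have : N%:R <= (2%:R : R) ^+ N by rewrite -natrX ler_nat ltnW// ltn_expl.
  rewrite div1r exprVn => N2; rewrite -[leRHS]invrK lef_pV2 ?posrE ?invr_gt0 ?exprn_gt0//.
  by rewrite (le_trans (ltW eN)).
have [b bl] : exists b, forall e y, 0 < e -> G e y -> nrm (y - b) <= e.
  apply: cauchy_family.
  - by move=> e /ex[n hn]; exists (u n), n.
  - by move=> e d _ ed y [n hn ->]; exists n => //; rewrite (le_trans hn).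
  - move=> e y z e0 [n hn ->] [m hm ->].
    have hp k : 0 <= (1 / 2 : R) ^+ k by apply: exprn_ge0; lra.
    case: (leqP n m) => [nm|/ltnW mn].
      rewrite -(subnKC nm); have := ud (m - n)%N n; have := hp n; lra.
    rewrite -(subnKC mn) nrmBC; have := ud (n - m)%N m; have := hp m; lra.
have near e : 0 < e -> exists2 n, nrm (u n - b) <= e & nrm (u n.+1 - b) <= e.
  move=> e0; have [n hn] := ex _ e0; exists n; apply: bl => //.
    by exists n.
  exists n.+1 => //; apply: le_trans hn; rewrite exprS.
  have : 0 <= (1 / 2 : R) ^+ n by apply: exprn_ge0; lra.
  lra.
have b4 : nrm b <= 1 / 4.
  apply/ler_addgt0Pr => e /near[n hn _].
  have := nrmB (u n) (u n - b); rewrite subKr; have := u4 n; lra.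
exists b; split.
- apply: nrm_sub0 => e e0; have [n hn _] := near (e / 2) (divr_gt0 e0 (ltr0n _ 2)).
  have un : adj (u n) = u n.
    elim: n {hn} => [|n ih]; first exact: adj0.
    by rewrite /u /= -!/(u _) /f adjZ adjD !adjM xa ih fmorphV rmorph_nat.
  have := nrmB3 (u n) (adj b) b; rewrite -{1}un -adjB nrm_adj (nrmBC b).
  lra.
- apply: nrm_sub0 => e e0; have [n hn _] := near e e0.
  have un : u n ** x = x ** u n.
    elim: n {hn} => [|n ih]; first by rewrite cmul0x cmulx0.
    rewrite /u /= -!/(u _) /f cmulZl cmulZr cmulDl cmulDr !cmulA.
    by congr (_ *: (_ + _)); rewrite -cmulA ih cmulA ih.
  have -> : b ** x - x ** b = x ** (u n - b) - (u n - b) ** x.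
    by rewrite cmulBl cmulBr un opprB [RHS]addrC addrA subrK.
  have := nrmB (x ** (u n - b)) ((u n - b) ** x).
  have := nrm_cmul x (u n - b); have := nrm_cmul (u n - b) x.
  have := nrm_ge0 (u n - b); nra.
- have bE : b = f b.
    apply: nrm_sub0 => e e0; have [n hn hn1] := near (e / 2) (divr_gt0 e0 (ltr0n _ 2)).
    have := nrmB3 (u n.+1) b (f b); rewrite (nrmBC b (u n.+1)).
    have := fL _ _ (u4 n) b4; have := nrm_ge0 (u n - b).
    have uS : u n.+1 = f (u n) by [].
    rewrite uS in hn1 *; have := u4 n; lra.
  rewrite [X in _ *: X]bE /f scalerA mulfV ?pnatr_eq0// scale1r addrK.
  by [].
Qed.

(** For small self-adjoint [y] and [b] as in [sqrt_fixpoint], the element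
    w = h b + i h y satisfies (1 - w)^* (1 - w) = 1, that is w^* w = w + w^*.  This
    bounds the norm of [w] by 2, hence that of its imaginary part [h y]. *)
Lemma hom_bound (x : A) : adj x = x -> nrm (h x) <= 4 * nrm x.
Proof.
move=> xa; have [->|x0] := eqVneq x 0; first by rewrite hom0 !nrm0 mulr0.
have small y : adj y = y -> nrm y <= 1 / 2 -> nrm (h y) <= 2.
  move=> ya /(sqrt_fixpoint ya)[b [ba bc e]].
  pose w := h b + 'i *: h y.
  have wa : adj w = h b - 'i *: h y.
    by rewrite /w adjD adjZ -!hA ba ya conjCi scaleNr.
  have hw : adj w ** w = w + adj w.
    have hc : h b ** h y = h y ** h b by rewrite -!hM bc.
    rewrite wa /w cmulBl !cmulDr !cmulZl !cmulZr -!hM bc !scalerA -expr2 sqrCi.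
    rewrite opprD addrA addrK scaleN1r opprK e homB hZ.
    by rewrite addrC subrK addrACA subrr addr0 -mulr2n scaler_nat.
  have w2 : nrm w <= 2.
    have := nrm_Cstar w; rewrite hw; have := nrmD w (adj w); rewrite nrm_adj.
    have := nrm_ge0 w; nra.
  have e2 : 'i *: h y *+ 2 = w - adj w.
    by rewrite wa /w opprB [RHS]addrC addrA subrK mulr2n.
  have := congr1 (@nrm R B) e2; rewrite -scaler_nat !nrmZ nrm_i mul1r.
  have -> : (2%:R : R[i]) = ((2%:R : R)%:C)%C by rewrite rmorph_nat.
  rewrite nrm_real ger0_norm// => {}e2.
  have := nrmB w (adj w); rewrite nrm_adj; lra.
have xp : 0 < nrm x.
  by rewrite lt_neqAle nrm_ge0 andbT eq_sym; apply: contra_neq x0; exact: nrm_eq0.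
have := small (((2 * nrm x)^-1%:C)%C *: x).
rewrite hZ adjZ xa !nrmZ nrm_real ger0_norm; last by rewrite invr_ge0 mulr_ge0// nrm_ge0.
have -> : ((((2 * nrm x)^-1)%:C)%C : R[i])^* = (((2 * nrm x)^-1)%:C)%C by exact: conjc_real.
have r0 : 0 < (2 * nrm x)^-1 by rewrite invr_gt0 mulr_gt0.
have e : (2 * nrm x)^-1 * nrm x = 1 / 2 by rewrite invfM mulfVK ?gt_eqF// div1r.
rewrite e lexx => /(_ erefl isT) k.
by rewrite -(ler_pM2l r0) mulrCA e; lra.
Qed.

(** The bound of [hom_bound] improves to 1 on the powers x^(2^n) of a
    self-adjoint element, whose norms are the powers of its norm. *)
Lemma hom_contract (x : A) : nrm (h x) <= nrm x.
Proof.
suff sa y : adj y = y -> nrm (h y) <= nrm y.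
  have : nrm (h x) ^+ 2 <= nrm x ^+ 2.
    by rewrite -!nrm_Cstar -hA -hM sa// adjM adjK.
  by rewrite ler_pXn2r// nnegrE nrm_ge0.
move=> ya; apply: le_of_pow2; rewrite ?nrm_ge0// => n.
elim: n y ya => [|n ih] y ya; first by rewrite expn0 !expr1 hom_bound.
have := ih (y ** y); rewrite adjM ya hM => /(_ erefl).
have /esym nh := nrm_Cstar (h y); have /esym ny := nrm_Cstar y.
by move: nh ny; rewrite -hA ya => <- <-; rewrite -!exprM -expnS.
Qed.

End Contractivity.

(** * Closed star-subalgebras *)

Section SubCstar.
Variables (R : realType) (A : cstarType R).

Record subcstar := SubCstar {
  ss_set :> A -> Prop;
  ss0 : ss_set 0;
  ssD : forall x y, ss_set x -> ss_set y -> ss_set (x + y);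
  ssZ : forall (c : R[i]) x, ss_set x -> ss_set (c *: x);
  ssM : forall x y, ss_set x -> ss_set y -> ss_set (x ** y);
  ssA : forall x, ss_set x -> ss_set (adj x);
  ss_closed : forall x, (forall e : R, 0 < e -> exists2 y, ss_set y & nrm (x - y) <= e) ->
    ss_set x }.

Variable S : subcstar.

Definition ss_pred : {pred A} := fun x => `[< S x >].

Lemma ss_submod : submod_closed ss_pred.
Proof.
split=> [|c x y /asboolP Sx /asboolP Sy]; apply/asboolP; first exact: ss0.
by apply: ssD => //; exact: ssZ.
Qed.

HB.instance Definition _ := GRing.isSubmodClosed.Build R[i] A ss_pred ss_submod.

Definition ss_type : Type := {x : A | ss_pred x}.
HB.instance Definition _ := SubChoice.on ss_type.
HB.instance Definition _ := [SubChoice_isSubLmodule of ss_type by <:].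

Let norm_sub (x : ss_type) : R[i] := `|val x|.

Let norm_subD x y : norm_sub (x + y) <= norm_sub x + norm_sub y.
Proof. by rewrite /norm_sub /= ler_normD. Qed.

Let norm_subZ (l : R[i]) x : norm_sub (l *: x) = `|l| * norm_sub x.
Proof. by rewrite /norm_sub /= normrZ. Qed.

Let norm_sub0 x : norm_sub x = 0 -> x = 0.
Proof. by move=> /normr0_eq0 h; apply: val_inj. Qed.

HB.instance Definition _ := Lmodule_isNormed.Build R[i] ss_type
  norm_subD norm_subZ norm_sub0.

Lemma nrm_val (x : ss_type) : nrm x = nrm (val x).
Proof. by []. Qed.

Let ss_cauchy (F : set_system ss_type) : ProperFilter F -> cauchy F -> cvg F.
Proof.
move=> FF /cauchyP Fc.
have near (e : R) : 0 < e -> exists x : ss_type, F [set y | nrm (x - y) < e].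
  move=> e0; have [|x Fx] := Fc (e%:C)%C; first by rewrite ltcR.
  by exists x; apply: filterS Fx => y; rewrite -ball_normE /= nrmE ltcR.
pose G (e : R) : set A := [set val x | x in [set x : ss_type |
  exists2 d : R, 2 * d <= e & F [set y : ss_type | nrm (x - y) < d]]].
have [l Gl] : exists l, forall e x, 0 < e -> G e x -> nrm (x - l) <= e.
  apply: cauchy_family.
  - move=> e e0; have [|x Fx] := near (e / 2); first by rewrite divr_gt0.
    by exists (val x), x => //; exists (e / 2) => //; lra.
  - by move=> e d _ ed _ [x [c ce Fx] <-]; exists x => //; exists c => //; lra.
  - move=> e _ _ e0 [x [c ce Fx] <-] [y [d de Fy] <-].
    have [z [/= zx zy]] := filter_ex (filterI Fx Fy).
    have -> : nrm (val x - val y) = nrm (x - y) by [].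
    by have := nrmB3 z x y; rewrite (nrmBC z); lra.
have Sl : S l.
  apply: ss_closed => e e0; have [|x Fx] := near (e / 2); first by rewrite divr_gt0.
  exists (val x); first exact/asboolP/(valP x).
  rewrite nrmBC; apply: Gl => //; exists x => //; exists (e / 2) => //; lra.
apply/cvg_ex; exists (@exist A ss_pred l (introT (asboolP _) Sl) : ss_type).
move=> O /nbhs_nrmP[e e0 Oe].
have [|x Fx] := near (e / 4); first by rewrite divr_gt0.
have lx : nrm (val x - l) <= e / 2.
  apply: Gl; first by lra.
  by exists x => //; exists (e / 4) => //; lra.
apply: filterS Fx => y /= xy; apply: Oe; rewrite nrm_val /=.
have := nrmB3 (val x) l (val y); rewrite (nrmBC l (val x)).
have : nrm (val x - val y) < e / 4 by [].
lra.
Qed.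

HB.instance Definition _ := Uniform_isComplete.Build ss_type ss_cauchy.

Let ss_mul_subproof (x y : ss_type) : ss_pred (val x ** val y).
Proof. by apply/asboolP/ssM; apply/asboolP; [exact: (valP x)|exact: (valP y)]. Qed.

Let ss_adj_subproof (x : ss_type) : ss_pred (adj (val x)).
Proof. by apply/asboolP/ssA/asboolP; exact: (valP x). Qed.

Let ss_mul (x y : ss_type) : ss_type := @exist A ss_pred _ (ss_mul_subproof x y).
Let ss_adj (x : ss_type) : ss_type := @exist A ss_pred _ (ss_adj_subproof x).

Let ss_mulA : associative ss_mul.
Proof. by move=> x y z; apply: val_inj; exact: cmulA. Qed.
Let ss_mulDl : left_distributive ss_mul +%R.
Proof. by move=> x y z; apply: val_inj; exact: cmulDl. Qed.
Let ss_mulDr : right_distributive ss_mul +%R.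
Proof. by move=> x y z; apply: val_inj; exact: cmulDr. Qed.
Let ss_mulZl (c : R[i]) x y : ss_mul (c *: x) y = c *: ss_mul x y.
Proof. by apply: val_inj; exact: cmulZl. Qed.
Let ss_mulZr (c : R[i]) x y : ss_mul x (c *: y) = c *: ss_mul x y.
Proof. by apply: val_inj; exact: cmulZr. Qed.
Let ss_adjK : involutive ss_adj.
Proof. by move=> x; apply: val_inj; exact: adjK. Qed.
Let ss_adjD : {morph ss_adj : x y / x + y}.
Proof. by move=> x y; apply: val_inj; exact: adjD. Qed.
Let ss_adjZ (c : R[i]) x : ss_adj (c *: x) = c^* *: ss_adj x.
Proof. by apply: val_inj; exact: adjZ. Qed.
Let ss_adjM x y : ss_adj (ss_mul x y) = ss_mul (ss_adj y) (ss_adj x).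
Proof. by apply: val_inj; exact: adjM. Qed.
Let ss_normM x y : `|ss_mul x y| <= `|x| * `|y|.
Proof. exact: cnormM. Qed.
Let ss_norm_adj x : `|ss_mul (ss_adj x) x| = `|x| ^+ 2.
Proof. exact: cnorm_adj. Qed.

HB.instance Definition _ := isCstar.Build R ss_type ss_mulA ss_mulDl ss_mulDr
  ss_mulZl ss_mulZr ss_adjK ss_adjD ss_adjZ ss_adjM ss_normM ss_norm_adj.

Definition ss_cstar : cstarType R := ss_type.

Definition ss_incl (x : ss_cstar) : A := val (x : ss_type).

Lemma ss_incl_hom : star_hom ss_incl.
Proof. by split. Qed.

Lemma ss_incl_in x : S (ss_incl x).
Proof. exact/asboolP/(valP (x : ss_type)). Qed.

Lemma ss_incl_inj : injective ss_incl.
Proof. exact: val_inj. Qed.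

Lemma ss_incl_onto x : S x -> exists y, ss_incl y = x.
Proof. by move=> Sx; exists (@exist A ss_pred x (introT (asboolP _) Sx)). Qed.

Definition ss_lift x (Sx : S x) : ss_cstar := sval (cid (ss_incl_onto Sx)).

Lemma ss_liftK x (Sx : S x) : ss_incl (ss_lift Sx) = x.
Proof. exact: svalP (cid (ss_incl_onto Sx)). Qed.

End SubCstar.

(** * Compactness of the spectrum *)

Section CompactInduction.
Variables (S : invSemigroupType) (X : set (idem S * {fset idem S})) (o : idem S).
Hypothesis ho : forall s : S, (s * val o)%g = s.
Variable code : idem S -> nat.
Hypothesis code_inj : injective code.
Implicit Types (e f : idem S) (l : seq (idem S * bool)).

Definition fits (phi : idem S -> bool) l := all (fun eb => phi eb.1 == eb.2) l.

Lemma fitsP (phi : idem S -> bool) l :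
  reflect (forall e b, (e, b) \in l -> phi e = b) (fits phi l).
Proof.
apply: (iffP allP) => [h e b /h /eqP //|h [e b] /= /h ->]; exact: eqxx.
Qed.

(** Finite data that visibly contradict the axioms of a character or the
    relations in [X].  The same data force a product of projections to vanish in
    any algebra in which these relations hold. *)
Inductive clash l : Prop :=
| clash0 of (idem0 S, true) \in l
| clash1 of (o, false) \in l
| clashM e f b c d of (e, b) \in l & (f, c) \in l & (imul e f, d) \in l &
    d != b && c
| clashX e (F : {fset idem S}) (beta : idem S -> bool) b of conj_closure X (e, F) &
    (e, b) \in l & (forall f, f \in F -> (f, beta f) \in l) &
    b != \big[orb/false]_(f <- F) beta f.

Lemma imulii e : imul e e = e.
Proof. by apply: val_inj; exact: idemE. Qed.

Lemma char_top (phi : spectrum X) : val phi o.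
Proof.
have [[e pe] _ _] := charP phi; have := charM phi e o.
have -> : imul e o = e by apply: val_inj; rewrite /= ho.
by rewrite pe /= => <-.
Qed.

Lemma clash_fits l (phi : spectrum X) : clash l -> ~ fits (val phi) l.
Proof.
move=> c /fitsP h; case: c => [/h|/h|e f b c d /h eb /h fc /h efd|e F beta b XF /h eb fb].
- by case: (charP phi) => _ ->.
- by rewrite char_top.
- by rewrite -efd charM eb fc eqxx.
- rewrite -eb (joinP phi XF) big_seq [X in _ != X]big_seq.
  by under eq_bigr => f fF do rewrite (h _ _ (fb f fF)); rewrite eqxx.
Qed.

(** Compactness of the spectrum in the form of a proof principle: a property of
    the basic sets [fits^-1 l] holds of the whole spectrum as soon as it is local
    and passes from the two halves of a set to that set.  A counterexample
    would be bisected along an enumeration of the idempotents down to a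
    character.  The sets without points are treated through [clash], so that
    [Q] may speak of projections in an algebra in which [X] is satisfied. *)
Lemma compact_induction (Q : seq (idem S * bool) -> Prop) :
  (forall l e, Q ((e, true) :: l) -> Q ((e, false) :: l) -> Q l) ->
  (forall l, clash l -> Q l) ->
  (forall phi : spectrum X, exists2 l, fits (val phi) l &
     forall l', fits (val phi) l' -> {subset l <= l'} -> Q l') ->
  Q [::].
Proof.
move=> Qsplit Qclash Qloc; apply: contrapT => NQ.
pose en n : idem S := xget (idem0 S) [set e | code e = n].
have enK e : en (code e) = e.
  apply: code_inj.
  exact: (@xgetPex _ (idem0 S) [set f | code f = code e] (ex_intro _ e erefl)).
pose dec e l : bool := `[< ~ Q ((e, true) :: l) >].
pose fix L n := if n is n'.+1 then (en n', dec (en n') (L n')) :: L n' else [::].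
have NL n : ~ Q (L n).
  elim: n => //= n ih; rewrite /dec; case: asboolP => // /contrapT h h'.
  exact/ih/(Qsplit _ (en n)).
have Lmono m n : (m <= n)%N -> {subset L m <= L n}.
  elim: n => [|n ih]; first by rewrite leqn0 => /eqP ->.
  rewrite leq_eqVlt => /predU1P[-> //|/ih h x /h xL].
  by rewrite /= inE xL orbT.
have Lfun n e b b' : (e, b) \in L n -> (e, b') \in L n -> b = b'.
  move=> h h'; apply: contrapT => bb'; apply: (NL n); apply: Qclash.
  (* Contradictory values at [e] clash as a failure of [e * e = e]. *)
  have [ht hf] : (e, true) \in L n /\ (e, false) \in L n.
    by case: b b' bb' h h' => [] [].
  by apply: (clashM hf hf) (_ : true != _) => //; rewrite imulii.
pose phi e := dec e (L (code e)).
have phiL e : (e, phi e) \in L (code e).+1.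
  by rewrite /= enK /phi inE eqxx.
have Lphi n e b : (e, b) \in L n -> phi e = b.
  move=> h; apply: (Lfun (maxn n (code e).+1) e).
    by apply: Lmono (phiL e); rewrite leq_maxr.
  by apply: Lmono h; rewrite leq_maxl.
have Lfin (s : seq (idem S)) : exists n, forall e, e \in s -> (e, phi e) \in L n.
  elim: s => [|e s [n hn]]; first by exists 0%N.
  exists (maxn n (code e).+1) => f; rewrite inE => /predU1P[->|/hn fL].
    by apply: Lmono (phiL e); rewrite leq_maxr.
  by apply: Lmono fL; rewrite leq_maxl.
have charphi : is_character phi.
  split.
  - exists o; apply: contrapT => /negP/negbTE po; have := phiL o; rewrite po => h.
    exact/(NL (code o).+1)/Qclash/clash1.
  - apply: contrapT => /eqP; rewrite eqbF_neg negbK => p0; have := phiL (idem0 S).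
    by rewrite p0 => h; exact/(NL (code (idem0 S)).+1)/Qclash/clash0.
  - move=> e f; have [n hn] := Lfin [:: e; f; imul e f].
    apply/eqP; apply: contrapT => /negP h; apply: (NL n); apply: Qclash.
    by apply: clashM h; apply: hn; rewrite !inE eqxx ?orbT.
have joinphi : X_to_join X phi.
  move=> e F XF; have [n hn] := Lfin (e :: F).
  apply/eqP; apply: contrapT => /negP h; apply: (NL n); apply: Qclash.
  apply: (clashX XF) h; first by apply: hn; rewrite inE eqxx.
  by move=> f fF; apply: hn; rewrite inE fF orbT.
pose Phi : spectrum X := exist _ phi (introT (asboolP _) (conj charphi joinphi)).
have [l /fitsP lphi hl] := Qloc Phi.
have [n hn] := Lfin (map fst l).
apply: (NL n); apply: hl; first by apply/fitsP => e b /Lphi.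
move=> [e b] eb; rewrite -(lphi _ _ eb); apply: hn.
by apply/mapP; exists (e, b).
Qed.

End CompactInduction.

(** * The topology of the groupoid of germs *)

Section GermTopology.
Variables (S : invSemigroupType) (X : set (idem S * {fset idem S})).
Implicit Types (s t : S) (e : idem S) (phi psi : spectrum X) (L : seq (idem S)).
Local Notation germs := (germs X).

Definition germs_of s : set germs :=
  [set g | exists phi (h : val phi (dom s)), g = germ h].

Lemma germ_dom s phi e : val phi (dom (s * val e)%g) = val phi e && val phi (dom s).
Proof. exact: domMi. Qed.

Lemma germ_in s phi (h : val phi (dom s)) : germs_of s (germ h).
Proof. by exists phi, h. Qed.

Lemma germs_ofP s (g : germs) : germs_of s g ->
  exists h : val (germ_src g) (dom s), g = germ h.
Proof. by move=> [phi [h ->]]; rewrite germ_srcE; exists h. Qed.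

Lemma germs_of_germ s t phi (h : val phi (dom t)) :
  germs_of s (germ h) <-> exists2 e, val phi e & (t * val e = s * val e)%g.
Proof.
split=> [[psi [hs E]]|[e pe te]].
  have P : phi = psi by rewrite -(germ_srcE h) E germ_srcE.
  by subst psi; apply/germ_eqP.
have hs : val phi (dom s).
  by have := germ_dom s phi e; rewrite -te germ_dom pe h /= => <-.
by exists phi, hs; apply/germ_eqP; exists e.
Qed.

Definition agree L phi psi := forall e, e \in L -> val psi e = val phi e.

(** The topology of the groupoid is that of the spectrum, transported along the
    section [phi |-> [s, phi]] on the domain of each [s]. *)
Lemma nbhs_germ s phi (h : val phi (dom s)) (O : set germs) :
  nbhs (germ h) O <-> exists L, forall psi (k : val psi (dom s)),
    agree L phi psi -> O (germ k).
Proof.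
split=> [|[L hL]].
  rewrite nbhsE => -[U [/germ_openE[D Db <-] [B DB Bg]] UO].
  have [t [l [tl Bb]]] := Db _ DB.
  move: Bg; rewrite Bb => -[psi [ht [E al]]].
  have P : phi = psi by rewrite -(germ_srcE h) E germ_srcE.
  subst psi; have [e pe se] := (germ_eqP _ _).1 E.
  exists (e :: dom t :: map (@dom S) l) => psi k ag.
  apply: UO; exists B => //; rewrite Bb.
  have ht' : val psi (dom t) by rewrite ag ?ht// !inE eqxx orbT.
  exists psi, ht'; split.
    by apply/germ_eqP; exists e => //; rewrite ag ?inE ?eqxx.
  apply/allP => x xl; rewrite ag; first exact: (allP al).
  by rewrite !inE map_f ?orbT.
pose E := foldr (@imul S) (dom s) [seq e <- L | val phi e].
have EE psi : val psi E = all (val psi) [seq e <- L | val phi e] && val psi (dom s).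
  rewrite /E; elim: [seq _ <- _ | _] => [//|e l ih].
  by rewrite -[foldr _ _ _]/(imul e (foldr (@imul S) (dom s) l)) charM ih andbA.
pose sE := (s * val E)%g.
pose B : set germs := @basic S X sE [seq (sE * val e)%g | e <- L & ~~ val phi e].
have oB : open B.
  apply/germ_openE; exists [set B]; last by rewrite bigcup_set1.
  move=> _ ->; exists sE, [seq (sE * val e)%g | e <- L & ~~ val phi e]; split=> //.
  by move=> t /mapP[e _ ->]; exists e.
rewrite nbhsE; exists B; first split=> //.
  have pE : val phi E by rewrite EE h andbT; apply/allP => e; rewrite mem_filter => /andP[].
  have k : val phi (dom sE) by rewrite germ_dom h pE.
  exists phi, k; split.
    by apply/germ_eqP; exists E => //; rewrite /sE -mulgA idemE.
  apply/allP => t /mapP[e]; rewrite mem_filter => /andP[ne _] ->.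
  by rewrite germ_dom (negbTE ne).
move=> _ [psi [k [-> al]]].
have /andP[pE ps] : val psi E && val psi (dom s) by rewrite -germ_dom.
have -> : germ k = germ ps.
  by apply/germ_eqP; exists E => //; rewrite /sE -mulgA idemE.
apply: hL => e eL; case pe: (val phi e).
  move: pE; rewrite EE => /andP[/allP h' _]; apply: h'.
  by rewrite mem_filter pe.
have /(allP al) : (sE * val e)%g \in [seq (sE * val e)%g | e <- L & ~~ val phi e].
  by apply/mapP; exists e => //; rewrite mem_filter pe.
by rewrite germ_dom k andbT => /negbTE.
Qed.

Lemma germs_of_inj s : {in germs_of s &, injective (@germ_src S X)}.
Proof.
move=> g g'; rewrite !inE => /germs_ofP[h gE] /germs_ofP[h' g'E] E.
by rewrite gE g'E; exact: germ_cast.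
Qed.

(** The source of a germ of [s] is recovered from its range by acting with the
    inverse of [s]. *)
Lemma germs_of_rng_inj s : {in germs_of s &, injective (@germ_rng S X)}.
Proof.
move=> g g'; rewrite !inE => -[phi [h ->]] [psi [k ->]]; rewrite !germ_rngE => E.
apply: germ_cast; rewrite -(act_inv (inv_subproof h)) -(act_inv (inv_subproof k)).
apply: val_inj; apply/funext => f.
exact: (congr1 (fun p : spectrum X => val p (iconj (sinv s) f)) E).
Qed.

Definition fit_germs s l : set germs :=
  germs_of s `&` [set g | fits (val (germ_src g)) l].

Lemma fit_germs_open s l : open (fit_germs s l).
Proof.
rewrite openE => g [[phi [h ->]] /=]; rewrite germ_srcE => /fitsP hl.
apply/nbhs_germ; exists (map fst l) => psi k ag; split; first exact: germ_in.
rewrite /= germ_srcE; apply/fitsP => e b eb.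
by rewrite -(hl _ _ eb); apply: ag; apply/mapP; exists (e, b).
Qed.

Lemma germs_of_open s : open (germs_of s).
Proof.
have -> : germs_of s = fit_germs s [::]; last exact: fit_germs_open.
by rewrite /fit_germs (_ : [set _ | _] = setT) ?setIT//; apply/seteqP; split.
Qed.

Lemma germs_of_bisection s : @open_bisection (germ_groupoid X) (germs_of s).
Proof. by split; [exact: germs_of_open|exact: germs_of_inj|exact: germs_of_rng_inj]. Qed.

End GermTopology.
Arguments fit_germs {S} X s l.

Section Compact.
Variables (S : invSemigroupType) (X : set (idem S * {fset idem S})) (o : idem S).
Hypothesis ho : forall s : S, (s * val o)%g = s.
Variable code : idem S -> nat.
Hypothesis code_inj : injective code.

(** A filter without cluster point avoids a neighbourhood of every germ of [s];
    these neighbourhoods come from basic sets of the spectrum, over which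
    [compact_induction] applies. *)
Lemma germs_of_compact (s : S) : compact (@germs_of S X s).
Proof.
move=> F FF Fs; apply: contrapT => nc.
have sep (phi : spectrum X) (h : val phi (dom s)) :
    exists L, F [set g : germs X | ~ (agree L phi (germ_src g) /\ germs_of s g)].
  apply: contrapT => nL; apply: nc; exists (germ h); split; first exact: germ_in.
  move=> A O FA /nbhs_germ[L hL]; apply: contrapT => AO; apply: nL; exists L.
  apply: filterS FA => g Ag [ag /germs_ofP[k gk]]; apply: AO.
  by exists g; split=> //; rewrite gk; exact: hL.
pose Q l := F [set g : germs X | ~ (fits (val (germ_src g)) l /\ germs_of s g)].
suff : Q [::].
  move=> Q0; have [g []] := filter_ex (filterI Fs Q0).
  by move=> gs; apply; split.
apply: (@compact_induction S X o code code_inj) => [l e Q1 Q2|l c|phi].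
- apply: filterS (filterI Q1 Q2) => g /= [n1 n2] [sl gs].
  by case pe: (val (germ_src g) e); [apply: n1|apply: n2]; rewrite /= pe eqxx.
- apply: filterS filterT => g _ [sl _]; exact: (clash_fits ho c sl).
- have [h|h] := pselect (val phi (dom s)); last first.
    exists [:: (dom s, false)]; first by rewrite /= andbT; apply/eqP/negbTE/negP.
    move=> l' _ ll'; apply: filterS filterT => g _ [/fitsP sl /germs_ofP[k _]].
    by have := sl (dom s) false (ll' _ (mem_head _ _)); rewrite k.
  have [L FL] := sep phi h; exists [seq (e, val phi e) | e <- L].
    by apply/allP => _ /mapP[e _ ->] /=.
  move=> l' _ ll'; apply: filterS FL => g nL [/fitsP sl gs]; apply: nL; split=> //.
  by move=> e eL; apply: sl; apply: ll'; apply/mapP; exists e.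
Qed.

End Compact.

(** * Functions supported on bisections *)

Section GermFunctions.
Variables (R : realType) (S : invSemigroupType) (X : set (idem S * {fset idem S})).
Variable o : idem S.
Hypothesis ho : forall s : S, (s * val o)%g = s.
Variable code : idem S -> nat.
Hypothesis code_inj : injective code.
Implicit Types (f : spectrum X -> R[i]) (phi psi : spectrum X).
Local Notation germs := (germs X).
Local Notation G := (germ_groupoid X).

Definition cts f := forall (phi : spectrum X) (e : R), 0 < e ->
  exists L, forall psi, agree L phi psi -> nrm (f psi - f phi) <= e.

(** For [f] continuous these functions span C_c of the groupoid. *)
Definition carry (s : S) f (g : germs) : R[i] :=
  if `[< germs_of s g >] then f (germ_src g) else 0.

Lemma carry_germ s f phi (h : val phi (dom s)) : carry s f (germ h) = f phi.
Proof. by rewrite /carry asboolT ?germ_srcE//; exact: germ_in. Qed.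

Lemma carry_out s f g : ~ germs_of s g -> carry s f g = 0.
Proof. by move=> h; rewrite /carry asboolF. Qed.

Lemma carry_bisection s f : cts f -> @bisection_function R G (carry s f).
Proof.
move=> fc; exists (germs_of s), (germs_of s); split.
- exact: germs_of_bisection.
- exact: (germs_of_compact ho code_inj).
- by [].
- by move=> g /carry_out.
move=> g [phi [h ->]] O /(@nbhs_nrmP R R[i]^o)[e e0 eO].
have [|L hL] := fc phi (e / 2); first by rewrite divr_gt0.
apply/nbhs_germ; exists L => psi k ag; apply: eO.
rewrite !carry_germ -[X in nrm X](opprB (f psi)) nrmN.
by have := hL _ ag; lra.
Qed.

(** The bisection [V] is not of the form [germs_of s].  The finitely many pieces
    that cover the support are made disjoint one after the other; on each of them
    [f] is a function of the source. *)
Lemma carry_sum_bisection (V : set germs) (r : seq (S * seq (idem S * bool)))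
    (f : germs -> R[i]) :
  {in V &, injective (@germ_src S X)} ->
  (forall p, p \in r -> fit_germs X p.1 p.2 `<=` V) ->
  (forall g, f g != 0 -> V g /\ exists2 p, p \in r & fit_germs X p.1 p.2 g) ->
  (forall s phi (h : val phi (dom s)), V (germ h) -> forall e : R, 0 < e ->
     exists L, forall psi (k : val psi (dom s)), agree L phi psi ->
       nrm (f (germ k) - f (germ h)) <= e) ->
  exists q : seq (S * {f | cts f}),
    f = fun g => \sum_(p <- q) carry p.1 (sval p.2) g.
Proof.
move=> Vi; elim: r f => [|[s l] r ih] f rV fV fc.
  exists [::]; apply/funext => g; rewrite big_nil; apply/eqP.
  by apply: contrapT => /negP/fV[_ []].
pose D phi := val phi (dom s) && fits (val phi) l.
pose f1 phi : R[i] := if pselect (val phi (dom s)) is left h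
  then if fits (val phi) l then f (germ h) else 0 else 0.
pose f2 g := if D (germ_src g) then 0 else f g.
have f1E phi (h : val phi (dom s)) : fits (val phi) l -> f1 phi = f (germ h).
  move=> sl; rewrite /f1; case: pselect => // h'; rewrite sl; congr f.
  exact: germ_cast.
have f10 phi : ~~ D phi -> f1 phi = 0.
  by rewrite /D /f1; case: pselect => // h; rewrite h /= => /negbTE ->.
have DE phi psi : agree (dom s :: map fst l) phi psi -> D psi = D phi.
  move=> ag; rewrite /D ag ?mem_head//; congr (_ && _).
  apply: eq_in_all => -[e b] eb /=; rewrite ag// inE.
  by apply/orP; right; apply/mapP; exists (e, b).
have DV phi (h : val phi (dom s)) : fits (val phi) l -> V (germ h).
  move=> sl; apply: (rV (s, l)); first exact: mem_head.
  by split; [exact: germ_in|rewrite /= germ_srcE].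
have f1c : cts f1.
  move=> phi e e0; case Dp: (D phi); last first.
    exists (dom s :: map fst l) => psi /DE Dps.
    by rewrite !f10 ?Dps ?Dp// subrr nrm0 ltW.
  have /andP[h sl] := Dp.
  have [L hL] := fc _ _ h (DV _ h sl) e e0.
  exists ((dom s :: map fst l) ++ L) => psi ag.
  have : D psi by rewrite (DE phi) ?Dp// => x xL; apply: ag; rewrite mem_cat xL.
  move=> /andP[k sk]; rewrite (f1E _ h sl) (f1E _ k sk); apply: hL.
  by move=> x xL; apply: ag; rewrite mem_cat xL orbT.
have [q qE] : exists q : seq (S * {f | cts f}),
    f2 = fun g => \sum_(p <- q) carry p.1 (sval p.2) g.
  apply: ih.
  - by move=> p pr; apply: rV; rewrite inE pr orbT.
  - move=> g; rewrite /f2; case: ifPn => [|nD /fV[Vg [p]]]; first by rewrite eqxx.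
    rewrite inE => /predU1P[->|pr pg]; last by split=> //; exists p.
    move=> [/germs_ofP[h _] /= sl].
    by move: nD; rewrite /D h sl.
  - move=> t phi h Vh e e0; have [L hL] := fc _ _ h Vh e e0.
    exists ((dom s :: map fst l) ++ L) => psi k ag.
    rewrite /f2 !germ_srcE (DE phi) => [|x xL]; last by apply: ag; rewrite mem_cat xL.
    case: ifP => _; first by rewrite subrr nrm0 ltW.
    by apply: hL => x xL; apply: ag; rewrite mem_cat xL orbT.
exists ((s, exist _ f1 f1c) :: q).
apply/funext => g; rewrite big_cons /= -[X in _ + X](congr1 (@^~ g) qE) /f2.
case: ifPn => [/andP[h sl]|nD]; last first.
  rewrite /carry; case: asboolP => _; rewrite ?add0r//.
  by rewrite f10 ?add0r.
rewrite addr0 /carry; case: asboolP => [gs|gs].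
  rewrite (f1E _ h sl); congr f; have [h' gE] := germs_ofP gs.
  by rewrite [LHS]gE; exact: germ_cast.
apply/eqP; apply: contrapT => /negP/fV[Vg _]; apply: gs.
have -> : g = germ h; last exact: germ_in.
by apply: Vi; rewrite ?inE//; [exact: DV|rewrite germ_srcE].
Qed.

Lemma bisection_carry (f : germs -> R[i]) : @bisection_function R G f ->
  exists q : seq (S * {f | cts f}),
    f = fun g => \sum_(p <- q) carry p.1 (sval p.2) g.
Proof.
move=> [V [K [[oV Vi _] cK KV fK fc]]].
pose ok (p : S * seq (idem S * bool)) := fit_germs X p.1 p.2 `<=` V.
pose left (r : seq (S * seq (idem S * bool))) := K `\` [set g | exists2 p, p \in r & fit_germs X p.1 p.2 g].
have near_ok g : K g -> exists2 p, ok p & fit_germs X p.1 p.2 g.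
  move=> Kg; have [s [phi [h gE]]] := germsP g.
  have : nbhs g V by apply: open_nbhs_nbhs; split=> //; exact: KV.
  rewrite gE => /nbhs_germ[L hL].
  exists (s, [seq (e, val phi e) | e <- L]) => /=.
    move=> g' [[psi [k ->]] /= /fitsP sl]; apply: hL => e eL.
    by move: sl; rewrite germ_srcE; apply; apply/mapP; exists e.
  split; first exact: germ_in.
  by rewrite /= germ_srcE; apply/allP => _ /mapP[e _ ->] /=.
have [r rok Kr] : exists2 r : seq (S * seq (idem S * bool)), {in r, forall p, ok p} & left r = set0.
  apply: contrapT => nr.
  pose F := filter_from [set r : seq (S * seq (idem S * bool)) | {in r, forall p, ok p}] left.
  have FF : Filter F.
    apply: filter_from_filter; first by exists [::].
    move=> r r' rok rok'; exists (r ++ r').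
      by move=> p; rewrite mem_cat => /orP[/rok|/rok'].
    by move=> g [Kg ng]; split; split=> // -[p pr pg]; apply: ng; exists p;
      rewrite // mem_cat pr ?orbT.
  have PF : ProperFilter F.
    apply: filter_from_proper => r rok; apply/set0P/eqP => r0.
    by apply: nr; exists r.
  have [|g [Kg cg]] := cK F PF; first by exists [::] => // g [].
  have [p pok pg] := near_ok _ Kg.
  have [|g' [[_ ng] pg']] := cg (left [:: p]) (fit_germs X p.1 p.2) _
      (open_nbhs_nbhs (conj (@fit_germs_open _ X p.1 p.2) pg)).
    by exists [:: p] => // q; rewrite inE => /eqP ->.
  by apply: ng; exists p; rewrite ?mem_head.
apply: (@carry_sum_bisection V r) => //.
- move=> g fg; have Kg : K g.
    by apply: contrapT => /fK /eqP; rewrite (negbTE fg).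
  split; first exact: KV.
  by apply: contrapT => ng; have : left r g by []; rewrite Kr.
- move=> s phi h Vh e e0.
  have := fc _ Vh [set y | nrm (f (germ h) - y) < e].
  rewrite nbhs_simpl /= => /(_ (@nearby_ball R R[i]^o _ _ e0))/nbhs_germ[L hL].
  by exists L => psi k ag; have := hL _ k ag; rewrite /= nrmBC; exact: ltW.
Qed.

(** Near a character [f] is nearly constant, and approximants on the two halves of
    a basic set combine linearly to one on that set. *)
Lemma cts_approx f (e : R) : cts f -> 0 < e ->
  exists r : seq (R[i] * idem S), forall phi,
    nrm (f phi - \sum_(p <- r) p.1 * (val phi p.2)%:R) <= e.
Proof.
move=> fc e0.
pose Q l := exists r : seq (R[i] * idem S), forall phi, fits (val phi) l ->
    nrm (f phi - \sum_(p <- r) p.1 * (val phi p.2)%:R) <= e.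
suff [r hr] : Q [::] by exists r => phi; exact: hr.
apply: (@compact_induction S X o code code_inj) => [l x [r1 h1] [r2 h2]|l c|phi].
- exists ([seq (p.1, imul p.2 x) | p <- r1] ++
          ([seq (- p.1, imul p.2 x) | p <- r2] ++ r2)) => phi sl.
  rewrite !big_cat !big_map /=.
  have S1 (r : seq (R[i] * idem S)) : \sum_(p <- r) p.1 * (val phi (imul p.2 x))%:R =
      (val phi x)%:R * \sum_(p <- r) p.1 * (val phi p.2)%:R.
    by rewrite mulr_sumr; apply: eq_bigr => p _; rewrite charM -mulnb natrM; ring.
  have -> : \sum_(p <- r2) - p.1 * (val phi (imul p.2 x))%:R =
      - \sum_(p <- r2) p.1 * (val phi (imul p.2 x))%:R.
    by rewrite -sumrN; apply: eq_bigr => p _; rewrite mulNr.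
  rewrite !S1; case px: (val phi x).
    by rewrite !mul1r addNr addr0; apply: h1; rewrite /= px.
  by rewrite !mul0r oppr0 !add0r; apply: h2; rewrite /= px.
- by exists [::] => phi /(clash_fits ho c).
- have [L hL] := fc phi e e0; exists [seq (x, val phi x) | x <- L].
    by apply/allP => _ /mapP[x _ ->] /=.
  move=> l' _ ll'; exists [:: (f phi, o)] => psi /fitsP sl.
  rewrite big_seq1 /= (char_top ho) mulr1; apply: hL => x xL.
  by apply: sl; apply: ll'; apply/mapP; exists x.
Qed.

End GermFunctions.

(** * Convolution *)

Section Convolution.
Variables (R : realType) (S : invSemigroupType) (X : set (idem S * {fset idem S})).
Variable o : idem S.
Hypothesis ho : forall s : S, (s * val o)%g = s.
Implicit Types (f : spectrum X -> R[i]) (phi psi : spectrum X) (s t : S).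
Local Notation germs := (germs X).
Local Notation G := (germ_groupoid X).
Implicit Types (F H : garr G -> R[i]) (g y z : garr G).

Definition supp_in (s : S) F := forall g, F g != 0 -> germs_of s g.

Lemma carry_supp s f : supp_in s (carry s f).
Proof. by move=> g /eqP h; apply: contrapT => ng; apply: h; exact: carry_out. Qed.

Lemma germs_of_mul s t y z : germs_of s y -> germs_of t z ->
  gsrc y = grng z -> germs_of (s * t)%g (gmul y z).
Proof.
move=> [psi [hs ->]] [phi [ht ->]]; rewrite /= germ_srcE germ_rngE => E; subst psi.
by rewrite (germ_mulE hs (mul_subproof hs (erefl (act ht)))); exact: germ_in.
Qed.

Lemma germs_of_mulP s t g : germs_of (s * t)%g g ->
  exists y z, [/\ germs_of s y, germs_of t z, gsrc y = grng z & gmul y z = g].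
Proof.
move=> [phi [h ->]].
have ht : val phi (dom t).
  have : val phi (imul (dom (s * t)%g) (dom t)).
    suff -> : imul (dom (s * t)%g) (dom t) = dom (s * t)%g by [].
    by apply: val_inj; rewrite /= !mulgA -(mulgA _ t) -(mulgA _ (t * _)%g) mulsVs.
  by rewrite charM => /andP[].
have hs : val (act ht) (dom s).
  change (val phi (iconj t (dom s))).
  suff -> : iconj t (dom s) = dom (s * t)%g by [].
  by apply: val_inj; rewrite /= sinvM !mulgA.
exists (germ hs), (germ ht); split; [exact: germ_in|exact: germ_in| |].
  by rewrite /= germ_srcE germ_rngE.
exact: germ_mulE.
Qed.

Lemma mulVKg (y z : garr G) : gsrc y = grng z -> gmul (ginv y) (gmul y z) = z.
Proof.
by move=> E; rewrite gmulA ?gsrc_inv// gmulVg E gmul1g.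
Qed.

(** On bisections the factorization of a germ is unique, so the convolution has a
    single nonzero term. *)
Lemma convolution_supp s t F H y z : supp_in s F -> supp_in t H ->
  germs_of s y -> germs_of t z -> gsrc y = grng z ->
  convolution F H (gmul y z) = F y * H z.
Proof.
move=> Fs Ht sy tz E; rewrite /convolution (fsbigE [:: (y, z)])//.
- rewrite big_cons big_nil ifT; first by rewrite /= addr0.
  exact: mem_set.
- by move=> p /=; rewrite inE => /eqP ->.
- move=> [y' z'] /= [E' e]; apply: contraNeq.
  rewrite mulf_eq0 negb_or => /andP[/Fs sy' /Ht tz'].
  have zz : z' = z.
    apply: (@germs_of_inj _ _ t); rewrite ?inE//.
    by have := congr1 (@gsrc G) e; rewrite !gsrc_mul.
  subst z'; have -> : y' = y by apply: (@germs_of_inj _ _ s); rewrite ?inE//; exact: (etrans E' (esym E)).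
  exact: mem_head.
Qed.

Lemma convolution_out s t F H g : supp_in s F -> supp_in t H ->
  ~ germs_of (s * t)%g g -> convolution F H g = 0.
Proof.
move=> Fs Ht ng; apply: fsbig1 => -[y z] /= [E e]; apply/eqP; apply: contra_notT ng.
by rewrite mulf_eq0 negb_or -e => /andP[/Fs sy /Ht tz]; exact: germs_of_mul.
Qed.

Definition supp_seq (sg : seq S) F :=
  forall g, F g != 0 -> exists2 s, s \in sg & germs_of s g.

(** At a given point the convolution is a sum of at most [size sg] terms, over
    pairs that depend on the support of the first factor only. *)
Lemma convolution_seq (sg : seq S) g : exists r : seq (garr G * garr G),
  [/\ (size r <= size sg)%N,
      (forall yz, yz \in r -> gsrc yz.1 = grng yz.2 /\ gmul yz.1 yz.2 = g) &
      forall F H, supp_seq sg F ->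
        convolution F H g = \sum_(yz <- r) F yz.1 * H yz.2].
Proof.
pose at_ s : option (garr G * garr G) :=
  if pselect (exists y, germs_of s y /\ grng y = grng g) is left h
  then Some (sval (cid h), gmul (ginv (sval (cid h))) g) else None.
pose r := undup (pmap at_ sg).
have rP yz : yz \in r -> gsrc yz.1 = grng yz.2 /\ gmul yz.1 yz.2 = g.
  rewrite mem_undup mem_pmap => /mapP[s _]; rewrite /at_.
  case: pselect => // h [->]; have := svalP (cid h).
  move: (sval (cid h)) => y [_ yg]; cbn [fst snd].
  have E : gsrc (ginv (y : garr G)) = grng g by rewrite gsrc_inv.
  split; first by rewrite grng_mul// grng_inv.
  by rewrite gmulA ?grng_inv// gmulgV yg gmul1g.
exists r; split=> //.
  by rewrite (leq_trans (size_undup _))// size_pmap count_size.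
move=> F H Fs; rewrite /convolution (fsbigE r) ?undup_uniq//.
- rewrite big_seq_cond [RHS]big_seq; apply: eq_bigl => yz.
  by apply: andb_idr => /rP ?; rewrite inE.
- move=> [y z] /= [E e]; apply: contraNeq; rewrite mulf_eq0 negb_or => /andP[/Fs].
  move=> [s ss sy] _; rewrite mem_undup mem_pmap; apply/mapP; exists s => //.
  have yg : grng y = grng g by rewrite -e grng_mul.
  rewrite /at_; case: pselect => [h|]; last by case; exists y.
  have := svalP (cid h); move: (sval (cid h)) => y' [sy' yg'].
  have -> : y' = y by apply: (@germs_of_rng_inj _ _ s); rewrite ?inE// [LHS]yg'.
  by rewrite -e mulVKg.
Qed.

Lemma germs_of_inv s g : germs_of s (ginv g) <-> germs_of (sinv s) g.
Proof.
have inv1 t (k : garr G) : germs_of t k -> germs_of (sinv t) (ginv k).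
  by move=> [phi [h ->]]; rewrite /= germ_invE; exact: germ_in.
split; last by move/inv1; rewrite sinvK.
suff invK (k : garr G) : ginv (ginv k) = k by move/inv1; rewrite invK.
rewrite -[LHS]gmulg1 (gsrc_inv (ginv k)) grng_inv -gmulVg.
by rewrite gmulA ?gsrc_inv ?grng_inv// gmulVg gsrc_inv gmul1g.
Qed.

Lemma germs_of_top g : germs_of (val o) g -> grng g = gsrc g.
Proof. by move=> [phi [h ->]]; rewrite /= germ_srcE germ_rngE idem_act. Qed.

Lemma convolution_indic s t :
  @convolution R G (carry s (fun=> 1)) (carry t (fun=> 1)) =
  carry (s * t)%g (fun=> 1).
Proof.
apply/funext => g; have [gst|ngst] := pselect (germs_of (s * t)%g g); last first.
  by rewrite (convolution_out _ _ ngst) ?carry_out//; exact: carry_supp.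
have [y [z [sy tz E e]]] := germs_of_mulP gst.
rewrite -{1}e (convolution_supp (@carry_supp _ _) (@carry_supp _ _) sy tz E).
by rewrite /carry !asboolT// mulr1.
Qed.

Lemma convolution_indic_top s f :
  @convolution R G (carry s (fun=> 1)) (carry (val o) f) =
  carry s f.
Proof.
apply/funext => g; have [gst|ngst] := pselect (germs_of (s * val o)%g g); last first.
  rewrite (convolution_out (@carry_supp _ _) (@carry_supp _ _) ngst).
  by rewrite carry_out// -[s in germs_of s]ho.
have [y [z [sy tz E e]]] := germs_of_mulP gst.
rewrite -{1}e (convolution_supp (@carry_supp _ _) (@carry_supp _ _) sy tz E).
rewrite ho in gst; rewrite /carry !asboolT// mul1r; congr f.
by have := congr1 (@gsrc G) e; rewrite gsrc_mul.
Qed.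

Lemma convolution_top f f' :
  @convolution R G (carry (val o) f) (carry (val o) f') =
  carry (val o) (fun phi => f phi * f' phi).
Proof.
apply/funext => g.
have [gst|ngst] := pselect (germs_of (val o * val o)%g g); last first.
  rewrite (convolution_out (@carry_supp _ _) (@carry_supp _ _) ngst).
  by rewrite carry_out// -[X in germs_of X]idemE.
have [y [z [sy tz E e]]] := germs_of_mulP gst.
rewrite -{1}e (convolution_supp (@carry_supp _ _) (@carry_supp _ _) sy tz E).
rewrite idemE in gst; rewrite /carry !asboolT//.
have zg : gsrc z = gsrc g by have := congr1 (@gsrc G) e; rewrite gsrc_mul.
by congr (f _ * f' _) => //; rewrite [LHS]E (germs_of_top tz).
Qed.

Lemma involution_indic s :
  @involution R G (carry s (fun=> 1)) = carry (sinv s) (fun=> 1).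
Proof.
apply/funext => g; rewrite /involution /carry.
have := germs_of_inv s g; case: asboolP => gs; case: asboolP => gs' h.
- by rewrite rmorph1.
- by case: gs'; apply/h.
- by case: gs; apply/h.
- by rewrite rmorph0.
Qed.

Lemma involution_top f :
  @involution R G (carry (val o) f) =
  carry (val o) (fun phi => (f phi)^*).
Proof.
apply/funext => g; rewrite /involution /carry.
have := germs_of_inv (val o) g; rewrite (sinv_idem (idemE o)).
case: asboolP => gs; case: asboolP => gs' h.
- congr (f _)^*; have := germs_of_top gs'.
  by rewrite -[germ_src (ginv g)]/(gsrc (ginv g)) gsrc_inv.
- by case: gs'; apply/h.
- by case: gs; apply/h.
- by rewrite rmorph0.
Qed.

End Convolution.

(** * Representations of an inverse semigroup *)

Section Average.
Variable R : realType.

(** In polar form this is the identity 2 r = (r + i t) + (r - i t) for r in [0, 1]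
    and t^2 = 1 - r^2. *)
Lemma disk_average (c : R[i]) (M : R) : nrm c <= M ->
  exists u v : R[i], [/\ u^* * u = 1, v^* * v = 1 & c = ((M / 2)%:C)%C * (u + v)].
Proof.
move=> cM.
have unit_conj (u : R[i]) : nrm u = 1 -> u^* * u = 1.
  by move=> u1; rewrite mulrC -normCK nrmE u1 expr1n.
have [M0|M0] := eqVneq M 0.
  exists 1, (-1); rewrite !unit_conj ?nrmN ?nrm1// subrr mulr0; split=> //.
  by apply: nrm_eq0; apply/eqP; rewrite eq_le nrm_ge0 andbT -M0.
have Mp : 0 < M by rewrite lt_neqAle eq_sym M0 (le_trans (nrm_ge0 c)).
pose r := nrm c / M.
have r0 : 0 <= r by rewrite divr_ge0 ?nrm_ge0// ltW.
have r1 : r <= 1 by rewrite ler_pdivrMr// mul1r.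
have [s s1 cs] : exists2 s : R[i], nrm s = 1 & c = s * (nrm c)%:C%C.
  have [->|c0] := eqVneq c 0; first by exists 1; rewrite ?nrm1// nrm0 mulr0.
  have nc : nrm c != 0 by apply: contra_neq c0; exact: nrm_eq0.
  have nc' : (nrm c)%:C%C != 0 :> R[i] by rewrite -nrmE normr_eq0.
  exists (c / (nrm c)%:C%C); last by rewrite divfK.
  rewrite -fmorphV nrmM nrm_real ger0_norm ?invr_ge0 ?nrm_ge0//.
  by rewrite mulfV.
pose t := Num.sqrt (1 - r ^+ 2).
have tt : t ^+ 2 = 1 - r ^+ 2 by rewrite sqr_sqrtr// subr_ge0 expr_le1.
have nu (x : R) : x ^+ 2 = 1 - r ^+ 2 -> nrm (r +i* x)%C = 1.
  by move=> xx; rewrite /nrm normc_def /= xx addrC subrK sqrtr1.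
exists (s * (r +i* t)%C), (s * (r +i* (- t))%C); split.
- by apply: unit_conj; rewrite nrmM s1 mul1r nu.
- by apply: unit_conj; rewrite nrmM s1 mul1r nu// sqrrN.
rewrite -mulrDr {1}cs mulrCA; congr (_ * _).
have -> : (r +i* t + (r +i* - t) = ((2 * r)%:C))%C.
  by apply/eqP; rewrite eq_complex /= subrr eqxx andbT mulrDl mul1r.
rewrite -rmorphM; congr (_%:C)%C.
by rewrite /r; field.
Qed.

End Average.

Section Representations.
Variables (R : realType) (S : invSemigroupType) (X : set (idem S * {fset idem S})).
Variable o : idem S.
Hypothesis ho : forall s : S, (s * val o)%g = s.
Variables (A : cstarType R) (T : S -> A).
Implicit Types (s t : S) (e f : idem S) (a b : A) (l : seq (idem S * bool)).

Record srep : Prop := Srep {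
  srep0 : T (@szero S) = 0;
  srepM : forall s t, T (s * t)%g = T s ** T t;
  srepV : forall s, T (sinv s) = adj (T s) }.

(** Multiplication by the projections T_e and 1 - T_e, in a form that makes sense
    without a unit in the algebra. *)
Definition cut1 a (eb : idem S * bool) :=
  if eb.2 then a ** T (val eb.1) else a - a ** T (val eb.1).

Definition cut a l := foldr (fun eb x => cut1 x eb) a l.

(** The equation e = join of [F] for commuting projections: each one of [F] lies
    below that of [e], and nothing of [e] is left outside of them. *)
Definition obeys e (F : {fset idem S}) :=
  (forall f, f \in F -> T (val e) ** T (val f) = T (val f)) /\
  cut (T (val e)) [seq (f, false) | f <- F] = 0.

Hypothesis Trep : srep.

Let T0 := srep0 Trep.
Let TM := srepM Trep.
Let TV := srepV Trep.

Lemma srep_idemC e f : T (val e) ** T (val f) = T (val f) ** T (val e).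
Proof. by rewrite -!TM (idemC (idemE e) (idemE f)). Qed.

Lemma srep_proj e : is_projection (T (val e)).
Proof. by split; [rewrite -TV (sinv_idem (idemE e))|rewrite -TM idemE]. Qed.

Lemma srep_contr s : nrm (T s) <= 1.
Proof. by apply: nrm_isometry (srep_proj (dom s)); rewrite /= TM TV. Qed.

Lemma srep_top s : T s ** T (val o) = T s.
Proof. by rewrite -TM ho. Qed.

Lemma cut1D a b eb : cut1 (a + b) eb = cut1 a eb + cut1 b eb.
Proof.
by rewrite /cut1; case: eb.2; rewrite cmulDl// opprD addrACA.
Qed.

Lemma cut1M a b eb : cut1 (a ** b) eb = a ** cut1 b eb.
Proof. by rewrite /cut1; case: eb.2; rewrite ?cmulBr cmulA. Qed.

Lemma cut1C a x y : cut1 (cut1 a x) y = cut1 (cut1 a y) x.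
Proof.
have c : a ** T (val x.1) ** T (val y.1) = a ** T (val y.1) ** T (val x.1).
  by rewrite -!cmulA srep_idemC.
rewrite /cut1; case: x.2; case: y.2; rewrite ?cmulBl ?c//.
by rewrite !opprB addrACA [RHS]addrACA; congr (_ + _); rewrite addrC.
Qed.

Lemma cutD a b l : cut (a + b) l = cut a l + cut b l.
Proof. by elim: l => //= x l ->; rewrite cut1D. Qed.

Lemma cutM a b l : cut (a ** b) l = a ** cut b l.
Proof. by elim: l => //= x l ->; rewrite cut1M. Qed.

Lemma cut_1 a l x : cut (cut1 a x) l = cut1 (cut a l) x.
Proof. by elim: l => //= y l ->; rewrite cut1C. Qed.

Lemma cutC a l l' : cut (cut a l) l' = cut (cut a l') l.
Proof. by elim: l => //= x l <-; rewrite cut_1. Qed.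

Lemma cut0 l : cut 0 l = 0.
Proof. by have := cutM 0 0 l; rewrite !cmul0x. Qed.

Lemma cut_mulT a e l : cut (a ** T (val e)) l = cut a l ** T (val e).
Proof. exact: (cut_1 a l (e, true)). Qed.

Lemma cut_mem a l e (b : bool) : (e, b) \in l ->
  cut a l ** T (val e) = if b then cut a l else 0.
Proof.
elim: l => //= x l ih; rewrite inE => /predU1P[<-|/ih h].
  rewrite /cut1; case: (b) => /=; rewrite ?cmulBl -cmulA (srep_proj e).2//.
  by rewrite subrr.
have -> : cut1 (cut a l) x ** T (val e) = cut1 (cut a l ** T (val e)) x.
  exact: (cut1C (cut a l) x (e, true)).
rewrite h; case: (b) => //.
by rewrite /cut1; case: x.2; rewrite cmul0x ?subrr.
Qed.

Lemma cut_sub a l l' : {subset l' <= l} -> cut (cut a l) l' = cut a l.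
Proof.
elim: l' => //= -[e b] l' ih sub; rewrite ih => [|x xl]; last first.
  by apply: sub; rewrite inE xl orbT.
rewrite /cut1 /=; have := cut_mem a (sub _ (mem_head _ _)).
by case: b {sub} => ->; rewrite ?subr0.
Qed.

Lemma cut_sub0 a l l' : {subset l' <= l} -> cut a l' = 0 -> cut a l = 0.
Proof. by move=> /(cut_sub a) <- h; rewrite cutC h cut0. Qed.

(** Conjugation by T_s intertwines the products defined by [cut], because T_s T_s^*
    commutes with the idempotents. *)
Lemma obeys_conj : conj_stable [set eF | obeys eF.1 eF.2].
Proof.
move=> s e F [/= h1 h2]; split=> /=.
  move=> _ /imfsetP[f /= fF ->].
  rewrite -TM /= conjM ?idemE// TM [in RHS]TM !(TM (sinv s)).
  by rewrite TM h1.
have conj_cut a l : {in l, forall x, x.2 = false} ->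
    cut (T (sinv s) ** a ** T s) [seq (iconj s x.1, x.2) | x <- l] =
    T (sinv s) ** cut a l ** T s.
  elim: l => //= x l ih xl; rewrite ih => [|y yl]; last first.
    by apply: xl; rewrite inE yl orbT.
  rewrite /cut1 /= (xl x (mem_head _ _)) cmulBr cmulBl; congr (_ - _).
  have c : T s ** T (sinv s) ** T (val x.1) ** T s = T (val x.1) ** T s.
    rewrite -!TM (idemC (idem_rng s) (idemE x.1)) -[in RHS](mulsVs s).
    by rewrite !mulgA.
  by rewrite /= !TM -!cmulA; congr (_ ** (_ ** _)); rewrite !cmulA.
have := conj_cut (T (val e)) [seq (f, false) | f <- F].
rewrite h2 cmulx0 cmul0x -!TM => h.
apply: cut_sub0 (h _); last by move=> _ /mapP[f _ ->].
move=> _ /mapP[_ /mapP[f fF ->] ->] /=; apply/mapP; exists (iconj s f) => //.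
by apply/imfsetP; exists f.
Qed.

Hypothesis TX : forall e F, X (e, F) -> obeys e F.

Lemma obeys_closure e F : conj_closure X (e, F) -> obeys e F.
Proof.
move=> h; apply: (h [set eF | obeys eF.1 eF.2]); split; first exact: obeys_conj.
by move=> -[e' F'] /TX.
Qed.

(** The algebraic counterpart of [clash_fits]. *)
Lemma cut_clash a l : a ** T (val o) = a -> clash X o l -> cut a l = 0.
Proof.
move=> ao [h|h|e f b c d he hf hef bcd|e F beta b XF he hF hb].
- by have := cut_mem a h; rewrite T0 cmulx0.
- by have := cut_mem a h; rewrite -cut_mulT ao.
- have := cut_mem a hef; rewrite /= TM cmulA (cut_mem a he).
  case: b he bcd => he; last first.
    by rewrite cmul0x => /=; case: d hef => // _ _ ->.
  rewrite (cut_mem a hf) /=; case: c hf => hf; case: d hef => // _ _ //.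
have [o1 o2] := obeys_closure XF.
have xF f : f \in F -> (f, beta f) \in l := hF f.
case: b he hb => he hb.
- have nb f : f \in F -> beta f = false.
    by move=> fF; apply/negbTE; move: hb; rewrite big_has eq_sym eqb_id => /hasPn ->.
  have := cut_sub a (_ : {subset [seq (f, false) | f <- F] <= l}) => <-; last first.
    by move=> _ /mapP[f fF ->]; rewrite -(nb _ fF); exact: xF.
  by rewrite -(cut_mem a he) cutM o2 cmulx0.
- move: hb; rewrite big_has eq_sym eqbF_neg negbK => /hasP[f fF bf].
  have := cut_mem a (xF f fF); rewrite bf => <-.
  by rewrite -(o1 f fF) cmulA (cut_mem a he) cmul0x.
Qed.

End Representations.

(** * The norm of a linear combination *)

Section KeyEstimate.
Variables (R : realType) (S : invSemigroupType) (X : set (idem S * {fset idem S})).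
Variable o : idem S.
Hypothesis ho : forall s : S, (s * val o)%g = s.
Variable code : idem S -> nat.
Hypothesis code_inj : injective code.
Variables (A : cstarType R) (T : S -> A).
Hypothesis Trep : srep T.
Hypothesis TX : forall e F, X (e, F) -> obeys T e F.
Implicit Types (s t : S) (e f : idem S) (a b w : A) (l : seq (idem S * bool)).
Implicit Types (L : seq (R[i] * S)) (sg : seq S).
Local Notation G := (germ_groupoid X).

(** A formal linear combination of elements of [S] is read as a function on the
    groupoid and as an element of the algebra. *)
Definition steinberg L : garr G -> R[i] :=
  fun g => \sum_(p <- L) p.1 * carry p.2 (fun=> 1) g.

Definition lincomb L : A := \sum_(p <- L) p.1 *: T p.2.

Definition below sg s := exists2 t, t \in sg & exists e, s = (t * val e)%g.

Definition subordinate sg L := forall p, p \in L -> below sg p.2.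

Let TM := srepM Trep.
Let Tpj := srep_proj Trep.
Let Ttop := srep_top ho Trep.

Lemma lincomb_top L : lincomb L ** T (val o) = lincomb L.
Proof.
by rewrite cmul_suml; apply: eq_bigr => p _; rewrite cmulZl Ttop.
Qed.

(** Unitaries of the corner of T_o that commute with the projections.  They play
    the role of the unimodular functions on the spectrum; they have norm at most 1
    and, unlike elements of norm at most 1, can obviously be pasted along a
    projection ([diag_paste]). *)
Definition diag_unitary w :=
  [/\ adj w ** w = T (val o), w ** T (val o) = w & forall e, T (val e) ** w = w ** T (val e)].

Lemma diag_scalar (u : R[i]) : u^* * u = 1 -> diag_unitary (u *: T (val o)).
Proof.
move=> uu; split.
- by rewrite adjZ (Tpj o).1 cmulZl cmulZr (Tpj o).2 scalerA uu scale1r.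
- by rewrite cmulZl (Tpj o).2.
- by move=> e; rewrite cmulZl cmulZr (srep_idemC Trep).
Qed.

Lemma diag_nrm w : diag_unitary w -> nrm w <= 1.
Proof. by case=> h _ _; exact: nrm_isometry h (Tpj o). Qed.

Lemma diag_paste w v e : diag_unitary w -> diag_unitary v ->
  diag_unitary (w ** T (val e) + (v - v ** T (val e))).
Proof.
set p := T (val e); move=> [w1 w2 w3] [v1 v2 v3].
have pp : p ** p = p := (Tpj e).2.
have pa : adj p = p := (Tpj e).1.
have po : p ** T (val o) = p by rewrite /p Ttop.
have op : T (val o) ** p = p by rewrite /p (srep_idemC Trep) Ttop.
have wp : adj w ** p = p ** adj w by rewrite -{1}pa -adjM w3 adjM pa.
have vp : adj v ** p = p ** adj v by rewrite -{1}pa -adjM v3 adjM pa.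
have X1 : adj (w ** p) ** (w ** p) = p.
  by rewrite adjM pa -!cmulA (cmulA (adj w)) w1 op pp.
have X2 : adj (w ** p) ** (v - v ** p) = 0.
  by rewrite adjM pa -wp cmulBr /p -(v3 e) -/p !cmulA -(cmulA (adj w) p p) pp subrr.
have X3 : adj (v - v ** p) ** (w ** p) = 0.
  by rewrite -[LHS]adjK adjM adjK X2 adj0.
have X4 : adj (v - v ** p) ** (v - v ** p) = T (val o) - p.
  rewrite adjB adjM pa cmulBl !cmulBr -!cmulA !(cmulA (adj v)) v1 op po pp.
  by rewrite subrr subr0.
split.
- move: X2 X3 X4; move: (v - v ** p) => d X2 X3 X4.
  by rewrite adjD cmulDl !cmulDr X1 X2 X3 X4 addr0 add0r addrC subrK.
- by rewrite cmulDl cmulBl -!cmulA po v2.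
- move=> f; rewrite cmulDl cmulDr cmulBr cmulBl !cmulA w3 v3 -!cmulA.
  by rewrite (srep_idemC Trep f e).
Qed.

(** An element of [sg] through whose germs [g] passes, the same for all
    occurrences of [g]. *)
Definition leader sg (g : garr G) : S :=
  nth (val o) sg (find (fun s => `[< germs_of s g >]) sg).

Lemma leaderP sg t g : t \in sg -> germs_of t g ->
  leader sg g \in sg /\ germs_of (leader sg g) g.
Proof.
move=> tsg tg; have h : has (fun s => `[< germs_of s g >]) sg.
  by apply/hasP; exists t => //; exact/asboolP.
by split; [rewrite mem_nth// -has_find|exact/asboolP/(nth_find (val o) h)].
Qed.

(** Close to [phi], each term of [L] may be replaced by the leader of its germ at
    [phi], or dropped if it has no germ there.  The coefficients that accumulate
    at a leader add up to the value of [steinberg L] at its germ. *)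
Lemma local_leaders sg L (phi : spectrum X) : uniq sg -> subordinate sg L ->
  exists2 l, fits (val phi) l & forall l', {subset l <= l'} ->
    cut T (lincomb L) l' = cut T (\sum_(s <- sg)
      (if pselect (val phi (dom s)) is left h
       then if leader sg (germ h) == s then steinberg L (germ h) else 0
       else 0) *: T s) l'.
Proof.
move=> usg; elim: L => [|[c t] L ih] sub.
  exists [::] => // l' _; rewrite /lincomb big_nil big1 ?cut0// => s _.
  by case: pselect => h; rewrite ?scale0r// /steinberg big_nil if_same scale0r.
have [|l fl hl] := ih; first by move=> p pL; apply: sub; rewrite inE pL orbT.
have [t0 t0sg [e0 /= te0]] := sub (c, t) (mem_head _ _).
suff [l1 fl1 hl1] : exists2 l, fits (val phi) l & forall l', {subset l <= l'} ->
    cut T (T t) l' = cut T (\sum_(s <- sg)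
      (if pselect (val phi (dom s)) is left h
       then if leader sg (germ h) == s then carry t (fun=> 1) (germ h) else 0
       else 0) *: T s) l'.
  exists (l1 ++ l) => [|l' ll']; first by rewrite /fits all_cat; apply/andP.
  rewrite /lincomb big_cons /= cutD //.
  have cutZ a : cut T (c *: a) l' = c *: cut T a l'.
    elim: (l') => //= x l0 ->; rewrite /cut1; case: x.2; rewrite ?cmulZl//.
    by rewrite scalerBr.
  rewrite cutZ hl1 => [|x xl]; last by apply: ll'; rewrite mem_cat xl.
  rewrite -/(lincomb L) hl => [|x xl]; last by apply: ll'; rewrite mem_cat xl orbT.
  rewrite -cutZ -cutD// scaler_sumr -big_split; congr (cut T _ l').
  apply: eq_bigr => s _ /=; rewrite scalerA -scalerDl; congr (_ *: _).
  case: pselect => h; last by rewrite mulr0 addr0.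
  by case: ifP => _; rewrite ?mulr0 ?addr0// /steinberg big_cons.
have [ht|ht] := pselect (val phi (dom t)); last first.
  exists [:: (dom t, false)]; first by rewrite /= andbT; apply/eqP/negbTE/negP.
  move=> l' ll'; rewrite big1 => [|s _]; last first.
    case: pselect => h; rewrite ?scale0r//; case: ifP => _; rewrite ?scale0r//.
    rewrite carry_out ?scale0r// => /germs_ofP[k _]; apply: ht.
    by rewrite germ_srcE in k.
  have := cut_mem Trep (T t) (ll' _ (mem_head _ _)).
  rewrite -(cut_mulT Trep) -TM /= mulgA mulsVs => ->.
  by rewrite (cut0 T).
have tg : germs_of t (germ ht) by exact: germ_in.
have t0g : germs_of t0 (germ ht).
  have /andP[pe pt] : val phi e0 && val phi (dom t0) by rewrite -germ_dom -te0.
  by apply/germs_of_germ; exists e0; rewrite // te0 -mulgA idemE.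
have [ls lg] := leaderP t0sg t0g.
have /germs_of_germ[e pe tle] := lg.
exists [:: (e, true)]; first by rewrite /= andbT; apply/eqP.
move=> l' ll'.
have red s : cut T (T s) l' = cut T (T (s * val e)%g) l'.
  by rewrite TM (cut_mulT Trep) (cut_mem Trep _ (ll' _ (mem_head _ _))).
rewrite [LHS]red [in LHS]tle -red; congr (cut T _ l').
rewrite (bigD1_seq _ ls usg) /= big1 ?addr0 => [|s /negP sl]; last first.
  case: pselect => h; rewrite ?scale0r//; case: eqP => [ld|]; rewrite ?scale0r//.
  rewrite carry_out ?scale0r// => tgs; apply: sl; rewrite -ld; apply/eqP.
  congr (leader sg _); apply: (@germs_of_inj _ _ t); rewrite ?inE//.
  by rewrite !germ_srcE.
have h : val phi (dom (leader sg (germ ht))).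
  by have [h _] := germs_ofP lg; move: h; rewrite germ_srcE.
case: pselect => // h'.
have -> : germ h' = germ ht.
  apply: (@germs_of_inj _ _ (leader sg (germ ht))); rewrite ?inE ?germ_srcE//.
  exact: germ_in.
by rewrite eqxx carry_germ scale1r.
Qed.

(** The statement to localize: up to a product of projections, [lincomb L] is a
    sum over [sg] of terms M T_s z, where [z] is an average of two diagonal
    unitaries.  Such sums can be pasted along a projection without enlarging the
    number of terms or the bound. *)
Lemma key_estimate_uniq sg L (M : R) : uniq sg -> subordinate sg L -> 0 <= M ->
  (forall g, nrm (steinberg L g) <= M) -> nrm (lincomb L) <= (size sg)%:R * M.
Proof.
move=> usg sub M0 hM.
pose m : R[i] := ((M / 2)%:C)%C.
pose comb (w v : S -> A) := \sum_(s <- sg) m *: (T s ** (w s + v s)).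
pose Q l := exists w v : S -> A, [/\ forall s, diag_unitary (w s),
  forall s, diag_unitary (v s) & cut T (lincomb L) l = cut T (comb w v) l].
have comb_top (w v : S -> A) : (forall s, diag_unitary (w s)) -> (forall s, diag_unitary (v s)) ->
    comb w v ** T (val o) = comb w v.
  move=> dw dv; rewrite cmul_suml; apply: eq_bigr => s _.
  by rewrite cmulZl -cmulA cmulDl; have [_ -> _] := dw s; have [_ -> _] := dv s.
have [w [v [dw dv E]]] : Q [::].
  apply: (@compact_induction S X o code code_inj).
  - move=> l e [w1 [v1 [dw1 dv1 E1]]] [w2 [v2 [dw2 dv2 E2]]].
    pose pst (x y : A) := x ** T (val e) + (y - y ** T (val e)).
    exists (fun s => pst (w1 s) (w2 s)), (fun s => pst (v1 s) (v2 s)); split.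
    + by move=> s; exact: diag_paste.
    + by move=> s; exact: diag_paste.
    have -> : comb (fun s => pst (w1 s) (w2 s)) (fun s => pst (v1 s) (v2 s)) =
        pst (comb w1 v1) (comb w2 v2).
      rewrite /pst !cmul_suml -sumrB -big_split; apply: eq_bigr => s _ /=.
      rewrite !cmulZl -scalerBr -scalerDr; congr (_ *: _).
      by rewrite -!cmulA -cmulBr -cmulDr; congr (_ ** _); rewrite !cmulDl opprD addrACA [X in _ + X]addrACA.
    have E3 b : cut T (b - b ** T (val e)) l = cut T b l - cut T b l ** T (val e).
      exact: (cut_1 Trep b l (e, false)).
    rewrite /pst cutD (cut_mulT Trep) E3.
    rewrite -[LHS](subrK (cut T (lincomb L) l ** T (val e))) addrC.
    by congr (_ + _); [exact: E1|exact: E2].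
  - move=> l cl; exists (fun=> T (val o)), (fun=> T (val o)).
    have d : diag_unitary (T (val o)).
      by have := diag_scalar (_ : 1^* * 1 = 1); rewrite scale1r rmorph1 mulr1; apply.
    split=> //.
    by rewrite !(cut_clash Trep TX _ cl)//; [exact: comb_top|exact: lincomb_top].
  - move=> phi; have [l fl hl] := local_leaders phi usg sub.
    have avg s : exists uv : R[i] * R[i], [/\ uv.1^* * uv.1 = 1, uv.2^* * uv.2 = 1 &
        (if pselect (val phi (dom s)) is left h
         then if leader sg (germ h) == s then steinberg L (germ h) else 0
         else 0) = m * (uv.1 + uv.2)].
      have [|u [v [u1 v1 uv]]] := @disk_average R (if pselect (val phi (dom s)) is left h
         then if leader sg (germ h) == s then steinberg L (germ h) else 0
         else 0) M; last by exists (u, v).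
      by case: pselect => h; rewrite ?nrm0//; case: ifP => _; rewrite ?nrm0.
    have [uv huv] := choice avg.
    exists l => // l' _ ll'.
    exists (fun s => (uv s).1 *: T (val o)), (fun s => (uv s).2 *: T (val o)).
    split=> [s|s|].
    + by apply: diag_scalar; have [] := huv s.
    + by apply: diag_scalar; have [] := huv s.
    rewrite hl//; congr (cut T _ l'); apply: eq_bigr => s _.
    have [_ _ ->] := huv s.
    by rewrite -scalerDl cmulZr Ttop scalerA.
rewrite -[lincomb L]/(cut T (lincomb L) [::]) E /= (le_trans (nrm_sum _ _ _))//.
have -> : (size sg)%:R * M = \sum_(s <- sg) M.
  by rewrite big_const_seq count_predT iter_addr addr0 mulr_natl.
apply: ler_sum => s _; rewrite nrmZ nrm_real ger0_norm ?divr_ge0//.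
have := nrm_cmul (T s) (w s + v s); have := srep_contr Trep s.
have := nrmD (w s) (v s); have := diag_nrm (dw s); have := diag_nrm (dv s).
have := nrm_ge0 (w s + v s) => p1 p2 p3 p4 p5 p6.
have : nrm (T s ** (w s + v s)) <= 2 by nra.
by move: M0 => {p1 p2 p3 p4 p5 p6}; nra.
Qed.

Lemma key_estimate sg L (M : R) : subordinate sg L -> 0 <= M ->
  (forall g, nrm (steinberg L g) <= M) -> nrm (lincomb L) <= (size sg)%:R * M.
Proof.
move=> sub M0 hM.
have sub' : subordinate (undup sg) L.
  by move=> p /sub[t ts te]; exists t; rewrite ?mem_undup.
rewrite (le_trans (key_estimate_uniq (undup_uniq sg) sub' M0 hM))//.
by rewrite ler_wpM2r// ler_nat size_undup.
Qed.

End KeyEstimate.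

(** * Integrating functions on the groupoid *)

Section Approximation.
Variables (R : realType) (S : invSemigroupType) (X : set (idem S * {fset idem S})).
Variable o : idem S.
Hypothesis ho : forall s : S, (s * val o)%g = s.
Variable code : idem S -> nat.
Hypothesis code_inj : injective code.
Local Notation G := (germ_groupoid X).
Implicit Types (s t : S) (e : idem S) (L : seq (R[i] * S)) (sg : seq S).
Implicit Types (f : garr G -> R[i]).

Definition uapprox sg f (d : R) L :=
  subordinate sg L /\ forall g, nrm (f g - steinberg L g) <= d.

Lemma germs_of_mulE s e (g : garr G) :
  germs_of (s * val e)%g g <-> germs_of s g /\ val (germ_src g) e.
Proof.
split=> [[phi [h ->]]|[[phi [h ->]]]]; rewrite germ_srcE.
  have /andP[pe ps] : val phi e && val phi (dom s) by rewrite -germ_dom.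
  split=> //; apply/germs_of_germ; exists e => //.
  by rewrite -mulgA idemE.
by move=> pe; apply/germs_of_germ; exists e; rewrite // -mulgA idemE.
Qed.

Lemma carry_mulE s e (g : garr G) :
  carry (s * val e)%g (fun=> 1 : R[i]) g = carry s (fun phi => (val phi e)%:R) g.
Proof.
rewrite /carry; have h := germs_of_mulE s e g; case: asboolP => [/h[gs ge]|ng].
  by rewrite asboolT// ge.
case: asboolP => // gs; case ge: (val (germ_src g) e) => //.
by case: ng; apply/h.
Qed.

Lemma steinberg_supp sg L : subordinate sg L -> supp_seq sg (@steinberg R S X L).
Proof.
move=> sub g; apply: contraTP => ng; rewrite negbK; apply/eqP.
rewrite /steinberg big_seq big1// => p /sub[t ts [e pe]].
rewrite carry_out ?mulr0// pe => /germs_of_mulE[gt _].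
by apply: ng; exists t.
Qed.

Lemma steinberg_cat L L' (g : garr G) :
  steinberg (L ++ L') g = steinberg L g + steinberg L' g.
Proof. by rewrite /steinberg big_cat. Qed.

Definition scalel (c : R[i]) L := [seq (c * p.1, p.2) | p <- L].

Lemma steinberg_scale c L (g : garr G) : steinberg (scalel c L) g = c * steinberg L g.
Proof.
by rewrite /steinberg big_map mulr_sumr; apply: eq_bigr => p _; rewrite mulrA.
Qed.

Definition mull L L' := [seq (p.1 * q.1, (p.2 * q.2)%g) | p <- L, q <- L'].

Definition adjl L : seq (R[i] * S) := [seq (p.1^*, sinv p.2) | p <- L].

Lemma subordinate_cat sg sg' L L' : subordinate sg L -> subordinate sg' L' ->
  subordinate (sg ++ sg') (L ++ L').
Proof.
move=> sub sub' p; rewrite mem_cat => /orP[/sub|/sub'] [t ts te];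
  by exists t; rewrite // mem_cat ts ?orbT.
Qed.

Lemma subordinate_scale sg c L : subordinate sg L -> subordinate sg (scalel c L).
Proof. by move=> sub _ /mapP[p /sub ? ->]. Qed.

Lemma subordinate_mul sg sg' L L' : subordinate sg L -> subordinate sg' L' ->
  subordinate [seq (s * t)%g | s <- sg, t <- sg'] (mull L L').
Proof.
move=> sub sub' _ /allpairsP[[p q] /= [/sub[s ss [e pe]] /sub'[t tt [e' qe]] ->]].
exists (s * t)%g; first by apply/allpairsP; exists (s, t).
exists (imul (iconj t e) e') => /=; rewrite pe qe.
rewrite !mulgA -(mulgA s t (sinv t)) -(mulgA s (t * sinv t)%g (val e)).
rewrite (idemC (idem_rng t) (idemE e)) !mulgA.
by rewrite -(mulgA _ t (sinv t)) -(mulgA _ (t * sinv t)%g t) mulsVs.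
Qed.

Lemma subordinate_adj sg L : subordinate sg L -> subordinate (map (@sinv S) sg) (adjl L).
Proof.
move=> sub _ /mapP[p /sub[s ss [e pe]] ->] /=.
exists (sinv s); first exact: map_f.
exists (iconj (sinv s) e); rewrite pe sinvM /= sinvK (sinv_idem (idemE e)).
by rewrite !mulgA (idemC (idem_dom s) (idemE e)) -mulgA mulVsV.
Qed.

(** Bilinearity of the convolution, reduced to the product of two indicator
    functions by writing all convolutions at a point over the same pairs. *)
Lemma steinberg_mul L L' :
  @steinberg R S X (mull L L') = @convolution R G (steinberg L) (steinberg L').
Proof.
have subL : subordinate (map snd L) L.
  move=> p pL; exists p.2; first exact: map_f.
  by exists o; rewrite ho.
apply/funext => g; have [r [_ _ rE]] := @convolution_seq R S X (map snd L) g.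
rewrite rE; last exact: steinberg_supp.
rewrite /steinberg /mull big_allpairs_dep /=.
under [RHS]eq_bigr do rewrite big_distrlr.
rewrite [RHS]exchange_big /=; apply: eq_big_seq => p pL.
rewrite [RHS]exchange_big /=; apply: eq_bigr => q _ /=.
rewrite -convolution_indic rE => [|y /carry_supp gy]; last first.
  by exists p.2 => //; exact: map_f.
by rewrite mulr_sumr; apply: eq_bigr => yz _; ring.
Qed.

Lemma steinberg_adj L :
  @steinberg R S X (adjl L) = @involution R G (steinberg L).
Proof.
apply/funext => g; rewrite /involution /steinberg /adjl big_map rmorph_sum.
apply: eq_bigr => p _ /=; rewrite rmorphM; congr (_ * _).
by rewrite -involution_indic.
Qed.

Definition cutl1 L (eb : idem S * bool) :=
  let Le := [seq (p.1, (p.2 * val eb.1)%g) | p <- L] in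
  if eb.2 then Le else L ++ scalel (-1) Le.

Definition cutl L (l : seq (idem S * bool)) := foldr (fun eb x => cutl1 x eb) L l.

Lemma steinberg_cutl L l (g : garr G) :
  steinberg (cutl L l) g = steinberg L g * (fits (val (germ_src g)) l)%:R.
Proof.
elim: l => [|[e b] l ih] /=; first by rewrite mulr1.
have mulE L1 : steinberg [seq (p.1, (p.2 * val e)%g) | p <- L1] g =
    steinberg L1 g * (val (germ_src g) e)%:R.
  rewrite /steinberg big_map mulr_suml; apply: eq_bigr => p _ /=.
  rewrite carry_mulE /carry; case: asboolP => _; rewrite ?mulr0 ?mul0r//.
  by rewrite mulr1.
rewrite /cutl1 /=; case: b => /=.
  by rewrite mulE ih eqb_id -mulnb natrM; ring.
rewrite steinberg_cat steinberg_scale mulE ih eqbF_neg.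
rewrite -[sval _ e]/(val (germ_src g) e).
by case: (val (germ_src g) e); rewrite /= ?mulr1 ?mulr0 ?mulN1r ?subrr ?addr0.
Qed.

Section Rep.
Variables (A : cstarType R) (T : S -> A).
Hypothesis Trep : srep T.
Hypothesis TX : forall e F, X (e, F) -> obeys T e F.

Lemma lincomb_cat L L' : lincomb T (L ++ L') = lincomb T L + lincomb T L'.
Proof. by rewrite /lincomb big_cat. Qed.

Lemma lincomb_scale c L : lincomb T (scalel c L) = c *: lincomb T L.
Proof.
by rewrite /lincomb big_map scaler_sumr; apply: eq_bigr => p _; rewrite scalerA.
Qed.

Lemma lincomb_mul L L' : lincomb T (mull L L') = lincomb T L ** lincomb T L'.
Proof.
rewrite /lincomb /mull big_allpairs_dep cmul_suml; apply: eq_bigr => p _.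
rewrite cmul_sumr; apply: eq_bigr => q _ /=.
by rewrite cmulZl cmulZr scalerA (srepM Trep).
Qed.

Lemma lincomb_adj L : lincomb T (adjl L) = adj (lincomb T L).
Proof.
rewrite /lincomb big_map adj_sum; apply: eq_bigr => p _ /=.
by rewrite adjZ (srepV Trep).
Qed.

Lemma lincomb_cutl L l : lincomb T (cutl L l) = cut T (lincomb T L) l.
Proof.
elim: l => //= -[e b] l <-.
have mulE L1 : lincomb T [seq (p.1, (p.2 * val e)%g) | p <- L1] =
    lincomb T L1 ** T (val e).
  rewrite /lincomb big_map cmul_suml; apply: eq_bigr => p _.
  by rewrite cmulZl (srepM Trep).
rewrite /cutl1 /cut1 /=; case: b => //.
by rewrite lincomb_cat lincomb_scale scaleN1r mulE.
Qed.

(** [b] is the limit of linear combinations of the [T s] whose counterparts on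
    the groupoid converge uniformly to [f], the germs being confined to a fixed
    finite set of bisections. *)
Definition integrates f (b : A) := exists sg, forall d : R, 0 < d ->
  exists2 L, uapprox sg f d L & nrm (b - lincomb T L) <= d.

Lemma lincomb_dist sg sg' L L' (M : R) : subordinate sg L -> subordinate sg' L' ->
  0 <= M -> (forall g : garr G, nrm (steinberg L g - steinberg L' g) <= M) ->
  nrm (lincomb T L - lincomb T L') <= (size sg + size sg')%:R * M.
Proof.
move=> sub sub' M0 hM; rewrite -size_cat.
have -> : lincomb T L - lincomb T L' = lincomb T (L ++ scalel (-1) L').
  by rewrite lincomb_cat lincomb_scale scaleN1r.
apply: (@key_estimate R S X o ho code code_inj A T Trep TX) => // [|g].
  by apply: subordinate_cat => //; exact: subordinate_scale.
by rewrite steinberg_cat steinberg_scale mulN1r.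
Qed.

Lemma integrates_uniq f b b' : integrates f b -> integrates f b' -> b = b'.
Proof.
move=> [sg h] [sg' h']; apply: nrm_sub0 => e e0.
pose N : R := (size sg + size sg')%:R.
have N0 : 0 <= N by [].
pose d := e / (2 + 2 * N).
have N2 : 0 < 2 + 2 * N by lra.
have d0 : 0 < d by rewrite divr_gt0.
have [L [sub hL] bL] := h d d0; have [L' [sub' hL'] bL'] := h' d d0.
have := @lincomb_dist sg sg' L L' (d + d) sub sub' (addr_ge0 (ltW d0) (ltW d0)).
have hh (g : garr G) : nrm (steinberg L g - steinberg L' g) <= d + d.
  by rewrite (le_trans (nrmB3 (f g) _ _))// lerD// nrmBC.
move=> /(_ hh); rewrite -/N.
have := nrmB3 (lincomb T L) b b'; have := nrmB3 (lincomb T L') (lincomb T L) b'.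
rewrite (nrmBC (lincomb T L') b').
have ed : e = d * (2 + 2 * N) by rewrite /d divfK// gt_eqF.
rewrite {1}ed; lra.
Qed.

Lemma integrates_ex sg f : (forall d : R, 0 < d -> exists L, uapprox sg f d L) ->
  exists b, integrates f b.
Proof.
move=> h; pose K : R := 2 * (size sg + size sg)%:R + 2.
have K2 : 2 <= K by rewrite lerDr mulr_ge0.
have Kp : 0 < K by lra.
pose B (d : R) : set A := [set b | exists2 L, uapprox sg f (d / K) L & b = lincomb T L].
have [b hb] : exists b, forall d x, 0 < d -> B d x -> nrm (x - b) <= d.
  apply: cauchy_family.
  - move=> d d0; have [|L hL] := h (d / K); first by rewrite divr_gt0.
    by exists (lincomb T L), L.
  - move=> d d' d0 dd' _ [L [sub hL] ->]; exists L => //; split=> // g.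
    by rewrite (le_trans (hL g))// ler_pM2r ?invr_gt0.
  - move=> d _ _ d0 [L [sub hL] ->] [L' [sub' hL'] ->].
    have dK : 0 <= d / K by rewrite divr_ge0 ?ltW.
    have := @lincomb_dist sg sg L L' (d / K + d / K) sub sub' (addr_ge0 dK dK).
    have hh (g : garr G) : nrm (steinberg L g - steinberg L' g) <= d / K + d / K.
      by rewrite (le_trans (nrmB3 (f g) _ _))// lerD// nrmBC.
    move=> /(_ hh) h1; rewrite (le_trans h1)//.
    have -> : (size sg + size sg)%:R * (d / K + d / K) =
        d * (2 * (size sg + size sg)%:R / K) by field; rewrite gt_eqF.
    by rewrite ler_piMr ?ltW// ltr_pdivrMr// mul1r /K; lra.
exists b, sg => d d0; have [|L [sub hL]] := h (d / K); first by rewrite divr_gt0.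
exists L; last by rewrite nrmBC; apply: hb => //; exists L.
split=> // g; rewrite (le_trans (hL g))// ler_pdivrMr// ler_peMr ?ltW//; lra.
Qed.

Lemma integrates_lincomb L : integrates (steinberg L) (lincomb T L).
Proof.
exists (map snd L) => d d0; exists L; last by rewrite subrr nrm0 ltW.
split=> [p pL|g]; last by rewrite subrr nrm0 ltW.
by exists p.2; [exact: map_f|exists o; rewrite ho].
Qed.

Lemma integratesD f f' b b' : integrates f b -> integrates f' b' ->
  integrates (fun g => f g + f' g) (b + b').
Proof.
move=> [sg h] [sg' h']; exists (sg ++ sg') => d d0.
have d2 : 0 < d / 2 by rewrite divr_gt0.
have [L [sub hL] bL] := h _ d2; have [L' [sub' hL'] bL'] := h' _ d2.
exists (L ++ L'); first split; first exact: subordinate_cat.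
- move=> g; rewrite steinberg_cat opprD addrACA (le_trans (nrmD _ _))//.
  by have := hL g; have := hL' g; lra.
- by rewrite lincomb_cat opprD addrACA (le_trans (nrmD _ _))//; lra.
Qed.

Lemma integratesZ c f b : integrates f b -> integrates (fun g => c * f g) (c *: b).
Proof.
move=> [sg h]; exists sg => d d0.
have [b0 [b0p _ bc]] := small_scale (nrm_ge0 c) d0.
have k (x : R) : x <= b0 -> nrm c * x <= d.
  by move=> xb; rewrite (le_trans _ bc)// mulrC ler_wpM2r ?nrm_ge0.
have [L [sub hL] bL] := h _ b0p; exists (scalel c L).
  split=> [|g]; first exact: subordinate_scale.
  by rewrite steinberg_scale -mulrBr nrmM k.
by rewrite lincomb_scale -scalerBr nrmZ k.
Qed.

Lemma integrates_supp sg f : (forall d : R, 0 < d -> exists L, uapprox sg f d L) ->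
  supp_seq sg f.
Proof.
move=> h g; apply: contraTP => ng; rewrite negbK; apply/eqP/nrm_le0 => d /h[L [sub hL]].
have : steinberg L g = 0.
  by apply/eqP; apply: contrapT => /negP /(steinberg_supp sub).
by have := hL g; move=> + L0; rewrite L0 subr0.
Qed.

Lemma uapprox_bounded sg f L : uapprox sg f 1 L ->
  exists2 M : R, 0 <= M & forall g, nrm (f g) <= M.
Proof.
move=> [_ hL]; exists (1 + \sum_(p <- L) nrm p.1).
  by rewrite addr_ge0// sumr_ge0// => p _; exact: nrm_ge0.
move=> g; have := nrmB3 (steinberg L g) (f g) 0; rewrite !subr0 => h.
rewrite (le_trans h)// lerD// (le_trans (nrm_sum _ _ _))// ler_sum// => p _.
by rewrite nrmM /carry; case: asboolP => _; rewrite ?nrm1 ?nrm0 ?mulr1 ?mulr0 ?nrm_ge0.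
Qed.

(** The supremum of a convolution is controlled because at each point it has at
    most [size sg] terms ([convolution_seq]). *)
Lemma integratesM f f' b b' : integrates f b -> integrates f' b' ->
  integrates (@convolution R G f f') (b ** b').
Proof.
move=> [sg h] [sg' h']; exists [seq (s * t)%g | s <- sg, t <- sg'] => d d0.
have h_ (x : R) : 0 < x -> exists L, uapprox sg f x L by move=> /h[L]; exists L.
have [L1 hL1 _] := h 1 ltr01; have [L2 hL2 _] := h' 1 ltr01.
have [M M0 fM] := uapprox_bounded hL1; have [M' M0' fM'] := uapprox_bounded hL2.
have b0 := nrm_ge0 b; have b0' := nrm_ge0 b'.
pose n : R := (size sg)%:R; have n0 : 0 <= n by [].
pose K := n * (M + M' + 1) + (nrm b + nrm b' + 1).
have K0 : 0 <= K by rewrite /K; nra.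
have [c [c0 c1 cK]] := small_scale K0 d0.
have [L [sub hL] bL] := h _ c0; have [L' [sub' hL'] bL'] := h' _ c0.
have FM (g : garr G) : nrm (steinberg L g) <= M + 1.
  have := nrmB3 (f g) (steinberg L g) 0; rewrite !subr0 nrmBC.
  by have := hL g; have := fM g; lra.
exists (mull L L').
  split=> [|g]; first exact: subordinate_mul.
  rewrite steinberg_mul; have [r [rn _ rE]] := @convolution_seq R S X sg g.
  rewrite !rE; [|exact: steinberg_supp|exact: integrates_supp h_].
  rewrite -sumrB (le_trans (nrm_sum _ _ _))//.
  apply: (@le_trans _ _ (\sum_(yz <- r) c * (M + M' + 1))).
    apply: ler_sum => -[y z] _ /=.
    have -> : f y * f' z - steinberg L y * steinberg L' z =
        (f y - steinberg L y) * f' z + steinberg L y * (f' z - steinberg L' z) by ring.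
    rewrite (le_trans (nrmD _ _))// !nrmM.
    have := hL y; have := hL' z; have := FM y; have := fM' z.
    have := nrm_ge0 (f y - steinberg L y); have := nrm_ge0 (f' z - steinberg L' z).
    have := nrm_ge0 (f' z); have := nrm_ge0 (steinberg L y).
    nra.
  rewrite big_const_seq count_predT iter_addr addr0 -mulr_natl.
  have rn' : (size r)%:R <= n by rewrite ler_nat.
  have : (size r)%:R * (c * (M + M' + 1)) <= n * (c * (M + M' + 1)).
    by rewrite ler_wpM2r// mulr_ge0 ?ltW//; lra.
  move=> /le_trans; apply; rewrite (le_trans _ cK)// mulrCA ler_pM2l// /K; lra.
rewrite lincomb_mul (le_trans (nrm_mul_dist c1 bL bL'))// (le_trans _ cK)//.
by rewrite ler_pM2l// /K lerDr mulr_ge0// addr_ge0// addr_ge0.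
Qed.

Lemma integratesA f b : integrates f b -> integrates (@involution R G f) (adj b).
Proof.
move=> [sg h]; exists (map (@sinv S) sg) => d /h[L [sub hL] bL]; exists (adjl L).
  split=> [|g]; first exact: subordinate_adj.
  by rewrite steinberg_adj /involution -rmorphB nrm_conj.
by rewrite lincomb_adj -adjB nrm_adj.
Qed.

End Rep.
End Approximation.

(** * Boundedness of star-homomorphisms on C_c *)

Section UnitCircle.
Variable R : realType.
Implicit Types (x y a b : R) (c d : R[i]).

(** The point of the upper unit circle above the real part of [c]. *)
Definition lift_circle c : R[i] := (complex.Re c +i* Num.sqrt (1 - complex.Re c ^+ 2))%C.

Lemma nrmC_def x y : nrm (x +i* y)%C = Num.sqrt (x ^+ 2 + y ^+ 2).
Proof. by rewrite /nrm normc_def. Qed.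

Lemma nrmC_le x y : nrm (x +i* y)%C <= `|x| + `|y|.
Proof.
have -> : (x +i* y = x%:C + (0 +i* y))%C.
  by apply/eqP; rewrite eq_complex /= addr0 add0r !eqxx.
rewrite (le_trans (nrmD _ _))// nrm_real lerD2l nrmC_def expr0n add0r.
by rewrite sqrtr_sqr.
Qed.

Lemma Re_le_nrm c : `|complex.Re c| <= nrm c.
Proof. by rewrite -lecR -nrmE normc_ge_Re. Qed.

Lemma sqrt_dist a b : (Num.sqrt a - Num.sqrt b) ^+ 2 <= `|a - b|.
Proof.
wlog ab : a b / b <= a.
  move=> h; have [/h //|/ltW/h] := leP b a.
  by rewrite -sqrrN opprB distrC.
rewrite ger0_norm ?subr_ge0//; have := ler_wsqrtr ab.
have s0 := sqrtr_ge0 b; have s0' := sqrtr_ge0 a.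
have [a0|a0] := leP 0 a; last first.
  have b0 : b <= 0 by apply: le_trans ab _; exact: ltW.
  by rewrite !ler0_sqrtr ?(ltW a0)// subrr expr0n /= subr_ge0.
have := sqr_sqrtr a0; have [b0|b0] := leP 0 b.
  have := sqr_sqrtr b0; nra.
rewrite (ler0_sqrtr (ltW b0)) subr0 => ->; lra.
Qed.

Lemma lift_circle_cts (e : R) : 0 < e -> exists2 d : R, 0 < d &
  forall c c', nrm c <= 1 -> nrm c' <= 1 -> nrm (c - c') <= d ->
    nrm (lift_circle c - lift_circle c') <= e.
Proof.
move=> e0; exists (Num.min (e / 2) (e ^+ 2 / 8)).
  by rewrite lt_min !divr_gt0// exprn_gt0.
move=> c c' c1 c1'; rewrite le_min => /andP[h1 h2].
have := Re_le_nrm c; have := Re_le_nrm c'; have := Re_le_nrm (c - c').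
have -> : complex.Re (c - c') = complex.Re c - complex.Re c' by case: c c' {c1 c1' h1 h2} => [? ?] [].
set a := complex.Re c; set b := complex.Re c' => ab b1 a1.
have -> : lift_circle c - lift_circle c' =
    ((a - b) +i* (Num.sqrt (1 - a ^+ 2) - Num.sqrt (1 - b ^+ 2)))%C by [].
rewrite (le_trans (nrmC_le _ _))//.
have : `|Num.sqrt (1 - a ^+ 2) - Num.sqrt (1 - b ^+ 2)| <= e / 2.
  rewrite -(@ler_pXn2r _ 2)// ?nnegrE ?divr_ge0 ?(ltW e0)//.
  rewrite real_normK ?num_real// (le_trans (sqrt_dist _ _))//.
  have -> : 1 - a ^+ 2 - (1 - b ^+ 2) = (b - a) * (b + a) by ring.
  rewrite normrM distrC.
  have : `|b + a| <= 2.
    by have := ler_normD b a; lra.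
  have := normr_ge0 (a - b); have := normr_ge0 (b + a); nra.
lra.
Qed.

Lemma lift_circle_unit c : nrm c <= 1 -> (lift_circle c)^* * lift_circle c = 1.
Proof.
move=> c1; rewrite mulrC -normCK nrmE /lift_circle nrmC_def.
have := Re_le_nrm c; set a := complex.Re c => a1.
rewrite sqr_sqrtr; first by rewrite addrC subrK sqrtr1 expr1n.
have := real_normK (num_real a); have := normr_ge0 a; nra.
Qed.

Lemma lift_circle_avg c :
  lift_circle c + (lift_circle c)^* = ((2 * complex.Re c)%:C)%C.
Proof.
apply/eqP; rewrite eq_complex /= subrr eqxx andbT.
by rewrite mulrDl mul1r.
Qed.

End UnitCircle.

Section CompactlySupported.
Variables (R : realType) (S : invSemigroupType) (X : set (idem S * {fset idem S})).
Variable o : idem S.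
Hypothesis ho : forall s : S, (s * val o)%g = s.
Variable code : idem S -> nat.
Hypothesis code_inj : injective code.
Local Notation G := (germ_groupoid X).
Implicit Types (s t : S) (e : idem S) (L : seq (R[i] * S)).
Implicit Types (f : spectrum X -> R[i]) (q : seq (S * {f : spectrum X -> R[i] | cts f})).

Lemma cts_const (c : R[i]) : cts (fun _ : spectrum X => c).
Proof. by move=> phi d d0; exists [::] => psi _; rewrite subrr nrm0 ltW. Qed.

Lemma ctsD f f' : cts f -> cts f' -> cts (fun phi => f phi + f' phi).
Proof.
move=> hf hf' phi d d0; have d2 : 0 < d / 2 by rewrite divr_gt0.
have [L hL] := hf phi _ d2; have [L' hL'] := hf' phi _ d2.
exists (L ++ L') => psi ag; rewrite opprD addrACA (le_trans (nrmD _ _))//.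
have h : agree L phi psi by move=> x xL; apply: ag; rewrite mem_cat xL.
have h' : agree L' phi psi by move=> x xL; apply: ag; rewrite mem_cat xL orbT.
by have := hL psi h; have := hL' psi h'; lra.
Qed.

Lemma cts_unif f (F : R[i] -> R[i]) (P : R[i] -> Prop) :
  (forall e : R, 0 < e -> exists2 d : R, 0 < d & forall c c', P c -> P c' ->
     nrm (c - c') <= d -> nrm (F c - F c') <= e) ->
  (forall phi, P (f phi)) -> cts f -> cts (fun phi => F (f phi)).
Proof.
move=> hF Pf hf phi e e0; have [d d0 hd] := hF e e0.
by have [L hL] := hf phi d d0; exists L => psi /hL; exact: hd.
Qed.

Lemma ctsZ c f : cts f -> cts (fun phi => c * f phi).
Proof.
apply: (@cts_unif f (fun x => c * x) xpredT) => // e e0.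
have [d [d0 _ cd]] := small_scale (nrm_ge0 c) e0; exists d => // x y _ _ xy.
rewrite -mulrBr nrmM (le_trans _ cd)// mulrC.
by rewrite ler_wpM2r ?nrm_ge0.
Qed.

Lemma cts_conj f : cts f -> cts (fun phi => (f phi)^*).
Proof.
apply: (@cts_unif f (fun x => x^*) xpredT) => // e e0; exists e => // x y _ _.
by rewrite -rmorphB nrm_conj.
Qed.

Lemma cts_val e : cts (fun phi : spectrum X => (val phi e)%:R : R[i]).
Proof.
move=> phi d d0; exists [:: e] => psi -> //; first by rewrite subrr nrm0 ltW.
exact: mem_head.
Qed.

Definition csum q (g : garr G) : R[i] := \sum_(p <- q) carry p.1 (sval p.2) g.

Lemma Cc_csum q : @Cc R G (csum q).
Proof.
exists (size q), (fun i => carry (tnth (in_tuple q) i).1 (sval (tnth (in_tuple q) i).2)).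
split=> [i|]; last by apply/funext => g; rewrite /csum big_tnth.
by apply: (carry_bisection ho code_inj); exact: svalP.
Qed.

Lemma Cc_csumP (f : garr G -> R[i]) : Cc f -> exists q, f = csum q.
Proof.
move=> [n [b [bb ->]]].
have /choice[q qE] : forall i, exists q, b i = csum q.
  by move=> i; have [q ->] := bisection_carry (bb i); exists q.
exists (flatten [seq q i | i <- index_enum 'I_n]); apply/funext => g.
rewrite /csum big_flatten big_map; apply: eq_bigr => i _.
by rewrite qE.
Qed.

Lemma Cc_carry s f : cts f -> @Cc R G (carry s f).
Proof.
move=> fc; have := Cc_csum [:: (s, exist _ f fc)].
by congr Cc; apply/funext => g; rewrite /csum big_seq1.
Qed.

Lemma csum_cons p q : csum (p :: q) = fun g => carry p.1 (sval p.2) g + csum q g.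
Proof. by apply/funext => g; rewrite /csum big_cons. Qed.

Lemma steinberg_csum L : exists q, steinberg L = csum q.
Proof.
exists [seq (p.2, exist _ _ (cts_const p.1)) | p <- L]; apply/funext => g.
rewrite /csum big_map; apply: eq_bigr => p _ /=.
by rewrite /carry; case: asboolP => _; rewrite ?mulr1 ?mulr0.
Qed.

Lemma cts_sum I (r : seq I) (F : I -> spectrum X -> R[i]) :
  (forall i, cts (F i)) -> cts (fun phi => \sum_(i <- r) F i phi).
Proof.
move=> Fc; elim: r => [|i r ih].
  have -> : (fun phi => \sum_(i <- [::]) F i phi) = (fun=> 0).
    by apply/funext => phi; rewrite big_nil.
  exact: cts_const.
have -> : (fun phi => \sum_(j <- i :: r) F j phi) =
    (fun phi => F i phi + \sum_(j <- r) F j phi).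
  by apply/funext => phi; rewrite big_cons.
exact: ctsD.
Qed.

Lemma carry_approx s f (d : R) : cts f -> 0 < d -> exists L h,
  [/\ cts h, subordinate [:: s] L, @steinberg R S X L = carry s h &
      forall phi, nrm (f phi - h phi) <= d].
Proof.
move=> fc d0; have [r hr] := cts_approx ho code_inj fc d0.
exists [seq (p.1, (s * val p.2)%g) | p <- r].
pose F (p : R[i] * idem S) (phi : spectrum X) : R[i] := p.1 * (val phi p.2)%:R.
exists (fun phi => \sum_(p <- r) F p phi); split=> //.
- by apply: cts_sum => p; apply: ctsZ; exact: cts_val.
- by move=> _ /mapP[p _ ->]; exists s; [exact: mem_head|exists p.2].
- apply/funext => g; rewrite /steinberg big_map /=.
  under eq_bigr do rewrite carry_mulE.
  rewrite /carry; case: asboolP => // _.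
  by rewrite big1// => p _; rewrite mulr0.
Qed.

Section Existence.
Variables (A : cstarType R) (T : S -> A).
Hypothesis Trep : srep T.
Hypothesis TX : forall e F, X (e, F) -> obeys T e F.

Lemma Cc_integrates (f : garr G -> R[i]) : Cc f -> exists b, integrates T f b.
Proof.
move=> /Cc_csumP[q ->]; elim: q => [|[s [f1 f1c]] q [b hb]].
  exists (lincomb T [::]); have := integrates_lincomb X ho T [::].
  by congr integrates; apply/funext => g; rewrite /csum /steinberg !big_nil.
have [b1 hb1] : exists b, integrates T (@carry R S X s f1) b.
  apply: (integrates_ex ho code_inj Trep TX (sg := [:: s])) => d d0.
  have [L [h [_ sub LE fh]]] := carry_approx s f1c d0; exists L; split=> // g.
  rewrite LE /carry; case: asboolP => _; first exact: fh.
  by rewrite subrr nrm0 ltW.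
by exists (b1 + b); rewrite csum_cons; exact: integratesD.
Qed.

End Existence.

Section Boundedness.
Variables (D : cstarType R) (pi : (garr G -> R[i]) -> D).
Hypothesis hpi : Cc_star_hom pi.

Let piD (f g : garr G -> R[i]) : Cc f -> Cc g -> pi (fun x => f x + g x) = pi f + pi g.
Proof. by case: hpi => h _ _ _; exact: h. Qed.
Let piZ c (f : garr G -> R[i]) : Cc f -> pi (fun x => c * f x) = c *: pi f.
Proof. by case: hpi => _ h _ _; exact: h. Qed.
Let piM (f g : garr G -> R[i]) : Cc f -> Cc g -> pi (convolution f g) = pi f ** pi g.
Proof. by case: hpi => _ _ h _; exact: h. Qed.
Let piA (f : garr G -> R[i]) : Cc f -> pi (involution f) = adj (pi f).
Proof. by case: hpi => _ _ _ h; exact: h. Qed.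

Definition germ_rep (s : S) : D := pi (carry s (fun=> 1)).

Lemma Cc_indic s : @Cc R G (carry s (fun=> 1)).
Proof. by apply: Cc_carry; exact: cts_const. Qed.

Lemma pi0 : pi (fun=> 0) = 0.
Proof.
have := piZ 0 (Cc_indic (val o)); rewrite scale0r => <-; congr pi.
by apply/funext => g; rewrite mul0r.
Qed.

Lemma germ_rep_srep : srep germ_rep.
Proof.
split.
- rewrite -pi0; congr pi; apply/funext => g; rewrite carry_out// => -[phi [h _]].
  move: h; have -> : dom (@szero S) = idem0 S by apply: val_inj; rewrite /= muls0.
  by case: (charP phi) => _ ->.
- by move=> s t; rewrite /germ_rep -(convolution_indic R X s t) piM//; exact: Cc_indic.
- by move=> s; rewrite /germ_rep -(involution_indic R X s) piA//; exact: Cc_indic.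
Qed.

Lemma germs_of_idem e (g : garr G) : germs_of (val e) g -> val (germ_src g) e.
Proof.
move=> /germs_ofP[h _]; move: h; suff -> : dom (val e) = e by [].
by apply: val_inj; rewrite /= (sinv_idem (idemE e)) idemE.
Qed.

Lemma pi_steinberg L : pi (steinberg L) = lincomb germ_rep L.
Proof.
elim: L => [|p L ih].
  rewrite /lincomb big_nil -pi0; congr pi; apply/funext => g.
  by rewrite /steinberg big_nil.
rewrite /lincomb big_cons -[X in _ + X]ih -piZ; last exact: Cc_indic.
have [q qE] := steinberg_csum L.
rewrite -piD; last by rewrite qE; exact: Cc_csum.
  by congr pi; apply/funext => g; rewrite /steinberg big_cons.
have -> : (fun x => p.1 * carry p.2 (fun=> 1) x) = carry p.2 (fun=> p.1) :> (garr G -> _).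
  by apply/funext => g; rewrite /carry; case: asboolP => _; rewrite ?mulr1 ?mulr0.
by apply: Cc_carry; exact: cts_const.
Qed.

(** A character of the spectrum takes the value 1 at [e] if and only if it does so
    at some element of [F], so the functions in question are zero on the whole
    groupoid. *)
Lemma germ_rep_obeys e F : X (e, F) -> obeys germ_rep e F.
Proof.
move=> XF.
have jX : conj_closure X (e, F) by move=> Y [_]; apply.
have join (phi : spectrum X) : val phi e = \big[orb/false]_(f <- F) val phi f.
  exact: (joinP phi jX).
split=> [f fF|].
  rewrite -(srepM germ_rep_srep) (idemC (idemE e) (idemE f)).
  congr pi; apply/funext => g; rewrite carry_mulE /carry.
  case: asboolP => // /germs_of_idem gf; rewrite join big_has.
  by have -> : has (val (germ_src g)) F by apply/hasP; exists f.
have eE : germ_rep (val e) = lincomb germ_rep [:: (1, val e)].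
  by rewrite /lincomb big_seq1 scale1r.
rewrite eE -(lincomb_cutl germ_rep_srep) -pi_steinberg -[RHS]pi0; congr pi.
apply/funext => g; rewrite steinberg_cutl /steinberg big_seq1 mul1r /carry.
case: asboolP => [/germs_of_idem|_]; last by rewrite mul0r.
rewrite join big_has => /hasP[f fF gf]; case: fitsP; rewrite ?mulr0// => h.
by have := h f false; rewrite gf => /(_ (map_f _ fF)).
Qed.

Let p f := pi (carry (val o) f).

Let pD f f' : cts f -> cts f' -> p (fun phi => f phi + f' phi) = p f + p f'.
Proof.
move=> fc fc'; rewrite /p -piD; [|exact: Cc_carry|exact: Cc_carry].
congr pi; apply/funext => g; rewrite /carry; case: asboolP => _//.
by rewrite addr0.
Qed.

Let pZ c f : cts f -> p (fun phi => c * f phi) = c *: p f.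
Proof.
move=> fc; rewrite /p -piZ; last exact: Cc_carry.
congr pi; apply/funext => g; rewrite /carry; case: asboolP => _//.
by rewrite mulr0.
Qed.

(** This is where star-homomorphisms defined on C_c alone get a norm bound: the
    image of a unimodular function is a partial isometry. *)
Let p_unitary f : cts f -> (forall phi, (f phi)^* * f phi = 1) -> nrm (p f) <= 1.
Proof.
move=> fc fu; apply: nrm_isometry (srep_proj germ_rep_srep o).
rewrite /p -piA; last exact: Cc_carry.
rewrite involution_top -piM; [|exact/Cc_carry/cts_conj|exact: Cc_carry].
rewrite convolution_top; congr (pi (carry _ _)).
by apply/funext => phi; rewrite fu.
Qed.

Let p_Re f (M : R) : cts f -> 0 < M -> (forall phi, nrm (f phi) <= M) ->
  nrm (p (fun phi => (complex.Re (f phi))%:C%C)) <= M /\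
  cts (fun phi => (complex.Re (f phi))%:C%C : R[i]).
Proof.
move=> fc M0 fM.
pose u phi := lift_circle ((M^-1)%:C%C * f phi).
have f1 phi : nrm ((M^-1)%:C%C * f phi) <= 1.
  by rewrite nrmM nrm_real gtr0_norm ?invr_gt0// mulrC ler_pdivrMr// mul1r.
have uc : cts u.
  by apply: (@cts_unif _ (@lift_circle R) (fun c => nrm c <= 1)) (ctsZ _ fc) => //;
    exact: lift_circle_cts.
have u1 phi : (u phi)^* * u phi = 1 by exact: lift_circle_unit.
have E : (fun phi => (complex.Re (f phi))%:C%C : R[i]) =
    (fun phi => ((M / 2)%:C)%C * (u phi + (u phi)^*)).
  apply/funext => phi; rewrite lift_circle_avg -rmorphM; congr (_%:C)%C.
  have -> : complex.Re ((M^-1)%:C%C * f phi) = M^-1 * complex.Re (f phi).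
    by case: (f phi) => x y /=; rewrite mul0r subr0.
  by field; rewrite gt_eqF.
rewrite E; split; last by apply: ctsZ; apply: ctsD => //; exact: cts_conj.
rewrite pZ ?pD//; [|exact: cts_conj|by apply: ctsD => //; exact: cts_conj].
rewrite nrmZ nrm_real ger0_norm ?divr_ge0 ?(ltW M0)//.
have := p_unitary uc u1; have := p_unitary (cts_conj uc) _.
have h phi : (u phi)^*^* * (u phi)^* = 1 by rewrite conjCK mulrC u1.
move=> /(_ h) h1 h2; have := nrmD (p u) (p (fun phi => (u phi)^*)).
nra.
Qed.

(** [f] is split into real and imaginary parts, each of which is [M] times the real
    part of a continuous unimodular function. *)
Lemma pi_carry_bound s f (M : R) : cts f -> 0 < M -> (forall phi, nrm (f phi) <= M) ->
  nrm (pi (carry s f)) <= 2 * M.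
Proof.
move=> fc M0 fM.
have pf : nrm (p f) <= 2 * M.
  have [r1 r2] := p_Re fc M0 fM.
  pose f' phi := - 'i * f phi.
  have fM' phi : nrm (f' phi) <= M by rewrite nrmM nrmN nrm_i mul1r.
  have [i1 i2] := p_Re (ctsZ (- 'i) fc) M0 fM'.
  have -> : f = (fun phi => (complex.Re (f phi))%:C%C + 'i * (complex.Re (f' phi))%:C%C).
    apply/funext => phi; rewrite /f'; case: (f phi) => x y.
    rewrite -!complexiE; apply/eqP; rewrite eq_complex /=.
    by apply/andP; split; apply/eqP; ring.
  rewrite pD//; last exact: ctsZ.
  rewrite pZ// (le_trans (nrmD _ _))// nrmZ nrm_i mul1r.
  by move: i1; rewrite -/(f' _) => i1; lra.
rewrite -(convolution_indic_top ho s f) piM; [|exact: Cc_indic|exact: Cc_carry].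
rewrite (le_trans (nrm_cmul _ _))//.
have := srep_contr germ_rep_srep s; rewrite -/(germ_rep s) -/(p f).
have := nrm_ge0 (germ_rep s); have := nrm_ge0 (p f); nra.
Qed.

Lemma pi_integrates (f : garr G -> R[i]) : Cc f -> integrates germ_rep f (pi f).
Proof.
move=> /Cc_csumP[q ->]; elim: q => [|[s [f1 f1c]] q ih].
  have -> : csum [::] = steinberg [::].
    by apply/funext => g; rewrite /csum /steinberg !big_nil.
  by rewrite pi_steinberg; exact: integrates_lincomb.
rewrite csum_cons /= piD; [|exact: Cc_carry|exact: Cc_csum].
apply: integratesD ih; exists [:: s] => d d0.
have d2 : 0 < d / 2 by rewrite divr_gt0.
have [L [h [hc sub LE fh]]] := carry_approx s f1c d2.
exists L.
  split=> // g; rewrite LE /carry; case: asboolP => _; last by rewrite subrr nrm0 ltW.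
  by rewrite (le_trans (fh _))//; lra.
rewrite -pi_steinberg LE.
have hc' := ctsZ (-1) hc.
have -> : pi (carry s f1) - pi (carry s h) = pi (carry s (fun phi => f1 phi + -1 * h phi)).
  rewrite -scaleN1r -piZ; last exact: Cc_carry.
  rewrite -piD; [|exact: Cc_carry|]; last first.
    have -> : (fun x => -1 * carry s h x) = carry s (fun phi => -1 * h phi) :> (garr G -> _).
      by apply/funext => g; rewrite /carry; case: asboolP => _; rewrite ?mulr0.
    exact: Cc_carry.
  congr pi; apply/funext => g; rewrite /carry; case: asboolP => _//.
  by rewrite mulr0 addr0.
have -> : d = 2 * (d / 2) by lra.
apply: pi_carry_bound => //; first exact: ctsD.
by move=> phi; rewrite mulN1r.
Qed.

End Boundedness.
End CompactlySupported.

(** * Representations of the left inverse hull *)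

Section Hull.
Variables (P : monoidType) (hP : right_lcm [set: P]).
Local Notation S := (left_hull hP).
Local Notation rideal := (rideal [set: P]).
Implicit Types (p x y : P).

Lemma rideal1 : rideal 1%g = [set: P].
Proof. by apply/seteqP; split=> // x _; exists x => //; rewrite mul1g. Qed.

Lemma ridealI1l p : rideal 1%g `&` rideal p = rideal p.
Proof. by rewrite rideal1 setTI. Qed.

Lemma ridealI1r p : rideal p `&` rideal 1%g = rideal p.
Proof. by rewrite rideal1 setIT. Qed.

Lemma mem_rideal p x : rideal p (p * x)%g. Proof. by exists x. Qed.

Lemma mem_rideal1 p : rideal p p. Proof. by exists 1%g; rewrite ?mulg1. Qed.

Lemma Jset_rideal p : Jset [set: P] (rideal p). Proof. by right; exists p. Qed.

Lemma right_cancel p x y : (p * x = p * y)%g -> x = y.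
Proof. by case: hP => _ h _; exact: h. Qed.

(** Generators of the same principal right ideal differ by a unit. *)
Lemma rideal_eq p x : rideal p = rideal x -> exists2 u, invertible u & p = (x * u)%g.
Proof.
move=> E; have := mem_rideal1 p; rewrite E => -[u _ xu].
have := mem_rideal1 x; rewrite -E => -[w _ pw].
exists u => //; exists w; split.
  by apply: (@right_cancel x); rewrite mulgA xu pw mulg1.
by apply: (@right_cancel p); rewrite mulgA pw xu mulg1.
Qed.

Lemma bracketM_ll p x : (bracket hP p 1 * bracket hP x 1 = bracket hP (p * x) 1)%g.
Proof.
have := @hull_mulE _ hP p 1%g x 1%g x 1%g x (ridealI1l x) (mul1g x) (mulg1 x).
by rewrite mulg1.
Qed.

Lemma bracketM_lr p x : (bracket hP p 1 * bracket hP 1 x = bracket hP p x)%g.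
Proof.
have := @hull_mulE _ hP p 1%g 1%g x 1%g 1%g 1%g (ridealI1l 1%g) (mul1g 1%g) (mul1g 1%g).
by rewrite !mulg1.
Qed.

Lemma bracketM_rl p : (bracket hP 1 p * bracket hP p 1 = bracket hP 1 1)%g.
Proof.
have := @hull_mulE _ hP 1%g p p 1%g 1%g 1%g p (setIid _) (mulg1 p) (mulg1 p).
by rewrite !mulg1.
Qed.

Lemma bracket_idem p : (bracket hP p p * bracket hP p p == bracket hP p p)%g.
Proof.
by rewrite -(bracketM_lr p p) -mulgA (mulgA (bracket hP 1 p)) bracketM_rl
  (bracketM_lr 1 p).
Qed.

Definition hull_idem p : idem S := exist _ (bracket hP p p) (bracket_idem p).

Lemma hull_inv_bracket p x : sinv (bracket hP p x) = bracket hP x p.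
Proof. exact: hull_invE. Qed.

Lemma bracketM_rr p x : (bracket hP 1 x * bracket hP 1 p = bracket hP 1 (p * x))%g.
Proof.
rewrite -(hull_inv_bracket x 1) -(hull_inv_bracket p 1) -sinvM bracketM_ll.
exact: hull_inv_bracket.
Qed.

Lemma hull_top (s : S) : (s * val (hull_idem 1) = s)%g.
Proof.
have [->|[p [x ->]]] := bracketP s; first exact: (@mul0s S).
have := @hull_mulE _ hP p x 1%g 1%g 1%g x x (ridealI1r x) (mulg1 x) (mul1g x).
by rewrite mulg1 mul1g.
Qed.

Lemma hull_code : countable [set: P] ->
  exists code : idem S -> nat, injective code.
Proof.
move=> /countable_injP[c cinj].
exists (fun e : idem S => if val e is Some x then (choice.pickle (c (repr x).1, c (repr x).2)).+1 else 0%N).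
move=> e f; case Ee: (val e) => [x|]; case Ef: (val f) => [y|] // h; apply: val_inj;
  rewrite Ee Ef//; congr Some.
have [/cinj h1 /cinj h2] := pcan_inj (@choice.pickleK (nat * nat)%type) (succn_inj h).
have xy : repr x = repr y.
  have := h1 (mem_set I) (mem_set I); have := h2 (mem_set I) (mem_set I).
  by case: (repr x) (repr y) => a b [a' b'] /= -> ->.
by rewrite -[x]reprK -[y]reprK xy.
Qed.

Section FromSemigroup.
Variables (R : realType) (A : cstarType R) (one : A) (v : P -> A) (e : set P -> A).
Hypothesis ve : semigroup_rep one v e.

Let u1 : is_unit one. Proof. by case: ve. Qed.
Let viso p : adj (v p) ** v p = one. Proof. by case: ve => _ []. Qed.
Let vM p x : v p ** v x = v (p * x)%g. Proof. by case: ve. Qed.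
Let ecov p I : Jset [set: P] I -> v p ** e I ** adj (v p) = e [set (p * x)%g | x in I].
Proof. by case: ve => _ _ _ h _; exact: h. Qed.
Let eM I I' : Jset [set: P] I -> Jset [set: P] I' -> e I ** e I' = e (I `&` I').
Proof. by case: ve => _ _ _ _ [_ _ h]; exact: h. Qed.
Let eT : e [set: P] = one. Proof. by case: ve => _ _ _ _ []. Qed.
Let e0 : e set0 = 0. Proof. by case: ve => _ _ _ _ []. Qed.

Lemma proj_rideal p : e (rideal p) = v p ** adj (v p).
Proof.
by have := ecov p (Jset_rideal 1%g); rewrite rideal1 eT (u1 _).2 => ->.
Qed.

Lemma isometry_one : v 1%g = one.
Proof.
by rewrite -[LHS](u1 _).1 -(viso 1%g) -cmulA vM mulg1.
Qed.

(** The class of (p, q) is sent to v_p v_q^*; a representative has to be chosen,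
    and [hull_rep_bracket] shows that the choice does not matter. *)
Definition hull_rep (s : S) : A :=
  if s is Some x then v (repr x).1 ** adj (v (repr x).2) else 0.

Lemma unitary_invertible u : invertible u -> v u ** adj (v u) = one.
Proof.
move=> [w [uw wu]]; have vw : v u ** v w = one by rewrite vM uw isometry_one.
have -> : adj (v u) = v w by rewrite -[LHS](u1 _).2 -vw cmulA viso (u1 _).1.
exact: vw.
Qed.

Lemma hull_rep_bracket p x : hull_rep (bracket hP p x) = v p ** adj (v x).
Proof.
rewrite /hull_rep /bracket; case: piP => -[a b] /= /eqmodP /asboolP[u [iu]].
move=> /= -> ->; rewrite -!vM adjM -cmulA (cmulA (v u)) unitary_invertible//.
by rewrite (u1 _).1.
Qed.

(** v_b^* v_c = v_b^* e_(bP) e_(cP) v_c = v_b^* e_(rP) v_c, and the middle projection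
    is v_r v_r^* with r = b b' = c c'. *)
Lemma hull_rep_srep : srep hull_rep.
Proof.
split=> // [s t|s].
- have [->|[a [b ->]]] := bracketP s; first by rewrite mul0s cmul0x.
  have [->|[c [d ->]]] := bracketP t; first by rewrite (@muls0 S) cmulx0.
  have key : adj (v b) ** v c = adj (v b) ** e (rideal b `&` rideal c) ** v c.
    rewrite -eM; [|exact: Jset_rideal|exact: Jset_rideal].
    rewrite !proj_rideal !cmulA viso (u1 _).1 -!cmulA viso (u1 _).2 //.
  rewrite !hull_rep_bracket -!cmulA (cmulA (adj (v b))) key.
  have [I0|[r _ Ir]] : rideal b `&` rideal c = set0 \/
      exists2 r, [set: P] r & rideal b `&` rideal c = rideal r.
    by case: hP => _ _; exact.
  - have -> : (bracket hP a b * bracket hP c d)%g = None by exact: hull_mulE0.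
    by rewrite I0 e0 !(cmulx0, cmul0x).
  have : rideal r r by exact: mem_rideal1.
  rewrite -Ir => -[[b' _ hb] [c' _ hc]].
  have -> : (bracket hP a b * bracket hP c d)%g = bracket hP (a * b')%g (d * c')%g.
    exact: hull_mulE Ir hb hc.
  rewrite hull_rep_bracket Ir proj_rideal -{1}hb -hc -!vM !adjM !cmulA.
  rewrite -(cmulA (v a) (adj (v b))) viso (u1 _).2 -!cmulA.
  by rewrite (cmulA (adj (v c))) viso (u1 _).1.
- have [->|[p [x ->]]] := bracketP s; first by rewrite /= adj0.
  by rewrite hull_inv_bracket !hull_rep_bracket adjM adjK.
Qed.

Lemma hull_rep_top : hull_rep (val (hull_idem 1)) = one.
Proof. by rewrite hull_rep_bracket isometry_one (unit_adj u1) (u1 _).1. Qed.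

Lemma hull_rep_isometry p : hull_rep (bracket hP p 1) = v p.
Proof. by rewrite hull_rep_bracket isometry_one (unit_adj u1) (u1 _).2. Qed.

Lemma hull_rep_proj p : hull_rep (bracket hP p p) = e (rideal p).
Proof. by rewrite hull_rep_bracket proj_rideal. Qed.

Lemma relator_cut (F : seq P) :
  \big[@cmul R A/one]_(f <- F) (one - e (rideal f)) =
  cut hull_rep one [seq (hull_idem f, false) | f <- F].
Proof.
elim: F => [|f F ih]; first by rewrite big_nil.
rewrite big_cons ih cmulBl (u1 _).1; set c := cut _ _ _.
rewrite -[RHS]/(c - c ** hull_rep (val (hull_idem f))); congr (_ - _).
rewrite -hull_rep_proj -[bracket _ f f]/(val (hull_idem f)) -cutM.
by rewrite -(cut_mulT hull_rep_srep) (u1 _).1 (u1 _).2.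
Qed.

End FromSemigroup.

Section ToSemigroup.
Variables (R : realType) (A : cstarType R) (T : S -> A).
Hypothesis Trep : srep T.
Hypothesis T1 : is_unit (T (val (hull_idem 1))).

(** By [rideal_eq] the idempotent [p, p] depends only on the ideal p P. *)
Definition hull_proj (I : set P) : A :=
  if pselect (exists p, I = rideal p) is left h
  then T (bracket hP (sval (cid h)) (sval (cid h))) else 0.

Lemma hull_projE p : hull_proj (rideal p) = T (bracket hP p p).
Proof.
rewrite /hull_proj; case: pselect => [h|]; last by case; exists p.
have := svalP (cid h); move: (sval (cid h)) => x /rideal_eq[u iu ->].
by rewrite bracket_eq.
Qed.

Lemma hull_proj0 : hull_proj set0 = 0.
Proof.
rewrite /hull_proj; case: pselect => // -[p E]; exfalso.
by have := mem_rideal1 p; rewrite -E.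
Qed.

Lemma hull_semigroup_rep :
  semigroup_rep (T (val (hull_idem 1))) (fun p => T (bracket hP p 1)) hull_proj.
Proof.
have TM := srepM Trep; have TV := srepV Trep.
split=> //.
- split=> [p|I [->|[p _ ->]]].
  + by rewrite -TV hull_inv_bracket -TM bracketM_rl.
  + by rewrite hull_proj0; split; rewrite ?adj0 ?cmul0x.
  + by rewrite hull_projE; exact: (srep_proj Trep (hull_idem p)).
- by move=> p x; rewrite -TM bracketM_ll.
- move=> p I [->|[x _ ->]].
    by rewrite image_set0 hull_proj0 cmulx0 cmul0x.
  have -> : [set (p * y)%g | y in rideal x] = rideal (p * x)%g.
    apply/seteqP; split=> [_ [_ [y _ <-] <-]|_ [y _ <-]].
      by exists y; rewrite ?mulgA.
    by exists (x * y)%g; [exact: mem_rideal|rewrite mulgA].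
  rewrite !hull_projE -TV hull_inv_bracket -!TM -(bracketM_lr x x).
  by rewrite mulgA bracketM_ll -mulgA bracketM_rr bracketM_lr.
- split; [by rewrite -rideal1 hull_projE|exact: hull_proj0|].
  move=> I I' [->|[p _ ->]] [->|[x _ ->]];
    rewrite ?setI0 ?set0I ?hull_proj0 ?cmul0x ?cmulx0//.
  rewrite !hull_projE -TM.
  have [I0|[r _ Ir]] : rideal p `&` rideal x = set0 \/
      exists2 r, [set: P] r & rideal p `&` rideal x = rideal r.
    by case: hP => _ _; exact.
    have -> : (bracket hP p p * bracket hP x x)%g = None by exact: hull_mulE0.
    by rewrite I0 hull_proj0 (srep0 Trep).
  have : rideal r r by exact: mem_rideal1.
  rewrite -Ir => -[[b' _ hb] [c' _ hc]].
  have -> : (bracket hP p p * bracket hP x x)%g = bracket hP (p * b')%g (x * c')%g.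
    exact: hull_mulE Ir hb hc.
  by rewrite Ir hull_projE hb hc.
Qed.

End ToSemigroup.

End Hull.

(** * The quotients of the semigroup C*-algebra *)

Section Composition.
Variables (R : realType) (A B : cstarType R) (h : A -> B).
Hypothesis hh : star_hom h.

Lemma star_hom_comp (C : cstarType R) (k : B -> C) : star_hom k -> star_hom (k \o h).
Proof.
case: hh => h1 h2 h3 h4 [k1 k2 k3 k4]; split=> * /=.
- by rewrite h1 k1.
- by rewrite h2 k2.
- by rewrite h3 k3.
- by rewrite h4 k4.
Qed.

(** Closed because star-homomorphisms are contractive. *)
Lemma star_hom_kernel : closed_ideal [set x | h x = 0].
Proof.
have [h1 h2 h3 _] := hh; split=> /=.
- exact: hom0.
- by move=> x y hx hy; rewrite h1 hx hy addr0.
- by move=> c x hx; rewrite h2 hx scaler0.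
- by move=> x y hx; rewrite !h3 hx cmul0x cmulx0.
rewrite -openC openE => x /= hx.
have nx : 0 < nrm (h x).
  by rewrite lt_neqAle eq_sym nrm_ge0 andbT; apply/eqP => /nrm_eq0.
apply/nbhs_nrmP; exists (nrm (h x)) => // y xy hy.
have := hom_contract hh (x - y); rewrite (homB hh) hy subr0.
by move=> /le_lt_trans /(_ xy); rewrite ltxx.
Qed.

Variables (S : invSemigroupType) (T : S -> A).

Lemma hom_cut a l : h (cut T a l) = cut (h \o T) (h a) l.
Proof.
elim: l => //= -[e b] l <-; have [_ _ h3 _] := hh.
by rewrite /cut1 /=; case: b; rewrite ?(homB hh) h3.
Qed.

Lemma hom_srep : srep T -> srep (h \o T).
Proof.
move=> [t0 tM tV]; have [_ _ h3 h4] := hh; split=> * /=.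
- by rewrite t0 (hom0 hh).
- by rewrite tM h3.
- by rewrite tV h4.
Qed.

Lemma hom_lincomb L : h (lincomb T L) = lincomb (h \o T) L.
Proof.
have [_ h2 _ _] := hh; rewrite /lincomb (hom_sum hh).
by apply: eq_bigr => p _; rewrite h2.
Qed.

Lemma hom_integrates X f b : @integrates R S X A T f b ->
  @integrates R S X B (h \o T) f (h b).
Proof.
move=> [sg H]; exists sg => d /H[L aL bL]; exists L => //.
by rewrite -hom_lincomb -(homB hh) (le_trans (hom_contract hh _)).
Qed.

End Composition.

Section SubRepresentation.
Variables (R : realType) (S : invSemigroupType) (A : cstarType R) (T : S -> A).
Variable K : subcstar A.
Hypothesis KT : forall s, K (T s).

Definition sub_rep (s : S) : ss_cstar K := ss_lift (KT s).

Lemma sub_repE s : ss_incl (sub_rep s) = T s.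
Proof. exact: ss_liftK. Qed.

Lemma sub_rep_srep : srep T -> srep sub_rep.
Proof.
have jh := ss_incl_hom K; have [_ _ jM jA] := jh.
move=> [t0 tM tV]; split=> [|s t|s]; apply: ss_incl_inj.
- by rewrite sub_repE t0 (hom0 jh).
- by rewrite jM !sub_repE tM.
- by rewrite jA !sub_repE tV.
Qed.

End SubRepresentation.

Section Corner.
Variables (R : realType) (A : cstarType R) (p : A).
Hypothesis pproj : is_projection p.

Definition corner_set (x : A) := p ** x = x /\ x ** p = x.

Lemma corner_adj x : corner_set x -> corner_set (adj x).
Proof. by case: pproj => pa _ [x1 x2]; split; rewrite -[p]pa -adjM ?x1 ?x2. Qed.

Lemma corner_closed x :
  (forall d : R, 0 < d -> exists2 y, corner_set y & nrm (x - y) <= d) -> corner_set x.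
Proof.
have p1 := nrm_proj pproj.
move=> hx; split; apply: nrm_sub0 => d d0; have d2 : 0 < d / 2 by rewrite divr_gt0.
  have [y [y1 _] xy] := hx _ d2.
  have -> : p ** x - x = p ** (x - y) - (x - y) by rewrite cmulBr y1 opprB addrA subrK.
  rewrite (le_trans (nrmB _ _))//; have := nrm_cmul p (x - y).
  have := nrm_ge0 (x - y); have := nrm_ge0 p; nra.
have [y [_ y2] xy] := hx _ d2.
have -> : x ** p - x = (x - y) ** p - (x - y) by rewrite cmulBl y2 opprB addrA subrK.
rewrite (le_trans (nrmB _ _))//; have := nrm_cmul (x - y) p.
have := nrm_ge0 (x - y); have := nrm_ge0 p; nra.
Qed.

Definition corner : subcstar A.
Proof.
apply: (@SubCstar R A corner_set) corner_adj corner_closed.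
- by split; rewrite ?cmul0x ?cmulx0.
- by move=> x y [x1 x2] [y1 y2]; rewrite /corner_set cmulDl cmulDr x1 x2 y1 y2.
- by move=> c x [x1 x2]; rewrite /corner_set cmulZl cmulZr x1 x2.
- by move=> x y [x1 x2] [y1 y2]; rewrite /corner_set cmulA x1 -cmulA y2.
Defined.

End Corner.

Section ClosedSpan.
Variables (R : realType) (S : invSemigroupType) (A : cstarType R) (T : S -> A).
Hypothesis Trep : srep T.

Definition span_set (x : A) :=
  forall d : R, 0 < d -> exists L, nrm (x - lincomb T L) <= d.

Lemma span_setD x y : span_set x -> span_set y -> span_set (x + y).
Proof.
move=> hx hy d d0; have d2 : 0 < d / 2 by rewrite divr_gt0.
have [L hL] := hx _ d2; have [L' hL'] := hy _ d2; exists (L ++ L').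
rewrite lincomb_cat opprD addrACA (le_trans (nrmD _ _))//; lra.
Qed.

Lemma span_setZ (c : R[i]) x : span_set x -> span_set (c *: x).
Proof.
move=> hx d d0; have [b [b0 _ bc]] := small_scale (nrm_ge0 c) d0.
have [L hL] := hx _ b0; exists (scalel c L).
by rewrite lincomb_scale -scalerBr nrmZ (le_trans _ bc)// mulrC ler_wpM2r ?nrm_ge0.
Qed.

Lemma span_setM x y : span_set x -> span_set y -> span_set (x ** y).
Proof.
move=> hx hy d d0.
have K0 : 0 <= nrm x + nrm y + 1 by rewrite !addr_ge0 ?nrm_ge0.
have [c [c0 c1 cK]] := small_scale K0 d0.
have [L hL] := hx _ c0; have [L' hL'] := hy _ c0; exists (mull L L').
by rewrite (lincomb_mul Trep) (le_trans (nrm_mul_dist c1 hL hL')).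
Qed.

Lemma span_set_adj x : span_set x -> span_set (adj x).
Proof.
move=> hx d /hx[L hL]; exists (adjl L).
by rewrite (lincomb_adj Trep) -adjB nrm_adj.
Qed.

Lemma span_set_closed x :
  (forall d : R, 0 < d -> exists2 y, span_set y & nrm (x - y) <= d) -> span_set x.
Proof.
move=> hx d d0; have d2 : 0 < d / 2 by rewrite divr_gt0.
have [y hy xy] := hx _ d2; have [L hL] := hy _ d2; exists L.
by rewrite (le_trans (nrmB3 y _ _))//; lra.
Qed.

Lemma span_set_mem s : span_set (T s).
Proof.
move=> d d0; exists [:: (1, s)].
by rewrite /lincomb big_seq1 scale1r subrr nrm0 ltW.
Qed.

Lemma span_set0 : span_set 0.
Proof. by move=> d d0; exists [::]; rewrite /lincomb big_nil subrr nrm0 ltW. Qed.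

Definition closed_span : subcstar A :=
  SubCstar span_set0 span_setD span_setZ span_setM span_set_adj span_set_closed.

End ClosedSpan.

Section Presentation.
Variables (R : realType) (P : monoidType) (hP : right_lcm [set: P]).
Hypothesis countP : countable [set: P].
Local Notation S := (left_hull hP).
Local Notation o := (hull_idem hP 1).
Variable FF : set {fset P}.

(** The unit is the join of the idempotents [f, f], which on ideals says that the
    [f P] cover [P]. *)
Definition hull_relations : set (idem S * {fset idem S}) :=
  [set eF | exists2 F, FF F & eF = (o, [fset hull_idem hP f | f in F]%fset)].

Local Notation X := hull_relations.
Local Notation G := (germ_groupoid X).

Variables (C : cstarType R) (one : C) (v : P -> C) (e : set P -> C).
Hypothesis univ : is_semigroup_cstar one v e.

Definition covering_relators : set C :=
  [set \big[@cmul R C/one]_(f <- F) (one - e (rideal [set: P] f)) | F in FF].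

Variables (B : cstarType R) (q : C -> B).
Hypothesis quot : is_quotient covering_relators q.

Let ve : semigroup_rep one v e. Proof. by case: univ. Qed.
Let qh : star_hom q. Proof. by case: quot. Qed.
Let TC := hull_rep (hP := hP) v.
Let TB := q \o TC.
Let TCrep : srep TC := hull_rep_srep hP ve.
Let TBrep : srep TB := hom_srep qh TCrep.
Let ho : forall s : S, (s * val o)%g = s := @hull_top P hP.

Lemma cover_sub (F : {fset P}) :
  {subset [seq (hull_idem hP f, false) | f <- F] <=
    [seq (x, false) | x <- [fset hull_idem hP f | f in F]%fset]}.
Proof.
move=> _ /mapP[f fF ->]; apply/mapP; exists (hull_idem hP f) => //.
by apply/imfsetP; exists f.
Qed.

Lemma sub_cover (F : {fset P}) :
  {subset [seq (x, false) | x <- [fset hull_idem hP f | f in F]%fset] <=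
    [seq (hull_idem hP f, false) | f <- F]}.
Proof.
by move=> _ /mapP[_ /imfsetP[f /= fF ->] ->]; apply/mapP; exists f.
Qed.

Let TBX (x : idem S) (F : {fset idem S}) : X (x, F) -> obeys TB x F.
Proof.
move=> [F0 FF0 [-> ->]]; split=> [f _|].
  by rewrite (srep_idemC TBrep) (srep_top ho TBrep).
have : q (cut TC (TC (val o)) [seq (hull_idem hP f, false) | f <- F0]) = 0.
  rewrite /TC (hull_rep_top hP ve) -(relator_cut hP ve).
  have [_ _ kq] := quot; rewrite -[LHS]/(q _).
  suff : (q @^-1` [set 0]) (\big[@cmul R C/one]_(f <- F0) (one - e (rideal [set: P] f))).
    by [].
  by rewrite kq => W [_ sub]; apply: sub; exists F0.
rewrite (hom_cut qh) => h0; apply: (cut_sub0 TBrep) h0.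
exact: cover_sub.
Qed.

(** The value is determined by [integrates_uniq] and exists for [f] in C_c by
    [Cc_integrates]. *)
Definition groupoid_iota (f : garr G -> R[i]) : B := xget 0 [set b | integrates TB f b].

Lemma groupoid_iotaE f b : integrates TB f b -> groupoid_iota f = b.
Proof.
have [code code_inj] := hull_code hP countP; move=> fb.
have ex : exists c, [set c | integrates TB f c] c by exists b.
exact: (integrates_uniq ho code_inj TBrep TBX (xgetPex 0 ex) fb).
Qed.

Lemma groupoid_iotaP f : Cc f -> integrates TB f (groupoid_iota f).
Proof.
have [code code_inj] := hull_code hP countP => Cf.
have [b fb] := Cc_integrates ho code_inj TBrep TBX Cf.
by rewrite (groupoid_iotaE fb).
Qed.

Lemma iota_star_hom : Cc_star_hom groupoid_iota.
Proof.
have [code code_inj] := hull_code hP countP.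
split=> [f g Cf Cg|c f Cf|f g Cf Cg|f Cf]; apply: groupoid_iotaE.
- by apply: integratesD; exact: groupoid_iotaP.
- by apply: integratesZ; exact: groupoid_iotaP.
- by apply: (integratesM ho TBrep); exact: groupoid_iotaP.
- by apply: (integratesA TBrep); exact: groupoid_iotaP.
Qed.

(** The closed span of the [TC s] satisfies the universal property of [C]:
    the uniqueness in that property makes it all of [C]. *)
Lemma span_dense (x : C) (d : R) : 0 < d -> exists L, nrm (x - lincomb TC L) <= d.
Proof.
pose K := closed_span TCrep; pose TK := sub_rep (K := K) (span_set_mem TC).
have TKE s : ss_incl (TK s) = TC s by exact: sub_repE.
have TKrep : srep TK by exact: sub_rep_srep.
have jh := ss_incl_hom K; have [_ _ jM _] := jh.
have TK1 : is_unit (TK (val o)).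
  have [u _ _ _ _] := ve.
  move=> y; split; apply: ss_incl_inj; rewrite jM TKE /TC (hull_rep_top hP ve).
    exact: (u _).1.
  exact: (u _).2.
have [_ un] := univ.
have [g [[gh gv ge] _]] := un _ _ _ _ (hull_semigroup_rep TKrep TK1).
have [id' [_ idu]] := un _ _ _ _ ve.
have E1 : id' = @ss_incl R C K \o g.
  apply: idu; split; first exact: (star_hom_comp gh jh).
    by move=> p /=; rewrite gv TKE /TC (hull_rep_isometry hP ve).
  move=> I JI /=; rewrite ge//; case: JI => [->|[p _ ->]].
    by rewrite hull_proj0 (hom0 jh); have [_ _ _ _ [_ -> _]] := ve.
  by rewrite hull_projE TKE /TC (hull_rep_proj hP ve).
have E2 : id' = idfun by apply: idu; split.
have xE : x = ss_incl (g x) by rewrite -[LHS]/(idfun x) -E2 E1.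
have : span_set TC (ss_incl (g x)) := ss_incl_in (g x).
by rewrite -xE; apply.
Qed.

Lemma iota_dense : dense (groupoid_iota @` @Cc R G).
Proof.
move=> O [y Oy] oO; have [_ qs _] := quot; have [x xy] := qs y.
have /nbhs_nrmP[d d0 dO] : nbhs y O by exact: open_nbhs_nbhs.
have d2 : 0 < d / 2 by rewrite divr_gt0.
have [L hL] := span_dense x d2.
exists (lincomb TB L); split.
  apply: dO; rewrite -xy -(hom_lincomb qh) -(homB qh).
  by rewrite (le_lt_trans (hom_contract qh _))// (le_lt_trans hL)//; lra.
have [code code_inj] := hull_code hP countP.
exists (steinberg L).
  by have [q' ->] := steinberg_csum X L; exact: (Cc_csum ho code_inj).
exact/groupoid_iotaE/(integrates_lincomb X ho).
Qed.

(** Both [pi f] and the image of [groupoid_iota f] integrate [f] with respect to the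
    representation s |-> pi(1_s), so they agree. *)
Lemma iota_universal (D : cstarType R) (pi : (garr G -> R[i]) -> D) :
  Cc_star_hom pi -> forall f, Cc f -> `|pi f| <= `|groupoid_iota f|.
Proof.
move=> hpi f Cf; have [code code_inj] := hull_code hP countP.
pose T := germ_rep pi.
have Trep : srep T := germ_rep_srep ho code_inj hpi.
have TX x F : X (x, F) -> obeys T x F := @germ_rep_obeys _ _ _ _ ho _ code_inj _ _ hpi x F.
pose K := corner (srep_proj Trep o).
have KT s : K (T s).
  split; last exact: (srep_top ho Trep).
  by rewrite -[T s]adjK -(srep_proj Trep o).1 -adjM -(srepV Trep) (srep_top ho Trep).
pose TK := sub_rep KT.
have TKE s : ss_incl (TK s) = T s by exact: sub_repE.
have TKrep : srep TK by exact: sub_rep_srep.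
have jh := ss_incl_hom K; have [_ _ jM _] := jh.
have TK1 : is_unit (TK (val o)).
  by move=> y; have [y1 y2] := ss_incl_in y; split; apply: ss_incl_inj; rewrite jM TKE.
have [_ un] := univ.
have [g [[gh gv ge] _]] := un _ _ _ _ (hull_semigroup_rep TKrep TK1).
have gT s : g (TC s) = TK s.
  have [_ _ gM gA] := gh.
  have [->|[a [b ->]]] := bracketP s.
    by rewrite [RHS](srep0 TKrep) (hom0 gh).
  rewrite /TC (hull_rep_bracket hP ve) gM gA !gv -(srepV TKrep) hull_inv_bracket.
  by rewrite -(srepM TKrep) bracketM_lr.
have gW : covering_relators `<=` [set x | g x = 0].
  move=> _ [F FF0 <-] /=; rewrite (relator_cut hP ve) (hom_cut gh).
  apply: ss_incl_inj; rewrite (hom_cut jh) (hom0 jh).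
  have -> : @ss_incl R D K \o (g \o TC) = T by apply/funext => s /=; rewrite gT TKE.
  rewrite -(hull_rep_top hP ve) -/TC gT TKE.
  apply: (cut_sub0 Trep (sub_cover (F := F))).
  by have [] := TX o [fset hull_idem hP f | f in F]%fset (ex_intro2 _ _ F FF0 erefl).
have [_ qs kq] := quot.
have qg x y : q x = q y -> g x = g y.
  move=> qxy; apply/eqP; rewrite -subr_eq0 -(homB gh); apply/eqP.
  have : (q @^-1` [set 0]) (x - y) by rewrite /= (homB qh) qxy subrr.
  by rewrite kq => sm; exact: (sm _ (conj (star_hom_kernel gh) gW)).
have [sec secK] := choice qs.
pose k y := g (sec y).
have kq' x : k (q x) = g x by apply: qg; rewrite secK.
have kh : star_hom k.
  have [g1 g2 g3 g4] := gh; have [q1 q2 q3 q4] := qh.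
  split.
  - by move=> x y; rewrite -g1; apply: qg; rewrite q1 !secK.
  - by move=> c x; rewrite -g2; apply: qg; rewrite q2 !secK.
  - by move=> x y; rewrite -g3; apply: qg; rewrite q3 !secK.
  - by move=> x; rewrite -g4; apply: qg; rewrite q4 !secK.
have jkh : star_hom (@ss_incl R D K \o k) := star_hom_comp kh jh.
have jkT : (@ss_incl R D K \o k) \o TB = T.
  by apply/funext => s /=; rewrite kq' gT TKE.
have := hom_integrates jkh (groupoid_iotaP Cf); rewrite jkT => i1.
have i2 := pi_integrates ho code_inj hpi Cf.
rewrite (integrates_uniq ho code_inj Trep TX i2 i1) !nrmE lecR.
exact: (hom_contract jkh).
Qed.

(** The common form of the two statements: the relators are attached to an arbitrary
    family of finite subsets of [P]. *)
Theorem quotient_groupoid_cstar : is_groupoid_cstar groupoid_iota.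
Proof.
by split; [exact: iota_star_hom|exact: iota_dense|move=> D pi; exact: iota_universal].
Qed.

End Presentation.

Lemma isomorphic_refl (R : realType) (B : cstarType R) : isomorphic B B.
Proof. by exists id; [split|exists id]. Qed.

Theorem corollary7p7 (R : realType) (P : monoidType)
    (hP : right_lcm [set: P]) (U A : set P) :
  countable [set: P] ->
  zappa_szep U A ->
  right_lcm U -> right_lcm A ->
  (forall I I', Jset A I -> Jset A I' -> I `<=` I' \/ I' `<=` I) ->
  (forall a, A a -> set_bij U U (zs_act U A a)) ->
  (exists X : set (idem (left_hull hP) * {fset idem (left_hull hP)}),
     forall B : cstarType R, is_cstar_A A B ->
       exists (D : cstarType R) (iota : (garr (germ_groupoid X) -> R[i]) -> D),
         is_groupoid_cstar iota /\ isomorphic B D) /\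
  (exists X : set (idem (left_hull hP) * {fset idem (left_hull hP)}),
     forall B : cstarType R, is_cstar_U U B ->
       exists (D : cstarType R) (iota : (garr (germ_groupoid X) -> R[i]) -> D),
         is_groupoid_cstar iota /\ isomorphic B D).
Proof.
move=> countP _ _ _ _ _; split.
(* e_(aP) = 1 is the relation attached to the one-element set {a}. *)
- exists (hull_relations [set [fset a]%fset | a in A]) => B.
  move=> [C [one [v [e [q [univ quot]]]]]].
  have relE : relators_A A one e = covering_relators [set [fset a]%fset | a in A] one e.
    rewrite /relators_A /covering_relators image_comp; congr (_ @` _).
    apply/funext => a /=; have -> : enum_fset [fset a]%fset = [:: a].
      apply: perm_small_eq => //; apply: uniq_perm => [||x]; rewrite ?fset_uniq//.
      by rewrite -[LHS]/(x \in [fset a]%fset) in_fset1 inE.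
    rewrite big_cons big_nil.
    by case: univ => -[u _ _ _ _] _; rewrite (u _).2.
  rewrite relE in quot.
  exists B, (groupoid_iota v q).
  split; last exact: isomorphic_refl.
  exact: (quotient_groupoid_cstar hP countP univ quot).
- exists (hull_relations (foundation_set U)) => B.
  move=> [C [one [v [e [q [univ quot]]]]]].
  exists B, (groupoid_iota v q).
  split; last exact: isomorphic_refl.
  exact: (quotient_groupoid_cstar hP countP univ quot).
Qed.
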